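(* Let $H$ be a Hilbert space, $\mathrm{Gr}(0)=H\oplus\{0\}$ the graph of the null operator and $\mathrm{Gr}(T)$ the graph of a densely defined closed operator $T$ on $H$ with domain $\mathcal{D}(T)$. There is a unique minimal geodesic $\gamma:[0,1]\to\mathrm{Grass}(H\oplus H)$ such that $\gamma(0)=P_{\mathrm{Gr}(0)}$ and $\gamma(1)=P_{\mathrm{Gr}(T)}$, and it consists of orthogonal projections onto graphs: writing $\dot\gamma(0)=\begin{pmatrix} 0 & a \\ a^* & 0 \end{pmatrix}$ with $a\in B(H)$, one has $\|a\|\le\pi/2$ and, for $t\in[0,1)$, $$\gamma(t)=P_{\mathrm{Gr}(A(t))},\qquad A(t)=ta^*(\operatorname{sinc}|ta^*|)(\cos|ta^*|)^{-1}=v\tan|ta^*|\in B(H),$$ where $v$ is the partial isometry of the polar decomposition $a^*=v|a^*|$.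
   Context: $\mathrm{Grass}(H\oplus H)$ is the manifold of orthogonal projections of $H\oplus H$, and $P_V$ is the orthogonal projection onto $V$. The tangent space at $\tilde p$ is $\{X\in B(H\oplus H):X^*=X,\ X\tilde p+\tilde pX=X\}$; geodesics are the curves $\gamma(t)=e^{t\tilde X}\tilde pe^{-t\tilde X}$ with $X$ tangent at $\tilde p$ and $\tilde X=X\tilde p-\tilde pX$ (so $\gamma(0)=\tilde p$, $\dot\gamma(0)=X$). The Finsler length of a curve is $\int\|\dot\gamma(t)\|\,dt$ with the operator norm; a geodesic on $[0,1]$ is minimal if its length is the infimum of the lengths of curves of projections with the same endpoints. $|b|=(b^*b)^{1/2}$ (so $|a^*|=(aa^* )^{1/2}$), and $\operatorname{sinc}(x)=\sin(x)/x$, $\operatorname{sinc}(0)=1$. *)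

(* Defs.v *)
From HB Require Import structures.
From mathcomp Require Import all_boot all_order all_algebra.
From mathcomp Require Import sesquilinear complex ring.
From mathcomp Require Import all_classical all_reals all_analysis.

Set Implicit Arguments.
Unset Strict Implicit.
Unset Printing Implicit Defensive.

Import Order.TTheory GRing.Theory Num.Theory.
Import numFieldNormedType.Exports.

Local Open Scope classical_set_scope.
Local Open Scope ring_scope.
Local Open Scope complex_scope.

(* The inner product is linear in its first argument. *)
HB.mixin Record isHilbert (R : realType) H & CompleteNormedModule R[i] H := {
  hdot : {dot H for Num.conj};
  hdotxx : forall x : H, hdot x x = `|x| ^+ 2
}.

#[short(type="hilbertType")]
HB.structure Definition Hilbert (R : realType) :=
  {H of CompleteNormedModule R[i] H & isHilbert R H}.

(* H ⊕ H is an alias of H * H because the library norms the latter by the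
   maximum of the norms of the components. *)
Definition hsum (R : realType) (H : hilbertType R) : Type := (H * H)%type.

Section HilbertSum.
Variables (R : realType) (H : hilbertType R).
Local Notation hsum := (hsum H).
Implicit Types x y : hsum.

HB.instance Definition _ := GRing.Lmodule.copy hsum (H * H)%type.

Definition hsum_dot x y : R[i] := hdot x.1 y.1 + hdot x.2 y.2.

Let hsum_dot_bilinear :
  bilinear_for ( *%R : GRing.Scale.law _ _)
    (Num.conj \; *%R : GRing.Scale.law _ _) hsum_dot.
Proof.
split=> [y a x z|x a y z] /=; rewrite /hsum_dot /=.
  by rewrite !linearPl /= mulrDr addrACA.
by rewrite !linearPr /= mulrDr addrACA.
Qed.

HB.instance Definition _ := bilinear_isBilinear.Build R[i] hsum hsum R[i]
  ( *%R : GRing.Scale.law _ _) (Num.conj \; *%R : GRing.Scale.law _ _)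
  hsum_dot hsum_dot_bilinear.

Let hsum_dot_herm x y : hsum_dot x y = (-1) ^+ false * Num.conj (hsum_dot y x).
Proof.
by rewrite /hsum_dot rmorphD mulrDr -!hermitian_subproof.
Qed.

HB.instance Definition _ := isHermitianSesquilinear.Build R[i] hsum false
  Num.conj hsum_dot hsum_dot_herm.

Let hsum_dot_gt0 x : x != 0 -> 0 < hsum_dot x x.
Proof.
case: x => x y; rewrite -[0]/(0, 0) xpair_eqE negb_and /hsum_dot /= !hdotxx.
by case/orP=> h; [apply: ltr_wpDr|apply: ltr_wpDl];
   rewrite ?exprn_ge0 ?exprn_gt0 ?normr_gt0.
Qed.

HB.instance Definition _ :=
  isDotProduct.Build R[i] hsum hsum_dot hsum_dot_gt0.

Definition hsum_norm x : R[i] := sqrtC (`|x.1| ^+ 2 + `|x.2| ^+ 2).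

Let hsum_norm_ge0 x : 0 <= hsum_norm x.
Proof. by rewrite sqrtC_ge0 addr_ge0 ?exprn_ge0. Qed.

Let sqr_hsum_norm x : hsum_norm x ^+ 2 = `|x.1| ^+ 2 + `|x.2| ^+ 2.
Proof. exact: sqrtCK. Qed.

Let hsum_normD x y : hsum_norm (x + y) <= hsum_norm x + hsum_norm y.
Proof.
rewrite -(@ler_pXn2r _ 2) ?nnegrE ?addr_ge0 ?hsum_norm_ge0 //.
rewrite sqrrD !sqr_hsum_norm.
set a := `|x.1|; set b := `|x.2|; set c := `|y.1|; set d := `|y.2|.
have [a0 b0 c0 d0] : [/\ 0 <= a, 0 <= b, 0 <= c & 0 <= d] by rewrite !normr_ge0.
apply: (@le_trans _ _ ((a + c) ^+ 2 + (b + d) ^+ 2)).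
  by apply: lerD; rewrite ler_pXn2r ?nnegrE ?addr_ge0 ?ler_normD.
have -> : (a + c) ^+ 2 + (b + d) ^+ 2 =
  a ^+ 2 + b ^+ 2 + (a * c + b * d) *+ 2 + (c ^+ 2 + d ^+ 2) by ring.
rewrite lerD2r lerD2l ler_wMn2r //.
rewrite -(@ler_pXn2r _ 2) ?nnegrE ?addr_ge0 ?mulr_ge0 ?hsum_norm_ge0 //.
rewrite exprMn !sqr_hsum_norm -/a -/b -/c -/d -subr_ge0.
have -> : (a ^+ 2 + b ^+ 2) * (c ^+ 2 + d ^+ 2) - (a * c + b * d) ^+ 2 =
  (a * d - b * c) ^+ 2 by ring.
by rewrite -realEsqr rpredB // ger0_real // mulr_ge0.
Qed.

Let hsum_normZ l x : hsum_norm (l *: x) = `|l| * hsum_norm x.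
Proof.
apply/eqP; rewrite -(@eqrXn2 _ 2) ?mulr_ge0 ?hsum_norm_ge0 //.
by rewrite exprMn !sqr_hsum_norm /= !normrZ !exprMn mulrDr.
Qed.

Let hsum_norm_eq0 x : hsum_norm x = 0 -> x = 0.
Proof.
move/eqP; rewrite sqrtC_eq0 paddr_eq0 ?exprn_ge0 // !expf_eq0 !normr_eq0 /=.
by case: x => x y /= /andP[/eqP-> /eqP->].
Qed.

HB.instance Definition _ :=
  Lmodule_isNormed.Build R[i] hsum hsum_normD hsum_normZ hsum_norm_eq0.

Let hsum_normE x : `|x| = hsum_norm x. Proof. by []. Qed.

Let norm_fst_le x : `|x.1| <= `|x|.
Proof.
rewrite -(@ler_pXn2r _ 2) ?nnegrE // hsum_normE sqr_hsum_norm.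
by rewrite lerDl exprn_ge0.
Qed.

Let norm_snd_le x : `|x.2| <= `|x|.
Proof.
rewrite -(@ler_pXn2r _ 2) ?nnegrE // hsum_normE sqr_hsum_norm.
by rewrite lerDr exprn_ge0.
Qed.

Let hsum_norm_le x : `|x| <= `|x.1| + `|x.2|.
Proof.
rewrite -(@ler_pXn2r _ 2) ?nnegrE ?addr_ge0 // hsum_normE sqr_hsum_norm.
by rewrite sqrrD lerD2r lerDl mulrn_wge0 ?mulr_ge0.
Qed.

Let hsum_complete (F : set_system hsum) :
  ProperFilter F -> cauchy F -> cvg F.
Proof.
move=> FF /cauchy_ballP Fc.
have cauchy_proj (p : hsum -> H) :
    (forall x y, p (x - y) = p x - p y) -> (forall x, `|p x| <= `|x|) ->
    cvg (p @ F).
  move=> pB ple; apply: cauchy_cvg; apply/cauchy_ballP => e e0.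
  have [[A B] /= [FA FB] AB] := Fc _ e0.
  exists (p @` A, p @` B) => /=.
    split; [apply: filterS FA|apply: filterS FB] => x Ax; exact: imageP.
  move=> [_ _] /= [[x Ax <-] [y By <-]].
  have := AB (x, y) (conj Ax By).
  rewrite -!ball_normE /= => xy.
  by rewrite -pB (le_lt_trans (ple _)).
have /cvg_ex[/= l1 c1] := @cauchy_proj fst (fun _ _ => erefl) norm_fst_le.
have /cvg_ex[/= l2 c2] := @cauchy_proj snd (fun _ _ => erefl) norm_snd_le.
apply/cvg_ex; exists ((l1, l2) : hsum).
apply/(@cvgrPdist_lt _ hsum _ F FF id) => e e0.
have e20 : 0 < e / 2 by rewrite divr_gt0.
move/cvgrPdist_lt: c1 => /(_ _ e20) n1; move/cvgrPdist_lt: c2 => /(_ _ e20) n2.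
near=> x.
rewrite (le_lt_trans (hsum_norm_le _)) // [e]splitr ltrD //=.
  by near: x.
by near: x.
Unshelve. all: by end_near. Qed.

HB.instance Definition _ := Uniform_isComplete.Build hsum hsum_complete.

Let hsum_dotxx x : hsum_dot x x = `|x| ^+ 2.
Proof. by rewrite hsum_normE sqr_hsum_norm /hsum_dot !hdotxx. Qed.

HB.instance Definition _ := isHilbert.Build R hsum hsum_dotxx.

End HilbertSum.

(* B(V), normed by the operator norm. *)
Section BoundedOperators.
Variables (R : realType) (V : normedModType R[i]).

Definition is_bop : {pred V -> V} :=
  [pred f | `[< linear f /\ continuous f >]].

Record bop := Bop { bop_fun :> V -> V; _ : bop_fun \in is_bop }.

HB.instance Definition _ := [isSub for bop_fun].
HB.instance Definition _ := [Choice of bop by <:].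

Implicit Types A B C : bop.

Let is_bopP f : reflect (linear f /\ continuous f) (f \in is_bop).
Proof. exact: asboolP. Qed.

Let bop_linear A : linear A.
Proof. by case: A => f /= /is_bopP[]. Qed.

HB.instance Definition _ A :=
  GRing.isLinear.Build R[i] V V *:%R (bop_fun A) (bop_linear A).

Lemma bop_continuous A : continuous A.
Proof. by case: A => f /= /is_bopP[]. Qed.

Let bop_submod : submod_closed is_bop.
Proof.
split=> [|a f g /is_bopP[fl fc] /is_bopP[gl gc]]; apply/is_bopP.
  split=> [b x y|]; last exact: cst_continuous.
  by rewrite /= scaler0 addr0.
split=> [b x y|x].
  rewrite !fctE fl gl !scalerDr !scalerA mulrC addrACA.
  by congr (_ + _ + _); rewrite addrC.
rewrite !fctE.
by apply: cvgD; [apply: cvgZr; exact: fc|exact: gc].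
Qed.

HB.instance Definition _ :=
  GRing.isSubmodClosed.Build R[i] (V -> V) is_bop bop_submod.
HB.instance Definition _ := [SubChoice_isSubLmodule of bop by <:].

Lemma bopP A B : A =1 B -> A = B.
Proof. by move=> AB; apply/val_inj/funext. Qed.

Let one_subproof : idfun \in is_bop.
Proof. by apply/is_bopP; split=> // x; exact: cvg_id. Qed.

Definition bop_one := Bop one_subproof.

Let mul_subproof A B : A \o B \in is_bop.
Proof.
apply/is_bopP; split=> [a x y|x] /=; first by rewrite !linearP.
by apply: continuous_comp; exact: bop_continuous.
Qed.

Definition bop_mul A B := Bop (mul_subproof A B).

Let bop_mulA : associative bop_mul.
Proof. by move=> A B C; apply: bopP. Qed.
Let bop_mul1l : left_id bop_one bop_mul.
Proof. by move=> A; apply: bopP. Qed.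
Let bop_mul1r : right_id bop_one bop_mul.
Proof. by move=> A; apply: bopP. Qed.
Let bop_mulDl : left_distributive bop_mul +%R.
Proof. by move=> A B C; apply: bopP. Qed.
Let bop_mulDr : right_distributive bop_mul +%R.
Proof. by move=> A B C; apply: bopP => x /=; rewrite linearD. Qed.

HB.instance Definition _ := GRing.Zmodule_isPzRing.Build bop
  bop_mulA bop_mul1l bop_mul1r bop_mulDl bop_mulDr.

Definition opnorm A : R :=
  sup [set complex.Re `|A x| | x in [set x : V | `|x| <= 1]].

Let ReE (x : V) : (complex.Re `|x|)%:C = `|x|.
Proof. by rewrite RRe_real // normr_real. Qed.

Let opnorm_has_sup A :
  has_sup [set complex.Re `|A x| | x in [set x : V | `|x| <= 1]].
Proof.
split; first by exists (complex.Re `|A 0|), 0; rewrite //= normr0.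
have /linear_bounded_continuous/linear_boundedP/pinfty_ex_gt0[r r0 Ar] :=
  @bop_continuous A.
exists (complex.Re r) => _ [x /= x1 <-].
rewrite -lecR ReE RRe_real ?gtr0_real // (le_trans (Ar x)) //.
by rewrite -[leRHS]mulr1 ler_wpM2l // ltW.
Qed.

Let opnorm_ge0 A : 0 <= opnorm A.
Proof.
have <- : complex.Re `|A 0| = 0 by rewrite raddf0 normr0.
by apply: ub_le_sup; [case: (opnorm_has_sup A)|exists 0; rewrite //= normr0].
Qed.

Lemma le_opnorm A x : `|A x| <= (opnorm A)%:C * `|x|.
Proof.
have [->|x0] := eqVneq x 0; first by rewrite raddf0 !normr0 mulr0.
rewrite -ler_pdivrMr ?normr_gt0 // mulrC.
pose n := `|x|^-1; have nV : `|n| = n by rewrite ger0_norm // invr_ge0.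
rewrite -/n; have <- : `|A (n *: x)| = n * `|A x|.
  by rewrite linearZ /= normrZ nV.
rewrite -ReE lecR; apply: ub_le_sup; first by case: (opnorm_has_sup A).
by exists (n *: x) => //=; rewrite normrZ nV mulVf ?normr_eq0.
Qed.

Lemma opnorm_le A (r : R) : 0 <= r ->
  (forall x, `|A x| <= r%:C * `|x|) -> opnorm A <= r.
Proof.
move=> r0 Ar; apply: ge_sup; first by case: (opnorm_has_sup A).
move=> _ [x /= x1 <-]; rewrite -lecR ReE (le_trans (Ar x)) //.
by rewrite -[leRHS]mulr1 ler_wpM2l // ler0c.
Qed.

Let opnormD A B : (opnorm (A + B))%:C <= (opnorm A)%:C + (opnorm B)%:C.
Proof.
rewrite -rmorphD /= lecR; apply: opnorm_le; first by rewrite addr_ge0.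
move=> x; rewrite rmorphD /= mulrDl (le_trans (ler_normD _ _)) //.
by rewrite lerD // le_opnorm.
Qed.

Let opnormZ_le (l : R[i]) A : (opnorm (l *: A))%:C <= `|l| * (opnorm A)%:C.
Proof.
have lE : `|l| = (complex.Re `|l|)%:C by rewrite RRe_real // normr_real.
have l0 : 0 <= complex.Re `|l| by rewrite -ler0c -lE.
rewrite lE -rmorphM /= lecR; apply: opnorm_le; first by rewrite mulr_ge0.
move=> x; rewrite rmorphM /= -lE -mulrA normrZ.
by rewrite ler_wpM2l // le_opnorm.
Qed.

Let opnormZ (l : R[i]) A : (opnorm (l *: A))%:C = `|l| * (opnorm A)%:C.
Proof.
apply/eqP; rewrite eq_le opnormZ_le /=.
have [->|l0] := eqVneq l 0; first by rewrite normr0 mul0r ler0c.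
rewrite -ler_pdivlMl ?normr_gt0 // -normfV.
by rewrite (le_trans _ (opnormZ_le _ _)) // scalerA mulVf // scale1r.
Qed.

Let opnorm_eq0 A : (opnorm A)%:C = 0 -> A = 0.
Proof.
move=> A0; apply: bopP => x; apply/eqP; rewrite -normr_le0.
by rewrite (le_trans (le_opnorm _ _)) // A0 mul0r.
Qed.

HB.instance Definition _ :=
  Lmodule_isNormed.Build R[i] bop opnormD opnormZ opnorm_eq0.

Definition bexp A : bop := limn (series (fun n => (n`!%:R)^-1 *: A ^+ n)).

Definition spectrum A : set R[i] :=
  [set z | ~ exists B, (A - z *: (1 : bop)) * B = 1 /\ B * (A - z *: (1 : bop)) = 1].

End BoundedOperators.

Section HilbertOperators.
Variables (R : realType) (V : hilbertType R).
Local Notation "''[' u , v ]" := (hdot u%R v%R) : ring_scope.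
Implicit Types A B S F P X : bop V.

Definition is_adjoint A B := forall x y, '[A x, y] = '[x, B y].

Definition selfadjoint A := is_adjoint A A.

Definition is_projection P := P * P = P /\ selfadjoint P.

Definition is_projection_onto (E : set V) P :=
  is_projection P /\ range P = E.

Definition positive A := forall x, 0 <= '[A x, x].

(* S = (A^* A)^{1/2} *)
Definition is_abs A S :=
  positive S /\ exists2 B, is_adjoint A B & S * S = B * A.

Definition partial_isometry A :=
  forall x, (forall y, A y = 0 -> '[x, y] = 0) -> `|A x| = `|x|.

(* A = v |A|, S = |A| *)
Definition is_polar A v S :=
  [/\ is_abs A S, A = v * S, partial_isometry v &
      forall x, v x = 0 <-> A x = 0].

Definition bop_poly (p : {poly R}) S : bop V :=
  \sum_(i < size p) (p`_i)%:C *: S ^+ i.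

(* F = f(S) in the continuous functional calculus of the self-adjoint S: F is
   the norm limit of p_n(S) for polynomials p_n converging to f uniformly on
   the (real) spectrum of S. *)
Definition is_funcalc (f : R -> R) S F :=
  selfadjoint S /\
  forall e : R, 0 < e -> exists p : {poly R},
    (forall x : R, spectrum S x%:C -> `|p.[x] - f x| <= e) /\
    opnorm (bop_poly p S - F) <= e.

End HilbertOperators.

Section Grassmannian.
Variables (R : realType) (V : hilbertType R).
Implicit Types (p X : bop V) (c g : R -> bop V).

Definition tangent p X := selfadjoint X /\ X * p + p * X = X.

Definition is_geodesic g := exists p X, [/\ is_projection p, tangent p X &
  {in `[0, 1], forall t : R,
     let Y := t%:C *: (X * p - p * X) in g t = bexp Y * p * bexp (- Y)}].

(* Difference quotients inside [0, 1]: one-sided derivatives at 0 and 1. *)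
Definition quotients c (t : R) : set_system (bop V) :=
  (fun h : R => (h^-1)%:C *: (c (t + h) - c t)) @
    within [set h | t + h \in `[0, 1]] 0^'.

Definition velocity c (t : R) : bop V := lim (quotients c t).

(* Continuous on [0, 1] and C^1 off a finite set; this contains the piecewise
   C^1 curves. *)
Definition is_curve c :=
  [/\ {in `[0, 1], forall t, is_projection (c t)},
      {within `[0, 1], continuous c} &
      exists s : seq R, {in `]0, 1[, forall t, t \notin s ->
        cvg (quotients c t) /\ {for t, continuous (velocity c)}}].

Definition curve_length c : \bar R :=
  \int[lebesgue_measure]_(t in `[0, 1]) (opnorm (velocity c t))%:E.

Definition minimal_geodesic g := is_geodesic g /\
  curve_length g = ereal_inf
    [set curve_length c | c in
      [set c | [/\ is_curve c, c 0 = g 0 & c 1 = g 1]]].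

End Grassmannian.

Section Graphs.
Variables (R : realType) (H : hilbertType R).

Definition linear_on (D : set H) (T : H -> H) :=
  D 0 /\ forall (a : R[i]) x y, D x -> D y ->
    D (a *: x + y) /\ T (a *: x + y) = a *: T x + T y.

(* The values of T outside its domain D are irrelevant. *)
Definition graph (D : set H) (T : H -> H) : set (hsum H) :=
  [set z | D z.1 /\ z.2 = T z.1].

Definition closed_operator (D : set H) (T : H -> H) :=
  linear_on D T /\ closed (graph D T).

(* X = [[0, a], [b, 0]] as a block matrix. *)
Definition is_offdiag (a b : bop H) (X : bop (hsum H)) :=
  forall z : hsum H, X z = (a z.2, b z.1) :> hsum H.

End Graphs.

Definition sinc (R : realType) (x : R) : R :=
  if x == 0 then 1 else sin x / x.

(* Main.v *)
(* Let J and K be the reflections 2 p - 1 of p = P_Gr(0) and p = P_Gr(T). The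
   operators W = (K J + J K) / 2 and Z = (K - J K J) / 2 are self-adjoint, W
   commutes and Z anticommutes with J, K = W J + Z and W^2 + Z^2 = 1. As T is
   single-valued and densely defined, J + K is injective, so that W + 1 is
   injective and W = 1 on the kernel of Z. Let Th = arccos(W) / 2, E = sgn Z and
   X = E Th. Then X anticommutes with J, |X| <= pi / 2, cos 2X = W and
   sin 2X = Z. Since J X = - X J, the geodesic with velocity X at P_Gr(0) is
   (1 + (cos 2tX + (sin 2tX) J) J) / 2, which ends at P_Gr(T). These properties
   determine X: W determines X^2 = Th^2, hence Z = 2 X sinc(2 Th), and
   sinc(2 Th) is injective.

   Let c be a curve of length L between the two projections and x a unit vector
   in the range or in the kernel of P_Gr(0). Then u = <(2 c - 1) x, x> satisfies
   |u'| <= 2 |c'| sqrt(1 - u^2), so arccos u varies by at most 2 L. This gives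
   W >= cos 2L, that is, Th <= L and |X| <= L.

   In H + H, Th is block diagonal with upper left block S, and E is off-diagonal
   with lower left block v; then a^* = v S. Conjugating by the rotation by tX
   maps H + 0 onto the set of the vectors (cos(tS) x, v sin(tS) x), which for
   t < 1 is the graph of v tan(tS). *)

Require Import Defs.
From HB Require Import structures.
From mathcomp Require Import all_boot all_order all_algebra.
From mathcomp Require Import sesquilinear complex ring lra.
From mathcomp Require Import all_classical all_reals all_analysis.
From mathcomp Require Import measurable_realfun.

Set Implicit Arguments.
Unset Strict Implicit.
Unset Printing Implicit Defensive.

Import Order.TTheory GRing.Theory Num.Theory.
Import numFieldNormedType.Exports.

Local Open Scope classical_set_scope.
Local Open Scope ring_scope.
Local Open Scope complex_scope.

(** * The real inner product and bounded operators *)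

(** Every equality between functions of [W], [Z], [Th] and [X] is reduced to a pointwise equality of
    continuous real functions on an interval. The reduction rests on one estimate, that [p(S)] is
    bounded by the supremum of [|p|] on an interval containing the spectrum of [S]. It comes from
    Bernstein polynomials, whose values at an operator between 0 and 1 are visibly positive, so no
    spectral theorem enters. The one discontinuous function is sgn, reached by a strong limit whose
    increments are controlled by monotonicity. As [E] vanishes on the kernel of [Z], the identity
    [X * X = Th * Th] requires [Th] to vanish there too. This is what injectivity of [W + 1]
    provides: a vector with [W = -1] would have angle pi / 2 and no preferred direction. Even
    functions of [X] depend only on [X * X] and hence agree with those of [Th]; odd ones are [X]
    times an even one, which is how sinc enters. The bound on curves is applied only to lengths
    [L < |X| <= pi / 2], for which [2 L] stays in the interval where cos is decreasing. *)

Section RealInnerProduct.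
Variables (R : realType) (V : hilbertType R).
Implicit Types (x y z : V) (r : R).

(** The real part determines [hdot] (see [hdot_rdot]), so adjointness can be tested here, where the
    scalars are real and [lra], [nra] and [ring] apply. *)
Definition rdot x y : R := complex.Re (hdot x y).
Definition rnorm x : R := complex.Re `|x|.

Lemma rnormE x : `|x| = (rnorm x)%:C.
Proof. by rewrite /rnorm RRe_real // normr_real. Qed.

Lemma rnorm_ge0 x : 0 <= rnorm x.
Proof. by rewrite -ler0c -rnormE. Qed.

Lemma rdotxx x : rdot x x = rnorm x ^+ 2.
Proof. by rewrite /rdot hdotxx rnormE -rmorphXn. Qed.

Lemma rdotC x y : rdot x y = rdot y x.
Proof.
have conjE (z : R[i]) : complex.Re (Num.conj z) = complex.Re z by case: z.
by rewrite /rdot (hermC hdot x y) expr0 mul1r conjE.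
Qed.

Lemma rdotDl x y z : rdot (x + y) z = rdot x z + rdot y z.
Proof. by rewrite /rdot linearDl raddfD. Qed.

Lemma rdotNl x z : rdot (- x) z = - rdot x z.
Proof. by rewrite /rdot linearNl raddfN. Qed.

Lemma rdotZl r x z : rdot (r%:C *: x) z = r * rdot x z.
Proof.
rewrite /rdot linearZl_LR /=; case: (hdot x z) => a b /=.
by rewrite mul0r subr0.
Qed.

Lemma rdotDr x y z : rdot x (y + z) = rdot x y + rdot x z.
Proof. by rewrite rdotC rdotDl !(rdotC _ x). Qed.

Lemma rdotNr x z : rdot x (- z) = - rdot x z.
Proof. by rewrite rdotC rdotNl rdotC. Qed.

Lemma rdotZr r x z : rdot x (r%:C *: z) = r * rdot x z.
Proof. by rewrite rdotC rdotZl rdotC. Qed.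

Lemma rdotBl x y z : rdot (x - y) z = rdot x z - rdot y z.
Proof. by rewrite rdotDl rdotNl. Qed.

Lemma rdotBr x y z : rdot x (y - z) = rdot x y - rdot x z.
Proof. by rewrite rdotDr rdotNr. Qed.

Lemma rdot0l x : rdot 0 x = 0.
Proof. by rewrite -(subrr 0) rdotBl subrr. Qed.

Lemma rdot0r x : rdot x 0 = 0.
Proof. by rewrite rdotC rdot0l. Qed.

Lemma rdotxx_ge0 x : 0 <= rdot x x.
Proof. by rewrite rdotxx exprn_ge0 // rnorm_ge0. Qed.

Lemma rnorm_eq0 x : (rnorm x == 0) = (x == 0).
Proof. by rewrite -[RHS]normr_eq0 rnormE (inj_eq (@complexI R)). Qed.

Lemma rdotxx_eq0 x : (rdot x x == 0) = (x == 0).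
Proof. by rewrite rdotxx expf_eq0 /= rnorm_eq0. Qed.

Lemma rdot_inj x y : (forall z, rdot x z = rdot y z) -> x = y.
Proof.
move=> xy; apply/eqP; rewrite -subr_eq0 -rdotxx_eq0 rdotBl xy subrr.
by [].
Qed.

Lemma hdot_rdot x y : hdot x y = rdot x y +i* rdot x ('i *: y).
Proof.
rewrite /rdot linearZr_LR /=; case: (hdot x y) => a b /=.
by rewrite mul0r sub0r mulN1r opprK.
Qed.

Lemma rnormD x y : rnorm (x + y) <= rnorm x + rnorm y.
Proof. by rewrite -lecR rmorphD /= -!rnormE ler_normD. Qed.

Lemma rnormN x : rnorm (- x) = rnorm x.
Proof. by rewrite /rnorm normrN. Qed.

Lemma rnormZ r x : rnorm (r%:C *: x) = `|r| * rnorm x.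
Proof.
apply: (@complexI R); rewrite rmorphM /= -!rnormE normrZ normc_def /=.
by rewrite expr0n addr0 sqrtr_sqr.
Qed.

Lemma rnorm0 : rnorm 0 = 0.
Proof. by apply/eqP; rewrite rnorm_eq0. Qed.

Lemma rdot_le x y : rdot x y <= rnorm x * rnorm y.
Proof.
have [->|y0] := eqVneq y 0; first by rewrite rdot0r rnorm0 mulr0.
have [->|x0] := eqVneq x 0; first by rewrite rdot0l rnorm0 mul0r.
have xp : 0 < rnorm x by rewrite lt_def rnorm_eq0 x0 rnorm_ge0.
have yp : 0 < rnorm y by rewrite lt_def rnorm_eq0 y0 rnorm_ge0.
(* The square of [|y| x - |x| y] expands to [2 a b (a b - c)], so no division by a norm occurs. *)
have := rdotxx_ge0 ((rnorm y)%:C *: x - (rnorm x)%:C *: y).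
rewrite rdotBl !rdotBr !rdotZl !rdotZr !rdotxx (rdotC y x).
set a := rnorm x in xp *; set b := rnorm y in yp *; set c := rdot x y => h.
have ab : 0 < a * b by rewrite mulr_gt0.
have : 0 <= (a * b) * (2 * (a * b - c)) by nra.
by rewrite pmulr_rge0 // pmulr_rge0 // subr_ge0.
Qed.

Lemma normr_rdot_le x y : `|rdot x y| <= rnorm x * rnorm y.
Proof.
by rewrite ler_norml rdot_le andbT lerNl -rdotNl -(rnormN x) rdot_le.
Qed.

End RealInnerProduct.

Section OperatorNorm.
Variables (R : realType) (V : hilbertType R).
Implicit Types (A B C : bop V) (x y : V) (r : R).

Lemma mulbE A B x : (A * B) x = A (B x). Proof. by []. Qed.
Lemma onebE x : (1 : bop V) x = x. Proof. by []. Qed.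
Lemma addbE A B x : (A + B) x = A x + B x. Proof. by []. Qed.
Lemma oppbE A x : (- A) x = - A x. Proof. by []. Qed.
Lemma zerobE x : (0 : bop V) x = 0. Proof. by []. Qed.
Lemma scalebE (a : R[i]) A x : (a *: A) x = a *: A x. Proof. by []. Qed.

Lemma scalebAl (a : R[i]) A B : a *: (A * B) = (a *: A) * B.
Proof. exact: bopP. Qed.

Lemma scalebAr (a : R[i]) A B : a *: (A * B) = A * (a *: B).
Proof. by apply: bopP => x; rewrite mulbE !scalebE linearZ. Qed.

Lemma norm_bopE A : `|A| = (opnorm A)%:C. Proof. by []. Qed.

Lemma opnorm_ge0 A : 0 <= opnorm A.
Proof. by rewrite -ler0c -norm_bopE. Qed.

Lemma opnormN A : opnorm (- A) = opnorm A.
Proof. by apply: (@complexI R); rewrite -!norm_bopE normrN. Qed.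

Lemma opnormB A B : opnorm (A - B) = opnorm (B - A).
Proof. by rewrite -opnormN opprB. Qed.

Lemma opnormD A B : opnorm (A + B) <= opnorm A + opnorm B.
Proof. by rewrite -lecR rmorphD /= -!norm_bopE ler_normD. Qed.

Lemma opnorm0 : opnorm (0 : bop V) = 0.
Proof. by apply: (@complexI R); rewrite -norm_bopE normr0. Qed.

Lemma opnormZ r A : opnorm (r%:C *: A) = `|r| * opnorm A.
Proof.
apply: (@complexI R); rewrite rmorphM /= -!norm_bopE normrZ normc_def /=.
by rewrite expr0n addr0 sqrtr_sqr.
Qed.

Lemma opnorm_eq0 A : opnorm A = 0 -> A = 0.
Proof. by move=> A0; apply/eqP; rewrite -normr_eq0 norm_bopE A0. Qed.

Lemma rnorm_bop_le A x : rnorm (A x) <= opnorm A * rnorm x.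
Proof. by rewrite -lecR rmorphM /= -!rnormE le_opnorm. Qed.

Lemma opnorm_ler A r : 0 <= r ->
  (forall x, rnorm (A x) <= r * rnorm x) -> opnorm A <= r.
Proof.
move=> r0 Ar; apply: opnorm_le => // x.
by rewrite !rnormE -rmorphM lecR.
Qed.

Lemma opnormM A B : opnorm (A * B) <= opnorm A * opnorm B.
Proof.
apply: opnorm_ler; first by rewrite mulr_ge0 ?opnorm_ge0.
move=> x; rewrite mulbE (le_trans (rnorm_bop_le _ _)) // -mulrA.
by rewrite ler_wpM2l ?opnorm_ge0 // rnorm_bop_le.
Qed.

Lemma bop_ex (f : V -> V) (r : R) : linear f ->
  (forall x, rnorm (f x) <= r * rnorm x) -> exists A : bop V, forall x, A x = f x.
Proof.
move=> flin fr.
pose g : {linear V -> V} :=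
  HB.pack f (GRing.isLinear.Build R[i] V V *:%R f flin).
have gc : continuous g.
  apply/bounded_linear_continuous/linear_boundedP.
  exists (r%:C); split => [|c rc x].
    by apply/complex_realP; exists r.
  rewrite (@le_trans _ _ (r%:C * `|x|)) //.
    by rewrite !rnormE -rmorphM lecR; apply: fr.
  by rewrite ler_wpM2r // ltW.
have fb : f \in @is_bop R V by apply/asboolP.
by exists (Bop fb).
Qed.

Lemma eq0_small r : 0 <= r -> (forall e : R, 0 < e -> r <= e) -> r = 0.
Proof.
move=> r0 re; apply/eqP; rewrite eq_le r0 andbT.
by apply/ler_addgt0Pr => e e0; rewrite add0r re.
Qed.

Lemma bop_eq_small A B : (forall e, 0 < e -> opnorm (A - B) <= e) -> A = B.
Proof.
move=> AB; apply/eqP; rewrite -subr_eq0; apply/eqP/opnorm_eq0.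
by apply: eq0_small => //; exact: opnorm_ge0.
Qed.

End OperatorNorm.

Definition bopE := (mulbE, onebE, addbE, oppbE, zerobE, scalebE).

(** * Norm limits and strong limits of operators *)

Section Limits.
Variables (R : realType).

Lemma natSinv_small (e : R) : 0 < e ->
  exists N : nat, forall n, (N <= n)%N -> n.+1%:R^-1 <= e.
Proof.
move=> e0; exists (Num.truncn e^-1) => n Nn.
by rewrite invf_ple ?posrE // (le_trans (ltW (Num.Theory.truncnS_gt _))) // ler_nat.
Qed.

Lemma complex_gt0E (e : R[i]) : 0 < e -> exists2 r : R, 0 < r & e = r%:C.
Proof.
move=> e0; have /complex_realP[r er] := gtr0_real e0.
by exists r => //; rewrite -ltcR -er.
Qed.

(** Norms take values in [R[i]], whose positive elements are the positive reals; convergence is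
    restated with real bounds. *)
Lemma cvg_realP (W : normedModType R[i]) (T : Type) (F : set_system T)
    (FF : Filter F) (f : T -> W) (l : W) :
  (forall e : R, 0 < e -> \forall t \near F, complex.Re `|l - f t| <= e) <->
  f @ F --> l.
Proof.
split=> h.
  apply/cvgrPdist_le => _ /complex_gt0E[e e0 ->].
  near=> t.
  rewrite -[leLHS]RRe_real ?normr_real // lecR.
  by near: t; apply: h.
move=> e e0; have e0' : 0 < e%:C by rewrite ltcR.
move/cvgrPdist_le: h => /(_ _ e0') h; near=> t.
rewrite -lecR RRe_real ?normr_real //.
by near: t; apply: h.
Unshelve. all: by end_near. Qed.

Variable V : hilbertType R.

Lemma cvg_rnormP (T : Type) (F : set_system T)
    (FF : Filter F) (f : T -> V) (l : V) :
  (forall e : R, 0 < e -> \forall t \near F, rnorm (l - f t) <= e) <->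
  f @ F --> l.
Proof. exact: cvg_realP. Qed.

Lemma cvg_opnormP (T : Type) (F : set_system T)
    (FF : Filter F) (f : T -> bop V) (l : bop V) :
  (forall e : R, 0 < e -> \forall t \near F, opnorm (l - f t) <= e) <->
  f @ F --> l.
Proof.
rewrite -cvg_realP; split=> h e e0; have := h e e0; apply: filterS => t;
by rewrite norm_bopE.
Qed.

Lemma cauchy_rnorm (u : nat -> V) :
  (forall e : R, 0 < e -> exists N, forall m n, (N <= m)%N -> (m <= n)%N ->
     rnorm (u m - u n) <= e) ->
  exists l : V, u @ \oo --> l.
Proof.
move=> uc; suff /cvg_ex[l ul] : cvg (u @ \oo) by exists l.
apply: cauchy_cvg; apply/cauchy_exP.
move=> _ /complex_gt0E[e e0 ->].
have e20 : 0 < e / 2 by rewrite divr_gt0.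
have [N hN] := uc _ e20.
exists (u N); exists N => // n /= Nn.
rewrite -ball_normE /= rnormE ltcR (le_lt_trans (hN _ _ (leqnn N) Nn)) //.
by rewrite ltr_pdivrMr // ltr_pMr // ltr1n.
Qed.

Lemma cvg_rdot (T : Type) (F : set_system T) (FF : Filter F)
    (f : T -> V) (l z : V) :
  f @ F --> l -> (fun t => rdot (f t) z) @ F --> rdot l z.
Proof.
move/cvg_rnormP => fl; apply/cvgrPdist_le => e e0.
have z0 : 0 < rnorm z + 1 by rewrite ltr_wpDl // rnorm_ge0.
have := fl (e / (rnorm z + 1)) (divr_gt0 e0 z0).
apply: filterS => t h; rewrite -rdotBl (le_trans (normr_rdot_le _ _)) //.
rewrite (@le_trans _ _ (e / (rnorm z + 1) * rnorm z)) //.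
  by rewrite ler_wpM2r // rnorm_ge0.
rewrite mulrAC ler_pdivrMr // ler_pM2l // lerDl //.
Qed.

(** The pointwise limit is linear by uniqueness of limits, and the uniform bound [r] passes to it,
    so it is a bounded operator. *)
Lemma strong_limit (A : nat -> bop V) (r : R) :
  (forall n, opnorm (A n) <= r) ->
  (forall x (e : R), 0 < e -> exists N, forall m n, (N <= m)%N -> (m <= n)%N ->
     rnorm (A m x - A n x) <= e) ->
  exists B : bop V, (forall x, (A n x) @[n --> \oo] --> B x).
Proof.
move=> Ar Ac.
have /choice[f fP] : forall x, exists l : V, (A n x) @[n --> \oo] --> l.
  by move=> x; apply: cauchy_rnorm => e /(Ac x).
have flin : linear f.
  move=> a x y; apply: (@cvg_unique _ (@norm_hausdorff _ V) _ _ _ _ (fP _)).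
  have -> : (fun n => A n (a *: x + y)) =
            (fun n => a *: A n x + A n y).
    by apply/funext => n; rewrite linearP.
  by apply: cvgD (fP y); apply: cvgZr.
have [|B BE] := @bop_ex _ _ f r flin; last first.
  by exists B => x; rewrite BE.
move=> x; apply/ler_addgt0Pr => e e0.
have /cvg_rnormP/(_ e e0)[N _ hN] := fP x.
have := hN N (leqnn N); rewrite /= => h.
rewrite -[f x](subrK (A N x)) (le_trans (rnormD _ _)) // addrC lerD //.
by rewrite (le_trans (rnorm_bop_le _ _)) // ler_wpM2r ?rnorm_ge0.
Qed.

(** Past [N1] the sequence is uniformly bounded, so [strong_limit] yields a candidate; the Cauchy
    estimate is then carried to the limit vector by vector, with a bound that does not depend on the
    vector. *)
Lemma bop_complete (A : nat -> bop V) :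
  (forall e : R, 0 < e -> exists N, forall m n, (N <= m)%N -> (m <= n)%N ->
     opnorm (A m - A n) <= e) ->
  exists B : bop V, forall e : R, 0 < e -> exists N, forall n, (N <= n)%N ->
     opnorm (A n - B) <= e.
Proof.
move=> Ac; have [N1 hN1] := Ac 1 ltr01.
pose A' n := A (N1 + n)%N.
have A'c (e : R) : 0 < e -> exists N, forall m n, (N <= m)%N -> (m <= n)%N ->
     opnorm (A' m - A' n) <= e.
  move=> /Ac[N hN]; exists N => m n Nm mn; apply: hN; rewrite ?leq_add2l //.
  by rewrite (leq_trans Nm) // leq_addl.
have [n|x e e0|B BP] := @strong_limit A' (opnorm (A N1) + 1).
- rewrite -[A' n](subrKC (A N1)) (le_trans (opnormD _ _)) // lerD2l.
  by rewrite opnormB hN1 // leq_addr.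
- have x0 : 0 < rnorm x + 1 by rewrite ltr_wpDl // rnorm_ge0.
  have [N hN] := A'c (e / (rnorm x + 1)) (divr_gt0 e0 x0).
  exists N => m n Nm mn; have := hN m n Nm mn => h.
  rewrite -oppbE -addbE (le_trans (rnorm_bop_le _ _)) //.
  rewrite (@le_trans _ _ (e / (rnorm x + 1) * rnorm x)) //.
    by rewrite ler_wpM2r // rnorm_ge0.
  by rewrite mulrAC ler_pdivrMr // ler_pM2l // lerDl.
exists B => e e0; have [N hN] := A'c e e0.
exists (N1 + N)%N => n Nn; apply: opnorm_ler; first exact: ltW.
have n1 : (N1 <= n)%N by rewrite (leq_trans _ Nn) // leq_addr.
have -> : A n = A' (n - N1)%N by rewrite /A' subnKC.
have Nn' : (N <= n - N1)%N by rewrite leq_subRL.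
move: (n - N1)%N Nn' => m Nm x.
apply/ler_addgt0Pr => d d0.
have /cvg_rnormP/(_ d d0)[M _ hM] := BP x.
have := hM (maxn M m) (leq_maxl _ _); rewrite /= => h.
rewrite -[_ x]/(A' m x - B x) -[A' m x](subrK (A' (maxn M m) x)) -addrA.
rewrite (le_trans (rnormD _ _)) // lerD //.
  rewrite -oppbE -addbE (le_trans (rnorm_bop_le _ _)) // ler_wpM2r ?rnorm_ge0 //.
  by apply: hN => //; exact: leq_maxr.
by rewrite -rnormN opprB.
Qed.

End Limits.

(** * Adjoints and orthogonal projections *)

Section Adjoints.
Variables (R : realType) (V : hilbertType R).
Implicit Types (A B D P : bop V) (x y : V) (r : R).

Lemma is_adjointP A B :
  is_adjoint A B <-> forall x y, rdot (A x) y = rdot x (B y).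
Proof.
split=> [AB x y|AB x y]; first by rewrite /rdot AB.
by rewrite !hdot_rdot !AB linearZ.
Qed.

Lemma selfadjointP A :
  selfadjoint A <-> forall x y, rdot (A x) y = rdot x (A y).
Proof. exact: is_adjointP. Qed.

Lemma is_adjoint_sym A B : is_adjoint A B -> is_adjoint B A.
Proof.
move/is_adjointP => AB; apply/is_adjointP => x y.
by rewrite rdotC -AB rdotC.
Qed.

Lemma is_adjointM A B A' B' :
  is_adjoint A A' -> is_adjoint B B' -> is_adjoint (A * B) (B' * A').
Proof. by move=> AA BB x y; rewrite !bopE AA BB. Qed.

Lemma is_adjointD A B A' B' :
  is_adjoint A A' -> is_adjoint B B' -> is_adjoint (A + B) (A' + B').
Proof.
move=> /is_adjointP AA /is_adjointP BB; apply/is_adjointP => x y.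
by rewrite !bopE rdotDl rdotDr AA BB.
Qed.

Lemma is_adjointZ A A' r : is_adjoint A A' -> is_adjoint (r%:C *: A) (r%:C *: A').
Proof.
move=> /is_adjointP AA; apply/is_adjointP => x y.
by rewrite !bopE rdotZl rdotZr AA.
Qed.

Lemma is_adjointN A A' : is_adjoint A A' -> is_adjoint (- A) (- A').
Proof.
move=> /is_adjointP AA; apply/is_adjointP => x y.
by rewrite !bopE rdotNl rdotNr AA.
Qed.

Lemma is_adjointB A B A' B' :
  is_adjoint A A' -> is_adjoint B B' -> is_adjoint (A - B) (A' - B').
Proof. by move=> AA BB; apply: is_adjointD => //; apply: is_adjointN. Qed.

Lemma is_adjoint1 : is_adjoint (1 : bop V) 1. Proof. by []. Qed.

Lemma is_adjoint_uniq A B B' : is_adjoint A B -> is_adjoint A B' -> B = B'.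
Proof.
move=> /is_adjointP AB /is_adjointP AB'; apply: bopP => x.
by apply: rdot_inj => z; rewrite !(rdotC _ z) -AB AB'.
Qed.

Lemma selfadjoint_closed D : (forall e : R, 0 < e ->
  exists2 B, selfadjoint B & opnorm (B - D) <= e) -> selfadjoint D.
Proof.
move=> hD; apply/selfadjointP => x y; apply/eqP; rewrite -subr_eq0 -normr_eq0.
apply/eqP; apply: eq0_small => // e e0.
pose K := 2 * rnorm x * rnorm y.
have K0 : 0 <= K by rewrite !mulr_ge0 ?rnorm_ge0.
have K1 : 0 < K + 1 by rewrite ltr_wpDl.
have [B /selfadjointP Bs BD] := hD _ (divr_gt0 e0 K1).
have -> : rdot (D x) y - rdot x (D y) = rdot x ((B - D) y) - rdot ((B - D) x) y.
  by rewrite !bopE rdotBr rdotBl Bs; ring.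
rewrite (le_trans (ler_normB _ _)) // (@le_trans _ _ (K * (e / (K + 1)))) //; last first.
  by rewrite mulrCA ler_piMr ?(ltW e0) // ler_pdivrMr // mul1r lerDl.
set d := e / _ in BD *.
have h z w : `|rdot ((B - D) z) w| <= d * (rnorm z * rnorm w).
  rewrite (le_trans (normr_rdot_le _ _)) // mulrA ler_wpM2r ?rnorm_ge0 //.
  by rewrite (le_trans (rnorm_bop_le _ _)) // ler_wpM2r ?rnorm_ge0.
have := h x y; have := h y x; rewrite rdotC /K; lra.
Qed.

Lemma rdot_i x y : rdot ('i *: x) y = - rdot x ('i *: y).
Proof.
rewrite /rdot linearZl_LR linearZr_LR /=; case: (hdot x y) => a b /=.
by rewrite !mul0r !sub0r mulN1r !mul1r opprK.
Qed.

(** The imaginary part of the form is [rdot (A x) ('i *: x)], which self-adjointness makes equal to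
    its own opposite. *)
Lemma selfadjoint_positive A :
  selfadjoint A -> (forall x, 0 <= rdot (A x) x) -> positive A.
Proof.
move=> /selfadjointP As Ap x; rewrite hdot_rdot.
suff -> : rdot (A x) ('i *: x) = 0 by rewrite ler0c.
have h : rdot (A x) ('i *: x) = - rdot (A x) ('i *: x).
  by rewrite {1}As linearZ -rdot_i rdotC.
lra.
Qed.

Lemma selfadjoint_sqr_eq0 A x : selfadjoint A -> A (A x) = 0 -> A x = 0.
Proof.
move=> /selfadjointP As AAx; apply/eqP; rewrite -rdotxx_eq0 As AAx rdot0r.
by [].
Qed.

Lemma projection_fix (E : set V) P x : is_projection_onto E P -> E x <-> P x = x.
Proof.
move=> [[PP _] <-]; split=> [[y _ <-]|<-]; first by rewrite -mulbE PP.
by exists x.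
Qed.

(** Two projections onto the same set absorb each other; taking the adjoint of one of the two
    products identifies them. *)
Lemma projection_uniq (E : set V) P P' :
  is_projection_onto E P -> is_projection_onto E P' -> P = P'.
Proof.
have main Q Q' : is_projection_onto E Q -> is_projection_onto E Q' -> Q' * Q = Q.
  move=> EQ EQ'; apply: bopP => x; rewrite bopE.
  by apply/(projection_fix _ EQ'); case: EQ => _ <-; exists x.
move=> EP EP'; have PP' := main _ _ EP EP'; have P'P := main _ _ EP' EP.
case: EP => [[_ Ps] _]; case: EP' => [[_ P's] _].
rewrite -PP'; have := is_adjointM Ps P's; rewrite P'P => h.
by rewrite PP' (is_adjoint_uniq P's h) PP'.
Qed.

End Adjoints.

(** * The projection theorem for a closed subspace *)

Section ProjectionTheorem.
Variables (R : realType) (V : hilbertType R).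
Variables (E : set V).
Hypotheses (E0 : E 0) (El : forall (a : R[i]) x y, E x -> E y -> E (a *: x + y)).
Hypothesis Ecl : closed E.

Let EZ (a : R[i]) x : E x -> E (a *: x).
Proof. by move=> Ex; rewrite -[_ *: _]addr0; apply: El. Qed.

Let ED x y : E x -> E y -> E (x + y).
Proof. by move=> Ex Ey; rewrite -[x]scale1r; apply: El. Qed.

Let EB x y : E x -> E y -> E (x - y).
Proof. by move=> Ex Ey; rewrite -scaleN1r addrC; apply: El. Qed.

(** If the squared distance at [m] is within [e ^+ 2] of the infimum, moving [m] by the optimal
    multiple [t] of [y] lowers it by [t * r], which therefore cannot exceed [e ^+ 2]. *)
Let almost_orthogonal (x : V) (e : R) : 0 < e ->
  exists2 m, E m & forall y, E y -> `|rdot (x - m) y| <= e * rnorm y.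
Proof.
move=> e0; pose S := [set rdot (x - y) (x - y) | y in E].
have Sinf : has_inf S.
  split; first by exists (rdot (x - 0) (x - 0)); exists 0.
  by exists 0 => _ [y _ <-]; exact: rdotxx_ge0.
have e20 : 0 < e ^+ 2 by rewrite exprn_gt0.
have [_ [m Em <-] mlt] := inf_adherent e20 Sinf.
exists m => // y Ey.
have [->|y0] := eqVneq y 0; first by rewrite rdot0r rnorm0 mulr0 normr0.
have yp : 0 < rnorm y by rewrite lt_def rnorm_eq0 y0 rnorm_ge0.
pose r := rdot (x - m) y; pose t := r / (rnorm y ^+ 2).
have Em' : E (m + t%:C *: y) by apply: ED => //; exact: EZ.
have : inf S <= rdot (x - (m + t%:C *: y)) (x - (m + t%:C *: y)).
  by apply: ge_inf; [case: Sinf|exists (m + t%:C *: y)].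
rewrite -/r opprD addrA.
rewrite (rdotBl (x - m)) !(rdotBr _ (x - m)) !rdotZl !rdotZr rdotxx (rdotC y (x - m)) -/r.
rewrite !rdotxx in mlt * => h.
have {}h : r ^+ 2 <= (e * rnorm y) ^+ 2.
  have tE : t * rnorm y ^+ 2 = r by rewrite /t divfK // sqrf_eq0 gt_eqF.
  move: (rnorm (x - m)) (inf S) (rnorm y) tE yp mlt h => a b c tE c0 ab h.
  have : t * r <= e ^+ 2.
    have : 2 * t * r - t * (t * c ^+ 2) <= e ^+ 2 by lra.
    by rewrite tE; lra.
  move=> tr; rewrite exprMn -tE; rewrite -tE in tr.
  have c2 : 0 < c ^+ 2 by rewrite exprn_gt0.
  rewrite exprMn; have -> : t ^+ 2 * (c ^+ 2) ^+ 2 = (t * (t * c ^+ 2)) * c ^+ 2 by ring.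
  by rewrite ler_pM2r.
rewrite -(@ler_pXn2r _ 2) ?nnegrE ?mulr_ge0 ?(ltW e0) ?(ltW yp) //.
by rewrite real_normK ?num_real.
Qed.

(** The almost orthogonal points [u n] are Cauchy: [z = u k - u l] lies in [E], and testing both
    residuals against [z] itself bounds [|z|] by the sum of their two errors. *)
Lemma orthogonal_decomposition x :
  exists2 m, E m & forall y, E y -> rdot (x - m) y = 0.
Proof.
have /choice[u uP] : forall n : nat, exists m, E m /\
    forall y, E y -> `|rdot (x - m) y| <= n.+1%:R^-1 * rnorm y.
  by move=> n; have [//|m Em mP] := @almost_orthogonal x n.+1%:R^-1; exists m.
have [e e0|m um] := @cauchy_rnorm R V u.
  have e20 : 0 < e / 2 by rewrite divr_gt0.
  have [N hM] := natSinv_small e20.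
  exists N => k l Nk kl; have Nl := leq_trans Nk kl.
  have [Ek uk] := uP k; have [E_l ul] := uP l.
  pose z := u k - u l; have Ez : E z by apply: EB.
  rewrite -/z; have [->|z0] := eqVneq (rnorm z) 0; first exact: ltW.
  have zp : 0 < rnorm z by rewrite lt_def z0 rnorm_ge0.
  rewrite -(ler_pM2r zp) -expr2 -rdotxx {1}/z.
  have -> : u k - u l = (x - u l) - (x - u k) by rewrite opprB [RHS]addrC subrKA.
  have /(_ _ Ez)/ler_normlP[_ h1] := ul; have /(_ _ Ez)/ler_normlP[h2 _] := uk.
  rewrite rdotBl [e]splitr mulrDl lerD //.
    by rewrite (le_trans h1) // ler_pM2r // hM.
  by rewrite (le_trans h2) // ler_pM2r // hM.
exists m.
  by apply: (closed_cvg E Ecl _ m um); apply: nearW => n; case: (uP n).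
move=> y Ey; apply/eqP; rewrite -normr_eq0; apply/eqP.
apply: eq0_small => // e e0.
have y0 : 0 < rnorm y + 1 by rewrite ltr_wpDl // rnorm_ge0.
pose d := e / 2 / (rnorm y + 1); have d0 : 0 < d by rewrite !divr_gt0.
have /cvg_rnormP/(_ d d0)[N1 _ hN1] := um.
have [N2 hN2] := natSinv_small d0.
pose N := maxn N1 N2; have NE : (N.+1%:R)^-1 <= d by apply: hN2; exact: leq_maxr.
have [_ /(_ _ Ey) hN] := uP N.
have -> : x - m = (x - u N) - (m - u N) by rewrite opprB addrA subrK.
rewrite rdotBl (le_trans (ler_normB _ _)) // [e]splitr.
have dE : d * rnorm y <= e / 2.
  rewrite /d mulrAC ler_pdivrMr // ler_pM2l ?divr_gt0 //.
  by rewrite lerDl.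
rewrite lerD // (le_trans _ dE) //.
  by rewrite (le_trans hN) // ler_wpM2r ?rnorm_ge0.
rewrite (le_trans (normr_rdot_le _ _)) // ler_wpM2r ?rnorm_ge0 //.
by apply: hN1; exact: leq_maxl.
Qed.

Lemma projection_ex : exists P : bop V, is_projection_onto E P.
Proof.
have /choice[f fP] : forall x, exists m, E m /\ forall y, E y -> rdot (x - m) y = 0.
  by move=> x; have [m Em mP] := orthogonal_decomposition x; exists m.
have funiq x m : E m -> (forall y, E y -> rdot (x - m) y = 0) -> f x = m.
  move=> Em mP; have [Ef fo] := fP x.
  apply/eqP; rewrite -subr_eq0 -rdotxx_eq0.
  have Ed : E (f x - m) by apply: EB.
  have -> : f x - m = (x - m) - (x - f x) by rewrite opprB [RHS]addrC subrKA.
  have Ed' : E ((x - m) - (x - f x)) by rewrite opprB addrC subrKA.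
  by rewrite rdotBl mP // fo // subrr.
have flin : linear f.
  move=> a x y; have [Ex ox] := fP x; have [Ey oy] := fP y.
  apply: funiq; first exact: El.
  move=> z Ez; rewrite opprD addrACA rdotDl oy // addr0 -scalerBr.
  (* Complex homogeneity: the scalar moves to the other argument as its conjugate, and [E] is stable
     under complex scalars. *)
  have := ox _ (EZ (a ^* ) Ez); rewrite /rdot linearZr_LR linearZl_LR /=.
  by have -> : Num.conj (a ^*) = a by exact: conjcK.
have [|P PE] := @bop_ex _ _ f 1 flin.
  move=> x; have [Ex ox] := fP x.
  rewrite mul1r -(@ler_pXn2r _ 2) ?nnegrE ?rnorm_ge0 // -!rdotxx.
  have := rdotxx_ge0 (x - f x).
  by have := ox _ Ex; rewrite !(rdotBl, rdotBr) (rdotC (f x) x); lra.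
exists P; split; last first.
  apply/seteqP; split=> [_ [x _ <-]|x Ex]; first by rewrite PE; case: (fP x).
  by exists x => //; rewrite PE; apply: funiq => // y _; rewrite subrr rdot0l.
split.
  apply: bopP => x; rewrite bopE !PE; apply: funiq; first by case: (fP x).
  by move=> y _; rewrite subrr rdot0l.
apply/selfadjointP => x y; rewrite !PE.
have [Ex ox] := fP x; have [Ey oy] := fP y.
apply/eqP; rewrite -subr_eq0; apply/eqP.
have := oy _ Ex; have := ox _ Ey; rewrite !rdotBl !(rdotC y) !(rdotC _ (f x)).
lra.
Qed.

End ProjectionTheorem.

(** * Bernstein polynomials *)

Section Bernstein.
Variable R : realType.
Implicit Types (p : {poly R}) (f : R -> R).

Definition bernstein n k : {poly R} :=
  'C(n, k)%:R *: ('X^k * (1 - 'X) ^+ (n - k)).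

Lemma sum_bernstein n : \sum_(k < n.+1) bernstein n k = 1.
Proof.
transitivity ((1 - 'X + 'X : {poly R}) ^+ n); last by rewrite subrK expr1n.
by rewrite exprDn; apply: eq_bigr => k _; rewrite /bernstein scaler_nat mulrC.
Qed.

(** This is [k C(n+1, k) = (n+1) C(n, k-1)], arranged to lower a falling factorial by one. *)
Lemma bernstein_shift n (c : nat -> R) :
  \sum_(k < n.+2) (k%:R * c k) *: bernstein n.+1 k =
  n.+1%:R *: ('X * \sum_(k < n.+1) c k.+1 *: bernstein n k).
Proof.
rewrite big_ord_recl /= mul0r scale0r add0r mulr_sumr scaler_sumr.
apply: eq_bigr => k _; rewrite /bump /= add1n /bernstein subSS.
rewrite exprS -mulrA -!scalerAr !scalerA; congr (_ *: _).
rewrite mulrAC -natrM -(mul_bin_diag n.+1 k) natrM /=; ring.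
Qed.

(** Falling factorials have exact Bernstein moments; those of powers follow only approximately,
    through [pow_ffact_ratio]. *)
Lemma ffact_moment n j :
  \sum_(k < n.+1) (k ^_ j)%:R *: bernstein n k = (n ^_ j)%:R *: 'X^j.
Proof.
elim: j n => [|j IH] [|n].
- by rewrite big_ord1 !scale1r /bernstein bin0 scale1r mulr1.
- under eq_bigr do rewrite ffactn0 scale1r.
  by rewrite sum_bernstein scale1r.
- by rewrite big_ord1 !ffact0n !scale0r.
under eq_bigr do rewrite ffactnS natrM.
rewrite (bernstein_shift n (fun k => (k.-1 ^_ j)%:R)) /=.
by rewrite IH ffactSS natrM -scalerA -scalerAr exprS.
Qed.

Definition bernstein_op n f : {poly R} :=
  \sum_(k < n.+1) f (k%:R / n%:R) *: bernstein n k.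

Lemma ffact_ratio_ge0_le1 (k n j : nat) : (k <= n)%N ->
  0 <= ((k ^_ j)%:R / (n ^_ j)%:R : R) <= 1.
Proof.
move=> kn; rewrite divr_ge0 //=.
have [->|n0] := eqVneq (n ^_ j) 0%N; first by rewrite invr0 mulr0 ler01.
have np : (0 < n ^_ j)%N by rewrite lt0n.
rewrite ler_pdivrMr ?ltr0n // mul1r ler_nat.
elim: j {n0 np} => // j IH; rewrite !ffactnSr leq_mul // leq_sub2r //.
Qed.

(** The ratio is a product of [j] factors [(k - i) / (n - i)]. Each lies in [[0, 1]] and within
    [2 d / n] of [k / n], so telescoping adds up [j] such errors. *)
Lemma pow_ffact_ratio (d j n k : nat) : (2 * d < n)%N -> (j <= d)%N -> (k <= n)%N ->
  `|(k%:R / n%:R) ^+ j - (k ^_ j)%:R / (n ^_ j)%:R| <= j%:R * (2 * d%:R / n%:R) :> R.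
Proof.
move=> dn jd kn; elim: j jd => [|j IH] jd.
  by rewrite !ffactn0 expr0 divr1 subrr normr0 mul0r.
have {}IH := IH (ltnW jd).
have n0 : (0 < n)%N by exact: leq_ltn_trans dn.
have n0' : 0 < n%:R :> R by rewrite ltr0n.
have jn : (j < n)%N.
  by apply: leq_trans jd _; rewrite (leq_trans _ (ltnW dn)) // leq_pmull.
have jn' : 0 < (n - j)%:R :> R by rewrite ltr0n subn_gt0.
rewrite !ffactnSr !natrM exprSr.
set a := _ ^+ j in IH *; set c := (k ^_ j)%:R / _ in IH.
rewrite invfM mulrACA -/c.
set b := k%:R / n%:R; set e := _ / (n - j)%:R.
have -> : a * b - c * e = (a - c) * b + c * (b - e) by ring.
have /andP[c0 c1] : 0 <= c <= 1 by exact: ffact_ratio_ge0_le1.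
have b0 : 0 <= b by rewrite divr_ge0.
have b1 : b <= 1 by rewrite ler_pdivrMr // mul1r ler_nat.
rewrite (le_trans (ler_normD _ _)) // (normrM (a - c)) (normrM c) (ger0_norm b0) (ger0_norm c0).
rewrite -natr1 mulrDl mul1r lerD //.
  by rewrite (le_trans _ IH) // ler_piMr.
suff be : `|b - e| <= 2 * d%:R / n%:R by rewrite (le_trans _ be) // ler_piMl.
have dj : j%:R <= d%:R :> R by rewrite ler_nat ltnW.
have d2n : 2 * d%:R <= n%:R :> R by rewrite -natrM ler_nat ltnW.
have j0 : 0 <= j%:R :> R by [].
have kn' : k%:R <= n%:R :> R by rewrite ler_nat.
(* For [k < j] truncated subtraction makes [e] zero, and [k / n] is itself below [j / n]. *)
have [jk|kj] := leqP j k; last first.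
  have -> : e = 0 by rewrite /e (eqP (ltnW kj : (k - j == 0)%N)) mul0r.
  rewrite subr0 ger0_norm // ler_pM2r ?invr_gt0 //.
  have kj' : k%:R <= j%:R :> R by rewrite ler_nat ltnW.
  lra.
have -> : b - e = j%:R * (n%:R - k%:R) / (n%:R * (n - j)%:R).
  rewrite /b /e !natrB //; last exact: ltnW.
  rewrite natrB in jn'; last exact: ltnW.
  by field; rewrite (gt_eqF jn') (gt_eqF n0').
rewrite ger0_norm; last by rewrite divr_ge0 // mulr_ge0 // subr_ge0.
rewrite ler_pdivrMr ?mulr_gt0 // mulrA divfK ?gt_eqF //.
have k0 : 0 <= k%:R :> R by [].
rewrite natrB; last exact: ltnW.
nra.
Qed.

(* A linear functional which is nonnegative on the Bernstein polynomials is
   nonnegative on p: it is so on the Bernstein approximations of p, which tend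
   to p coefficientwise. *)
Lemma bernstein_positive (phi : {poly R} -> R) p :
  {morph phi : q r / q + r >-> q + r} ->
  (forall c q, phi (c *: q) = c * phi q) ->
  (forall n k, (k <= n)%N -> 0 <= phi (bernstein n k)) ->
  (forall x, 0 <= x <= 1 -> 0 <= p.[x]) -> 0 <= phi p.
Proof.
move=> phiD phiZ phi_ge0 p_ge0.
have phi0 : phi 0 = 0 by rewrite -(scale0r 0) phiZ mul0r.
have phi_sum (I : Type) (s : seq I) (P : pred I) F :
    phi (\sum_(i <- s | P i) F i) = \sum_(i <- s | P i) phi (F i).
  exact: (big_morph phi phiD phi0).
(* By [pow_ffact_ratio] the coefficient of degree [j <= d] contributes an error of at most
   [d * (2 d / n)] times [phi 1], the sum of [phi] over the Bernstein polynomials; the total is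
   [C / n]. *)
pose d := size p; pose C : R := \sum_(j < d) `|p`_j| * (d%:R * (2 * d%:R)) * phi 1.
have phi1 : 0 <= phi 1.
  by rewrite -(sum_bernstein 0) big_ord1 phi_ge0.
have C0 : 0 <= C by apply: sumr_ge0 => j _; rewrite !mulr_ge0.
have main n : (2 * d < n)%N -> - (C / n%:R) <= phi p.
  move=> dn; have n0 : (0 < n)%N by exact: leq_ltn_trans dn.
  have n0' : 0 < n%:R :> R by rewrite ltr0n.
  pose B := bernstein_op n (fun x => p.[x]).
  have phiB : 0 <= phi B.
    rewrite phi_sum; apply: sumr_ge0 => k _; rewrite phiZ mulr_ge0 //.
      apply: p_ge0; rewrite divr_ge0 //= ler_pdivrMr // mul1r ler_nat.
      by rewrite -ltnS.
    by apply: phi_ge0; rewrite -ltnS.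
  have monE j : phi 'X^j = phi (\sum_(k < n.+1) ((k ^_ j)%:R / (n ^_ j)%:R) *: bernstein n k)
      \/ (d <= j)%N.
    have [dj|jd] := leqP d j; [by right|left].
    congr phi; under eq_bigr do rewrite mulrC -scalerA.
    rewrite -scaler_sumr ffact_moment scalerA mulVf ?scale1r //.
    rewrite pnatr_eq0 -lt0n ffact_gt0 (leq_trans (ltnW jd)) //.
    by rewrite (leq_trans _ (ltnW dn)) // leq_pmull.
  have pE : phi p = \sum_(j < d) p`_j * phi 'X^j.
    rewrite -{1}(coefK p) poly_def phi_sum.
    by apply: eq_bigr => j _; rewrite phiZ.
  have BE : phi B = \sum_(j < d) p`_j *
      phi (\sum_(k < n.+1) ((k%:R / n%:R) ^+ j) *: bernstein n k).
    rewrite phi_sum.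
    under eq_bigr do rewrite phiZ horner_coef mulr_suml.
    rewrite exchange_big; apply: eq_bigr => j _.
    rewrite phi_sum mulr_sumr; apply: eq_bigr => k _.
    by rewrite (phiZ (_ ^+ j)) mulrA.
  have : `|phi B - phi p| <= C / n%:R.
    rewrite BE pE -sumrB (le_trans (ler_norm_sum _ _ _)) // mulr_suml.
    apply: ler_sum => j _; rewrite -mulrBr normrM.
    have -> : `|p`_j| * (d%:R * (2 * d%:R)) * phi 1 / n%:R =
      `|p`_j| * (d%:R * (2 * d%:R / n%:R) * phi 1) by ring.
    rewrite ler_wpM2l //.
    have [->|] := monE j; last by rewrite leqNgt ltn_ord.
    have -> : phi 1 = \sum_(k < n.+1) phi (bernstein n k).
      by rewrite -(sum_bernstein n) phi_sum.
    rewrite !phi_sum -sumrB mulr_sumr (le_trans (ler_norm_sum _ _ _)) //.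
    apply: ler_sum => k _; rewrite (phiZ (_ ^+ j)) (phiZ (_ / _)) -mulrBl normrM.
    have pk : 0 <= phi (bernstein n k) by apply: phi_ge0; rewrite -ltnS.
    have kn : (k <= n)%N by rewrite -ltnS.
    rewrite (ger0_norm pk) ler_wpM2r //.
    rewrite (le_trans (pow_ffact_ratio dn (ltnW (ltn_ord j)) kn)) //.
    by rewrite ler_wpM2r ?divr_ge0 ?mulr_ge0 // ler_nat ltnW.
  by rewrite ler_norml => /andP[_]; rewrite lerBlDl; lra.
apply/ler_addgt0Pr => e e0; rewrite -lerBlDr sub0r.
have [N hN] := natSinv_small (divr_gt0 e0 (ltr_wpDl C0 ltr01)).
pose m := (maxn N (2 * d))%N.
apply: le_trans (main m.+1 _); last by rewrite ltnS leq_maxr.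
rewrite lerN2; have := hN m (leq_maxl _ _).
rewrite ler_pdivlMr ?ltr_wpDl // => h.
by rewrite (le_trans _ h) // mulrC ler_wpM2l ?invr_ge0 // lerDl.
Qed.

(** Compactness in its near-covering form. The radius given by continuity at a point is halved, so
    that half of it is left for every nearby centre. *)
Lemma heine_cantor (a b : R) f : {within `[a, b], continuous f} ->
  forall e : R, 0 < e -> exists2 d : R, 0 < d &
    forall x y, a <= x <= b -> a <= y <= b -> `|x - y| <= d -> `|f x - f y| <= e.
Proof.
move=> /subspace_continuousP fc e e0.
have /compact_near_coveringP/near_covering_withinP cov := @segment_compact R a b.
pose P (d : R) (x : R) := forall y, y \in `[a, b] -> `|x - y| <= d -> `|f x - f y| <= e.
have := cov _ (0^'+) P _.
move=> [x xab|/= d d0 hd].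
  have /cvgrPdist_le/(_ (e / 2)) := fc x xab.
  rewrite divr_gt0 // => /(_ isT).
  rewrite near_withinE => /nbhs_ballP[d /= d0 hd].
  exists ([set z | ball x (d / 2) z], [set r | 0 < r < d / 2]) => /=.
    split; first by apply: nbhsx_ballx; rewrite divr_gt0.
    exists (d / 2) => /=; first by rewrite divr_gt0.
    by move=> r /= + r0; rewrite sub0r normrN gtr0_norm // r0 => ->.
  move=> [z r] /= [xz /andP[r0 rd]] zab y yab zy.
  have fz : `|f x - f z| <= e / 2.
    apply: hd => //; rewrite /ball /= (lt_trans xz) // ltr_pdivrMr // ltr_pMr //.
    by rewrite ltr1n.
  have fy : `|f x - f y| <= e / 2.
    apply: hd => //; rewrite /ball /=.
    have -> : x - y = (x - z) + (z - y) by ring.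
    rewrite (le_lt_trans (ler_normD _ _)) // [d]splitr ltrD //.
    exact: le_lt_trans rd.
  have -> : f z - f y = (f x - f y) - (f x - f z) by ring.
  by rewrite (le_trans (ler_normB _ _)) // [e]splitr lerD.
have d20 : 0 < d / 2 by rewrite divr_gt0.
exists (d / 2) => // x y xab yab xy; apply: (hd (d / 2)) => //=.
  by rewrite sub0r normrN gtr0_norm // ltr_pdivrMr // ltr_pMr // ltr1n.
Qed.

Lemma segment_bounded (a b : R) f : {within `[a, b], continuous f} ->
  exists2 M : R, 0 < M & forall x, a <= x <= b -> `|f x| <= M.
Proof.
move=> fc; have [ab|ba] := leP a b; last first.
  by exists 1 => // x /andP[ax xb]; move: (lt_le_trans ba ax); rewrite ltNge xb.
have [c1 _ h1] := EVT_max ab fc.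
have [c2 _ h2] := EVT_min ab fc.
exists (`|f c1| + `|f c2| + 1); first by rewrite ltr_wpDl // addr_ge0.
move=> x xab; have := h1 x; have := h2 x; rewrite in_itv /= xab => /(_ isT) A /(_ isT) B.
rewrite ler_norml; have := ler_norm (f c1); have := ler_norm (- f c2); rewrite normrN.
have := normr_ge0 (f c1); have := normr_ge0 (f c2); lra.
Qed.

(** Bernstein's argument: where [k / n] is within [d] of [x], uniform continuity gives [e / 2];
    elsewhere the oscillation [2 M] is at most [K (k / n - x) ^+ 2], whose weighted sum is the
    variance, at most [1 / n], times [K]. *)
Lemma weierstrass01 f : {within `[0, 1], continuous f} ->
  forall e : R, 0 < e -> exists p : {poly R},
    forall x, 0 <= x <= 1 -> `|p.[x] - f x| <= e.
Proof.
move=> fc e e0; have e20 : 0 < e / 2 by rewrite divr_gt0.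
have [d d0 hd] := heine_cantor fc e20.
have [M M0 hM] := segment_bounded fc.
pose K : R := 2 * M / d ^+ 2.
have K0 : 0 < K by rewrite divr_gt0 ?exprn_gt0 ?mulr_gt0.
have [N hN] := natSinv_small (divr_gt0 e20 K0).
pose n := N.+1; have n0 : 0 < n%:R :> R by rewrite ltr0n.
have {}hN : K / n%:R <= e / 2.
  by have := hN N (leqnn N); rewrite ler_pdivlMr // mulrC.
exists (bernstein_op n f) => x x01; have /andP[x0 x1] := x01.
pose b k := (bernstein n k).[x].
have b_ge0 k : 0 <= b k.
  rewrite /b /bernstein hornerZ hornerM hornerXn horner_exp.
  have -> : (1 - 'X : {poly R}).[x] = 1 - x by rewrite !hornerE.
  rewrite mulr_ge0 // mulr_ge0 ?exprn_ge0 //.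
  by rewrite subr_ge0.
have mom j : \sum_(k < n.+1) (k ^_ j)%:R * b k = (n ^_ j)%:R * x ^+ j.
  have := congr1 (horner^~ x) (ffact_moment n j).
  rewrite /= hornerZ hornerXn => <-.
  by rewrite horner_sum; apply: eq_bigr => k _; rewrite hornerZ.
have b1 : \sum_(k < n.+1) b k = 1.
  by have := mom 0%N; under eq_bigr do rewrite ffactn0 mul1r; rewrite mulr1 ffactn0.
have var : \sum_(k < n.+1) (k%:R / n%:R - x) ^+ 2 * b k <= n%:R^-1.
  have -> : \sum_(k < n.+1) (k%:R / n%:R - x) ^+ 2 * b k = x * (1 - x) / n%:R.
    have m1 := mom 1%N; have m2 := mom 2%N.
    rewrite !ffactnS !ffactn0 !muln1 expr1 in m1 m2.
    have -> : \sum_(k < n.+1) (k%:R / n%:R - x) ^+ 2 * b k =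
      n%:R^-1 ^+ 2 * \sum_(k < n.+1) (k ^_ 2)%:R * b k +
      (n%:R^-1 ^+ 2 - 2 * x * n%:R^-1) * (\sum_(k < n.+1) (k ^_ 1)%:R * b k) +
      x ^+ 2 * (\sum_(k < n.+1) b k).
      rewrite !mulr_sumr -!big_split /=; apply: eq_bigr => k _.
      case: k => [[|k] kn] /=; first by rewrite ffact0n !mul0r; ring.
      rewrite !ffactnS !ffactn0 !muln1 !natrM -[k.+1%:R]natr1 /=; ring.
    rewrite !mom b1 !ffactnS !ffactn0 !muln1 /n natrM /= -[N.+1%:R]natr1.
    have : N%:R + 1 != 0 :> R by rewrite natr1 pnatr_eq0.
    by move=> h; field.
  by rewrite ler_piMl ?invr_ge0 // mulr_ile1 // ?subr_ge0 // gerBl.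
have -> : f x = \sum_(k < n.+1) f x * b k by rewrite -mulr_sumr b1 mulr1.
rewrite /bernstein_op horner_sum -sumrB.
rewrite (le_trans (ler_norm_sum _ _ _)) //.
apply: (@le_trans _ _ (\sum_(k < n.+1) (e / 2 * b k + K * ((k%:R / n%:R - x) ^+ 2 * b k)))).
  apply: ler_sum => k _; rewrite hornerZ -/(b k) -mulrBl normrM (ger0_norm (b_ge0 k)).
  rewrite mulrA -mulrDl ler_wpM2r //.
  have k01 : 0 <= (k%:R / n%:R : R) <= 1.
    by rewrite divr_ge0 //= ler_pdivrMr // mul1r ler_nat -ltnS ltn_ord.
  have [kd|dk] := leP `|k%:R / n%:R - x| d.
    rewrite (le_trans (hd _ _ k01 x01 kd)) // lerDl mulr_ge0 ?sqr_ge0 //.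
    exact: ltW.
  apply: (@le_trans _ _ (2 * M)).
    rewrite (le_trans (ler_normB _ _)) //.
    by have := hM _ k01; have := hM _ x01; lra.
  have : d ^+ 2 <= (k%:R / n%:R - x) ^+ 2.
    rewrite -[leRHS]real_normK ?num_real // ler_pXn2r ?nnegrE //; exact: ltW.
  rewrite -(ler_pM2l K0) {1}/K divfK ?gt_eqF ?exprn_gt0 // => h.
  by rewrite (le_trans h) // lerDr ltW.
rewrite big_split /= -!mulr_sumr b1 mulr1 [leRHS]splitr lerD2l.
by rewrite (le_trans _ hN) // ler_pM2l.
Qed.

Lemma weierstrass (a b : R) f : a < b -> {within `[a, b], continuous f} ->
  forall e : R, 0 < e -> exists p : {poly R},
    forall x, a <= x <= b -> `|p.[x] - f x| <= e.
Proof.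
move=> ab fc e e0; have ba : 0 < b - a by rewrite subr_gt0.
pose g t := f (a + t * (b - a)).
have tab t : 0 <= t <= 1 -> a <= a + t * (b - a) <= b.
  by move=> /andP[t0 t1]; nra.
have [|p hp] := @weierstrass01 g _ e e0.
  apply/subspace_continuousP => t /= t01; apply/cvgrPdist_le => d d0.
  have /subspace_continuousP/(_ (a + t * (b - a))) := fc.
  rewrite /= in_itv /= => /(_ (tab t _)).
  rewrite in_itv /= in t01 => /(_ t01)/cvgrPdist_le/(_ d d0).
  rewrite !near_withinE => /nbhs_ballP[r /= r0 hr].
  apply/nbhs_ballP; exists (r / (b - a)); first by rewrite /= divr_gt0.
  move=> s /= ts s01; apply: hr; last by rewrite /= in_itv /= in s01 *; apply: tab.
  rewrite /ball /=; have -> : a + t * (b - a) - (a + s * (b - a)) = (t - s) * (b - a) by ring.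
  by rewrite normrM (gtr0_norm ba) -ltr_pdivlMr.
exists (p \Po ((b - a)^-1 *: ('X - a%:P))) => x /andP[ax xb].
rewrite horner_comp !hornerE.
have xE : x = a + (b - a)^-1 * (x - a) * (b - a).
  by rewrite mulrAC mulVf ?gt_eqF // mul1r addrC subrK.
rewrite {2}xE; apply: hp.
rewrite mulr_ge0 ?invr_ge0 ?subr_ge0 ?(ltW ab) //=.
by rewrite mulrC ler_pdivrMr // mul1r lerD2r.
Qed.

End Bernstein.

(** * Continuous functional calculus on an interval *)

Section PolynomialCalculus.
Variables (R : realType) (V : hilbertType R).
Implicit Types (S A B : bop V) (p q : {poly R}) (x y : V).

Lemma bop_polyE p S n : (size p <= n)%N ->
  bop_poly p S = \sum_(i < n) (p`_i)%:C *: S ^+ i.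
Proof.
move=> pn; rewrite /bop_poly (big_ord_widen n (fun i => (p`_i)%:C *: S ^+ i)) //.
rewrite big_mkcond; apply: eq_bigr => i _; case: ltnP => // pi.
by rewrite nth_default // scale0r.
Qed.

Lemma bop_polyD p q S : bop_poly (p + q) S = bop_poly p S + bop_poly q S.
Proof.
pose n := maxn (size p) (size q).
rewrite !(@bop_polyE _ _ n) ?leq_maxl ?leq_maxr ?size_polyD // -big_split.
by apply: eq_bigr => i _; rewrite coefD rmorphD scalerDl.
Qed.

Lemma bop_polyZ (c : R) p S : bop_poly (c *: p) S = c%:C *: bop_poly p S.
Proof.
rewrite !(@bop_polyE _ _ (size p)) ?size_scale_leq // scaler_sumr.
by apply: eq_bigr => i _; rewrite coefZ rmorphM scalerA.
Qed.

Lemma bop_poly0 S : bop_poly 0 S = 0.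
Proof. by rewrite /bop_poly size_poly0 big_ord0. Qed.

Lemma bop_polyC (c : R) S : bop_poly c%:P S = c%:C *: (1 : bop V).
Proof.
by rewrite (@bop_polyE _ _ 1) ?size_polyC_leq1 // big_ord1 coefC.
Qed.

Lemma bop_poly1 S : bop_poly 1 S = 1.
Proof. by rewrite -polyC1 bop_polyC scale1r. Qed.

Lemma bop_polyN p S : bop_poly (- p) S = - bop_poly p S.
Proof. by rewrite -scaleN1r bop_polyZ rmorphN1 scaleN1r. Qed.

Lemma bop_polyB p q S : bop_poly (p - q) S = bop_poly p S - bop_poly q S.
Proof. by rewrite bop_polyD bop_polyN. Qed.

Lemma bop_polyMX p S : bop_poly (p * 'X) S = bop_poly p S * S.
Proof.
rewrite (@bop_polyE _ _ (size p).+1); last first.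
  by rewrite (leq_trans (size_polyMleq _ _)) // size_polyX addn2.
rewrite big_ord_recl coefMX eqxx scale0r add0r /bop_poly mulr_suml.
by apply: eq_bigr => i _; rewrite coefMX /= exprSr scalebAl.
Qed.

Lemma bop_polyX S : bop_poly 'X S = S.
Proof. by rewrite -['X]mul1r bop_polyMX bop_poly1 mul1r. Qed.

Lemma bop_polyM p q S : bop_poly (p * q) S = bop_poly p S * bop_poly q S.
Proof.
elim/poly_ind: q => [|q c IH].
  by rewrite mulr0 bop_poly0 mulr0.
rewrite mulrDr mulrA !bop_polyD !bop_polyMX IH mulrDr mulrA bop_polyC.
by rewrite mulrC mul_polyC bop_polyZ -scalebAr mulr1.
Qed.

Lemma bop_polyXn n p S : bop_poly (p ^+ n) S = bop_poly p S ^+ n.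
Proof.
by elim: n => [|n IH]; rewrite ?expr0 ?bop_poly1 // !exprS bop_polyM IH.
Qed.

Lemma bop_poly_comp p q S : bop_poly (p \Po q) S = bop_poly p (bop_poly q S).
Proof.
elim/poly_ind: p => [|p c IH].
  by rewrite comp_poly0 !bop_poly0.
by rewrite comp_poly_MXaddC !bop_polyD bop_polyMX bop_polyM IH !bop_polyC.
Qed.

Lemma bop_poly_selfadjoint p S : selfadjoint S -> selfadjoint (bop_poly p S).
Proof.
move=> Ss; elim/poly_ind: p => [|p c IH].
  rewrite bop_poly0; apply/selfadjointP => x y.
  by rewrite !bopE rdot0l rdot0r.
rewrite bop_polyD bop_polyC; apply: is_adjointD; last first.
  by apply: is_adjointZ; exact: is_adjoint1.
have pS : bop_poly p S * S = S * bop_poly p S.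
  by rewrite -bop_polyMX mulrC bop_polyM bop_polyX.
by rewrite bop_polyMX {2}pS; exact: is_adjointM.
Qed.

Lemma bop_poly_eigen p S x (c : R) : S x = c%:C *: x ->
  bop_poly p S x = (p.[c])%:C *: x.
Proof.
move=> Sx; elim/poly_ind: p => [|p d IH].
  by rewrite bop_poly0 horner0 scale0r.
rewrite bop_polyD bop_polyMX bop_polyC !bopE Sx linearZ /= IH hornerMXaddC.
by rewrite rmorphD rmorphM /= scalerDl scalerA mulrC.
Qed.

(** For self-adjoint [S] this plays the role of the inclusion of the spectrum in [[a, b]]. *)
Definition between (a b : R) S := selfadjoint S /\
  forall x, a * rdot x x <= rdot (S x) x <= b * rdot x x.

Lemma opnorm_between (r : R) S : selfadjoint S -> opnorm S <= r -> between (- r) r S.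
Proof.
move=> Ss Sr; split=> // x; rewrite mulNr -ler_norml.
rewrite (le_trans (normr_rdot_le _ _)) // rdotxx expr2 mulrA.
rewrite ler_wpM2r ?rnorm_ge0 // (le_trans (rnorm_bop_le _ _)) //.
by rewrite ler_wpM2r ?rnorm_ge0.
Qed.

Lemma betweenW (a b c d : R) S : c <= a -> b <= d -> between a b S -> between c d S.
Proof.
move=> ca bd [Ss h]; split=> // x; have /andP[h1 h2] := h x.
apply/andP; split; first by rewrite (le_trans _ h1) // ler_wpM2r ?rdotxx_ge0.
by rewrite (le_trans h2) // ler_wpM2r ?rdotxx_ge0.
Qed.

Lemma betweenN (a b : R) S : between a b S -> between (- b) (- a) (- S).
Proof.
move=> [Ss h]; split; first exact: is_adjointN.
by move=> x; rewrite bopE rdotNl !mulNr !lerN2 andbC.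
Qed.

Lemma rdot_bop_poly_sqr p q S x : selfadjoint S ->
  rdot (bop_poly (q ^+ 2 * p) S x) x =
  rdot (bop_poly p S (bop_poly q S x)) (bop_poly q S x).
Proof.
move=> Ss; rewrite expr2 mulrAC -mulrA !bop_polyM !bopE.
by have /selfadjointP -> := bop_poly_selfadjoint q Ss.
Qed.

(** Even powers are absorbed as the square of a self-adjoint polynomial in [S]. There remains [1],
    ['X], [1 - 'X] or ['X * (1 - 'X)], and the last is again a sum of squares times the two linear
    factors. *)
Lemma bernstein_bop_ge0 n k S x : between 0 1 S ->
  0 <= rdot (bop_poly (bernstein R n k) S x) x.
Proof.
move=> [Ss h]; rewrite /bernstein bop_polyZ bopE rdotZl mulr_ge0 //.
move: (n - k)%N => m.
have -> : 'X^k * (1 - 'X) ^+ m = ('X^(k./2) * (1 - 'X) ^+ m./2) ^+ 2 *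
    ('X^(odd k) * (1 - 'X) ^+ odd m) :> {poly R}.
  rewrite exprMn -!exprM -mulrACA -!exprD !muln2.
  by rewrite addnC odd_double_half addnC odd_double_half.
rewrite rdot_bop_poly_sqr //; move: (bop_poly _ S x) => {}x.
have hX y : 0 <= rdot (bop_poly 'X S y) y.
  by rewrite bop_polyX; have := h y; rewrite mul0r => /andP[].
have hX' y : 0 <= rdot (bop_poly (1 - 'X) S y) y.
  rewrite bop_polyB bop_poly1 bop_polyX !bopE rdotBl subr_ge0.
  by have := h y; rewrite mul1r => /andP[].
case: (odd k); case: (odd m); rewrite ?expr0 ?expr1 ?mulr1 ?mul1r //.
  have -> : 'X * (1 - 'X) = (1 - 'X) ^+ 2 * 'X + 'X ^+ 2 * (1 - 'X) :> {poly R} by ring.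
  by rewrite bop_polyD bopE rdotDl !rdot_bop_poly_sqr // addr_ge0.
by rewrite bop_poly1 rdotxx_ge0.
Qed.

(** After rescaling to [[0, 1]], the quadratic form of a polynomial in [T] at a fixed vector is a
    functional to which [bernstein_positive] applies. *)
Lemma bop_poly_ge0 (a b : R) p S x : a < b -> between a b S ->
  (forall t, a <= t <= b -> 0 <= p.[t]) -> 0 <= rdot (bop_poly p S x) x.
Proof.
move=> ab [Ss h] p0; have ba : 0 < b - a by rewrite subr_gt0.
pose T := (b - a)^-1%:C *: (S - a%:C *: (1 : bop V)).
have T01 : between 0 1 T.
  split.
    by apply: is_adjointZ; apply: is_adjointB => //; apply: is_adjointZ.
  move=> y; rewrite mul0r mul1r !bopE rdotZl rdotBl rdotZl.
  have /andP[h1 h2] := h y; rewrite mulr_ge0 ?invr_ge0 ?subr_ge0 //=.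
    by rewrite mulrC ler_pdivrMr // mulrBr (mulrC _ b) (mulrC _ a) lerB.
  exact: ltW.
pose q : {poly R} := (b - a) *: 'X + a%:P.
have SE : S = bop_poly q T.
  rewrite bop_polyD bop_polyZ bop_polyX bop_polyC scalerA -rmorphM /=.
  by rewrite mulfV ?gt_eqF // scale1r subrK.
rewrite SE -bop_poly_comp.
apply: (@bernstein_positive R (fun r => rdot (bop_poly r T x) x)).
- by move=> r s; rewrite bop_polyD bopE rdotDl.
- by move=> c r; rewrite bop_polyZ bopE rdotZl.
- by move=> n k _; exact: bernstein_bop_ge0.
- move=> t /andP[t0 t1]; rewrite horner_comp; apply: p0.
  by rewrite /q !hornerE; apply/andP; split; nra.
Qed.

Lemma opnorm_bop_poly_le (a b m : R) p S : a < b -> between a b S -> 0 <= m ->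
  (forall t, a <= t <= b -> `|p.[t]| <= m) -> opnorm (bop_poly p S) <= m.
Proof.
move=> ab abS m0 pm; apply: opnorm_ler => // x.
have [Ss _] := abS.
(* Positivity of [m ^+ 2 - p ^+ 2] says that [|p(S) x| <= m |x|]. The factor 1 gives the shape
   [q ^+ 2 * p] of [rdot_bop_poly_sqr]. *)
have := @bop_poly_ge0 a b ((m ^+ 2)%:P - p ^+ 2 * 1) S x ab abS.
rewrite bop_polyB bop_polyC !bopE rdotBl rdotZl rdot_bop_poly_sqr // bop_poly1 bopE.
rewrite subr_ge0 !rdotxx -exprMn ler_pXn2r ?nnegrE ?mulr_ge0 ?rnorm_ge0 // => -> //.
move=> t tab; rewrite mulr1 hornerD hornerC hornerN horner_exp subr_ge0.
by rewrite -[leLHS]real_normK ?num_real // ler_pXn2r ?nnegrE // pm.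
Qed.

End PolynomialCalculus.

Section ContinuousCalculus.
Variables (R : realType) (V : hilbertType R).
Implicit Types (S A B F G : bop V) (p q : {poly R}) (x y : V) (f g : R -> R).

(** The relation [F = f(S)] relative to an interval. The algebraic rules hold for every [S];
    uniqueness, existence and norm bounds rest on [between a b S]. *)
Definition isfc (a b : R) S f F := forall e : R, 0 < e -> exists p : {poly R},
  (forall t, a <= t <= b -> `|p.[t] - f t| <= e) /\ opnorm (bop_poly p S - F) <= e.

Lemma isfc_poly a b S p : isfc a b S (horner p) (bop_poly p S).
Proof.
move=> e e0; exists p; rewrite subrr opnorm0 ltW //; split=> // t _.
by rewrite subrr normr0 ltW.
Qed.

Lemma isfc_ext a b S f g F : isfc a b S f F ->
  (forall t, a <= t <= b -> f t = g t) -> isfc a b S g F.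
Proof.
move=> fF fg e e0; have [p [hp pF]] := fF e e0; exists p; split=> // t tab.
by rewrite -fg // hp.
Qed.

Lemma isfcW a b c d S f F : a <= c -> d <= b -> isfc a b S f F -> isfc c d S f F.
Proof.
move=> ac db fF e e0; have [p [hp pF]] := fF e e0; exists p; split=> // t /andP[ct td].
by apply: hp; rewrite (le_trans ac) //= (le_trans td).
Qed.

Lemma isfc_id a b S : isfc a b S id S.
Proof.
rewrite -{2}[S]bop_polyX; apply: isfc_ext (isfc_poly _ _ _ _) _ => t _.
by rewrite hornerX.
Qed.

Lemma isfc_cst a b S (c : R) : isfc a b S (fun _ => c) (c%:C *: (1 : bop V)).
Proof.
rewrite -(bop_polyC c S); apply: isfc_ext (isfc_poly _ _ _ _) _ => t _.
by rewrite hornerC.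
Qed.

Lemma isfcD a b S f g F G : isfc a b S f F -> isfc a b S g G ->
  isfc a b S (fun t => f t + g t) (F + G).
Proof.
move=> fF gG e e0; have e20 : 0 < e / 2 by rewrite divr_gt0.
have [p [hp pF]] := fF _ e20; have [q [hq qG]] := gG _ e20.
exists (p + q); split=> [t tab|].
  rewrite hornerD opprD addrACA [e]splitr (le_trans (ler_normD _ _)) //.
  by rewrite lerD ?hp ?hq.
by rewrite bop_polyD opprD addrACA [e]splitr (le_trans (opnormD _ _)) // lerD.
Qed.

Lemma isfc_bounded a b S f F : isfc a b S f F ->
  exists2 M : R, 0 < M & forall t, a <= t <= b -> `|f t| <= M.
Proof.
move=> /(_ 1 ltr01)[p [hp _]].
have [|M M0 hM] := @segment_bounded R a b (horner p).
  by apply: continuous_subspaceT => t; exact: continuous_horner.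
exists (M + 1) => [|t tab]; first by rewrite addr_gt0.
rewrite -[f t](subKr p.[t]) (le_trans (ler_normB _ _)) // lerD //; first exact: hM.
exact: hp.
Qed.

Lemma isfcM a b S f g F G : isfc a b S f F -> isfc a b S g G ->
  isfc a b S (fun t => f t * g t) (F * G).
Proof.
move=> fF gG; have [M1 M10 h1] := isfc_bounded fF.
have [M2 M20 h2] := isfc_bounded gG.
pose K := M1 + M2 + opnorm F + opnorm G.
have K0 : 0 < K.
  by have := opnorm_ge0 F; have := opnorm_ge0 G; rewrite /K; lra.
have [fK gK] : M1 <= K /\ M2 <= K.
  by have := opnorm_ge0 F; have := opnorm_ge0 G; rewrite /K; lra.
have [FK GK] : opnorm F <= K /\ opnorm G <= K.
  by have := opnorm_ge0 F; have := opnorm_ge0 G; rewrite /K; lra.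
(* As [d <= 1], both [q] and [q(S)] stay within [K + 1]; the product error is then at most
   [d (K + 1) + K d = d (2 K + 1)]. *)
move=> e e0; pose d := Num.min 1 (e / (2 * K + 1)).
have d0 : 0 < d by rewrite lt_min ltr01 divr_gt0 // addr_gt0 // mulr_gt0.
have d1 : d <= 1 by rewrite ge_min lexx.
have de : d * (K + 1) + K * d <= e.
  have -> : d * (K + 1) + K * d = d * (2 * K + 1) by ring.
  by rewrite -ler_pdivlMr ?addr_gt0 ?mulr_gt0 // ge_min lexx orbT.
have [p [hp pF]] := fF _ d0; have [q [hq qG]] := gG _ d0.
exists (p * q); split=> [t tab|].
  rewrite hornerM.
  have -> : p.[t] * q.[t] - f t * g t =
    (p.[t] - f t) * q.[t] + f t * (q.[t] - g t) by ring.
  rewrite (le_trans (ler_normD _ _)) // (le_trans _ de) // !normrM lerD //.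
    rewrite ler_pM // ?hp // -[q.[t]](subrK (g t)) addrC.
    rewrite (le_trans (ler_normD _ _)) // lerD // ?(le_trans (h2 _ tab)) //.
    by rewrite (le_trans (hq _ tab)).
  by rewrite ler_pM // ?hq // (le_trans (h1 _ tab)).
rewrite bop_polyM.
have -> : bop_poly p S * bop_poly q S - F * G =
    (bop_poly p S - F) * bop_poly q S + F * (bop_poly q S - G).
  by rewrite mulrBl mulrBr subrKA.
rewrite (le_trans (opnormD _ _)) // (le_trans _ de) // lerD //.
  rewrite (le_trans (opnormM _ _)) // ler_pM ?opnorm_ge0 //.
  rewrite -[bop_poly q S](subrK G) addrC (le_trans (opnormD _ _)) // lerD //.
  by rewrite (le_trans qG).
by rewrite (le_trans (opnormM _ _)) // ler_pM ?opnorm_ge0.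
Qed.

Lemma isfcZ a b S f F (c : R) : isfc a b S f F ->
  isfc a b S (fun t => c * f t) (c%:C *: F).
Proof.
by move=> /(isfcM (isfc_cst a b S c)); rewrite -scalebAl mul1r.
Qed.

Lemma isfcB a b S f g F G : isfc a b S f F -> isfc a b S g G ->
  isfc a b S (fun t => f t - g t) (F - G).
Proof.
move=> fF /(isfcZ (-1)); rewrite rmorphN1 scaleN1r => gG.
by apply: isfc_ext (isfcD fF gG) _ => t _; rewrite mulN1r.
Qed.

Lemma isfc_poly_comp a b S f F q : isfc a b S f F ->
  isfc a b S (fun t => q.[f t]) (bop_poly q F).
Proof.
move=> fF; elim/poly_ind: q => [|q c IH].
  rewrite bop_poly0 -(scale0r (1 : bop V)) -(rmorph0 (real_complex R)).
  apply: isfc_ext (isfc_cst _ _ _ _) _ => t _.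
  by rewrite horner0.
rewrite bop_polyD bop_polyMX bop_polyC.
apply: isfc_ext (isfcD (isfcM IH fF) (isfc_cst _ _ _ c)) _ => t _.
by rewrite hornerMXaddC.
Qed.

Lemma isfc_comp a b c d S f F g G : isfc a b S f F ->
  (forall t, a <= t <= b -> c <= f t <= d) -> isfc c d F g G ->
  isfc a b S (fun t => g (f t)) G.
Proof.
move=> fF fcd gG e e0; have e20 : 0 < e / 2 by rewrite divr_gt0.
have [q [hq qG]] := gG _ e20.
have [p [hp pF]] := isfc_poly_comp q fF e20.
exists p; split=> [t tab|].
  rewrite -(subrKA q.[f t]) [e]splitr (le_trans (ler_normD _ _)) // lerD ?hp //.
  by rewrite hq // fcd.
by rewrite -(subrKA (bop_poly q F)) [e]splitr (le_trans (opnormD _ _)) // lerD.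
Qed.

Lemma isfc_selfadjoint a b S f F : selfadjoint S -> isfc a b S f F -> selfadjoint F.
Proof.
move=> Ss fF; apply: selfadjoint_closed => e /fF[p [_ pF]].
by exists (bop_poly p S) => //; exact: bop_poly_selfadjoint.
Qed.

Lemma isfc_eigen a b S f F x (c : R) : isfc a b S f F -> a <= c <= b ->
  S x = c%:C *: x -> F x = (f c)%:C *: x.
Proof.
move=> fF cab Sx; apply/eqP; rewrite -subr_eq0 -rnorm_eq0; apply/eqP.
apply: eq0_small; first exact: rnorm_ge0.
move=> e e0; pose K := rnorm x + 1.
have K0 : 0 < K by rewrite ltr_wpDl // rnorm_ge0.
have [p [hp pF]] := fF _ (divr_gt0 (divr_gt0 e0 (ltr0n R 2)) K0).
set d := _ / K in hp pF.
have -> : F x - (f c)%:C *: x =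
    (p.[c] - f c)%:C *: x - (bop_poly p S - F) x.
  rewrite !bopE (bop_poly_eigen _ Sx) rmorphB /= scalerBl opprB.
  by rewrite [RHS]addrC subrKA.
have dK : d * rnorm x <= e / 2.
  rewrite /d mulrAC ler_pdivrMr // ler_pM2l ?divr_gt0 //.
  by rewrite lerDl.
rewrite (le_trans (rnormD _ _)) // [e]splitr rnormN rnormZ lerD //.
  by rewrite (le_trans _ dK) // ler_wpM2r ?rnorm_ge0 // hp.
by rewrite (le_trans (rnorm_bop_le _ _)) // (le_trans _ dK) // ler_wpM2r ?rnorm_ge0.
Qed.

Lemma isfcN a b S f F : isfc a b S f F ->
  isfc (- b) (- a) (- S) (fun t => f (- t)) F.
Proof.
move=> fF e e0; have [p [hp pF]] := fF _ e0.
exists (p \Po (- 'X)); split.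
  move=> t /andP[bt ta]; rewrite horner_comp hornerN hornerX; apply: hp.
  by rewrite lerNr ta lerNl bt.
by rewrite bop_poly_comp bop_polyN bop_polyX opprK.
Qed.

Section Bounds.
Variables (a b : R) (S : bop V).
Hypotheses (ab : a < b) (abS : between a b S).

Lemma isfc_opnorm_le f F (m : R) : isfc a b S f F -> 0 <= m ->
  (forall t, a <= t <= b -> `|f t| <= m) -> opnorm F <= m.
Proof.
move=> fF m0 fm; apply/ler_addgt0Pr => e e0.
have e20 : 0 < e / 2 by rewrite divr_gt0.
have [p [hp pF]] := fF _ e20.
rewrite -[F](subKr (bop_poly p S)) (le_trans (opnormD _ _)) // opnormN.
rewrite [e]splitr addrA lerD // (opnorm_bop_poly_le ab abS) //.
  by rewrite addr_ge0 // ltW.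
move=> t tab; rewrite -[p.[t]](subrK (f t)) addrC (le_trans (ler_normD _ _)) //.
by rewrite lerD ?fm ?hp.
Qed.

Lemma isfc_dist_le f g F G (m : R) : isfc a b S f F -> isfc a b S g G ->
  0 <= m -> (forall t, a <= t <= b -> `|f t - g t| <= m) -> opnorm (F - G) <= m.
Proof. by move=> fF gG; apply: isfc_opnorm_le (isfcB fF gG). Qed.

Lemma isfc_uniq f g F G : isfc a b S f F -> isfc a b S g G ->
  (forall t, a <= t <= b -> f t = g t) -> F = G.
Proof.
move=> fF gG fg; apply: bop_eq_small => e e0; apply: isfc_dist_le fF gG (ltW e0) _.
by move=> t tab; rewrite fg // subrr normr0 ltW.
Qed.

Lemma isfc_between f F (c d : R) : isfc a b S f F ->
  (forall t, a <= t <= b -> c <= f t <= d) -> between c d F.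
Proof.
move=> fF fcd; split; first exact: isfc_selfadjoint abS.1 fF.
move=> x; suff h (e : R) : 0 < e ->
    (c - e) * rdot x x <= rdot (F x) x <= (d + e) * rdot x x.
  have h0 := rdotxx_ge0 x; have h1 : 0 < rdot x x + 1 by lra.
  apply/andP; split; apply/ler_addgt0Pr => e e0.
    have /andP[+ _] := h _ (divr_gt0 e0 h1); rewrite mulrBl lerBlDr => /le_trans.
    by apply; rewrite lerD2l mulrAC ler_pdivrMr // ler_pM2l // lerDl.
  have /andP[_ /le_trans] := h _ (divr_gt0 e0 h1); apply.
  by rewrite mulrDl lerD2l mulrAC ler_pdivrMr // ler_pM2l // lerDl.
move=> e0; have e20 : 0 < e / 2 by rewrite divr_gt0.
have [p [hp pF]] := fF _ e20.
have pF' := opnorm_between (is_adjointB (bop_poly_selfadjoint p abS.1)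
  (isfc_selfadjoint abS.1 fF)) pF.
have := pF'.2 x; rewrite !bopE rdotBl => /andP[h1 h2].
have := @bop_poly_ge0 _ _ a b (p - (c - e / 2)%:P) S x ab abS.
rewrite bop_polyB bop_polyC !bopE rdotBl rdotZl subr_ge0 => h3.
have := @bop_poly_ge0 _ _ a b ((d + e / 2)%:P - p) S x ab abS.
rewrite bop_polyB bop_polyC !bopE rdotBl rdotZl subr_ge0 => h4.
have {}h3 : (c - e / 2) * rdot x x <= rdot (bop_poly p S x) x.
  apply: h3 => t tab; rewrite !hornerE; have := hp _ tab.
  by rewrite ler_norml; have := fcd _ tab; lra.
have {}h4 : rdot (bop_poly p S x) x <= (d + e / 2) * rdot x x.
  apply: h4 => t tab; rewrite !hornerE; have := hp _ tab.
  by rewrite ler_norml; have := fcd _ tab; lra.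
apply/andP; split; lra.
Qed.

Lemma isfc_ex f : {within `[a, b], continuous f} -> exists F, isfc a b S f F.
Proof.
move=> fc.
have /choice[p hp] : forall n : nat, exists p : {poly R},
    forall t, a <= t <= b -> `|p.[t] - f t| <= n.+1%:R^-1.
  by move=> n; apply: weierstrass.
have [e e0|F hF] := @bop_complete R V (fun n => bop_poly (p n) S).
  have [N hN] := natSinv_small (divr_gt0 e0 (ltr0n R 2)).
  exists N => m n Nm mn; rewrite -bop_polyB.
  apply: (opnorm_bop_poly_le ab abS (ltW e0)) => t tab.
  rewrite hornerD hornerN -(subrKA (f t)) [e]splitr (le_trans (ler_normD _ _)) //.
  rewrite lerD // ?(le_trans (hp _ _ tab)) ?hN //.
  by rewrite distrC (le_trans (hp _ _ tab)) ?hN // (leq_trans Nm).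
exists F => e e0; have [N1 h1] := natSinv_small e0; have [N2 h2] := hF _ e0.
exists (p (maxn N1 N2)); split=> [t tab|]; last by apply: h2; exact: leq_maxr.
by rewrite (le_trans (hp _ _ tab)) // h1 // leq_maxl.
Qed.

(** The real points of the spectrum lie in [[a, b]]: for [x] outside, the function [(t - x)^-1] is
    continuous on the interval and its operator inverts [S - x]. *)
Lemma isfc_funcalc f F : isfc a b S f F -> is_funcalc f S F.
Proof.
move=> fF; split; first exact: abS.1.
move=> e e0; have [p [hp pF]] := fF _ e0; exists p; split=> // x; rewrite /spectrum /= => xS.
apply: hp; apply: contrapT => xab; apply: xS.
have xab' t : a <= t <= b -> t - x != 0.
  by move=> tab; rewrite subr_eq0; apply: contra_notN xab => /eqP <-.
have [|G fG] := @isfc_ex (fun t => (t - x)^-1).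
  apply/subspace_continuousP => t /=; rewrite in_itv /= => tab.
  apply: cvg_within_filter; apply: cvgV; first exact: xab'.
  by apply: cvgB; [exact: cvg_id|exact: cvg_cst].
have fS := isfcB (isfc_id a b S) (isfc_cst a b S x).
exists G; split.
  by have := isfc_uniq (isfcM fS fG) (isfc_cst a b S 1); rewrite scale1r;
     apply => t tab; rewrite /= mulfV // xab'.
by have := isfc_uniq (isfcM fG fS) (isfc_cst a b S 1); rewrite scale1r;
   apply => t tab; rewrite /= mulVf // xab'.
Qed.

End Bounds.
End ContinuousCalculus.

(** Clear for polynomials, and one polynomial approximates [f] for both operators. Taking
    [S2 = - S1] gives anticommutation rules; taking distinct spaces gives the restriction of a block
    operator to one summand. *)
Lemma isfc_intertwine (R : realType) (V1 V2 : hilbertType R)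
    (W : {linear V1 -> V2}) (r : R) (a b : R) (S1 F1 : bop V1) (S2 F2 : bop V2)
    (f : R -> R) :
  a < b -> between a b S1 -> between a b S2 ->
  (forall x, rnorm (W x) <= r * rnorm x) ->
  (forall x, W (S1 x) = S2 (W x)) ->
  {within `[a, b], continuous f} ->
  isfc a b S1 f F1 -> isfc a b S2 f F2 -> forall x, W (F1 x) = F2 (W x).
Proof.
move=> ab abS1 abS2 Wr WS fc fF1 fF2 x.
have Wp p y : W (bop_poly p S1 y) = bop_poly p S2 (W y).
  elim/poly_ind: p y => [|p c IH] y.
    by rewrite !bop_poly0 !bopE linear0.
  by rewrite !bop_polyD !bop_polyMX !bop_polyC !bopE linearD linearZ IH WS.
apply/eqP; rewrite -subr_eq0 -rnorm_eq0; apply/eqP.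
apply: eq0_small; first exact: rnorm_ge0.
move=> e e0; pose K := (`|r| + 1) * (rnorm x + 1).
have x0 := rnorm_ge0 x; have r0 := normr_ge0 r.
have K0 : 0 < K by rewrite mulr_gt0 // ltr_wpDl.
pose d := e / 4 / K; have d0 : 0 < d by rewrite !divr_gt0.
have dK : d * K = e / 4 by rewrite divfK // gt_eqF.
have Wr' y : rnorm (W y) <= `|r| * rnorm y.
  by rewrite (le_trans (Wr _)) // ler_wpM2r ?rnorm_ge0 // ler_norm.
have [p hp] := weierstrass ab fc d0.
have h1 : opnorm (bop_poly p S1 - F1) <= d.
  exact: (isfc_dist_le ab abS1 (isfc_poly a b S1 p) fF1 (ltW d0) hp).
have h2 : opnorm (bop_poly p S2 - F2) <= d.
  exact: (isfc_dist_le ab abS2 (isfc_poly a b S2 p) fF2 (ltW d0) hp).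
have -> : W (F1 x) - F2 (W x) =
    (bop_poly p S2 - F2) (W x) - W ((bop_poly p S1 - F1) x).
  by rewrite !bopE linearB Wp opprB [RHS]addrC subrKA.
rewrite (le_trans (rnormD _ _)) // rnormN.
have k1 : rnorm ((bop_poly p S2 - F2) (W x)) <= d * (`|r| * rnorm x).
  by rewrite (le_trans (rnorm_bop_le _ _)) // ler_pM ?opnorm_ge0 ?rnorm_ge0.
have k2 : rnorm (W ((bop_poly p S1 - F1) x)) <= d * (`|r| * rnorm x).
  rewrite (le_trans (Wr' _)) // mulrCA ler_wpM2l //.
  by rewrite (le_trans (rnorm_bop_le _ _)) // ler_wpM2r.
have : d * (`|r| * rnorm x) <= d * K.
  by rewrite ler_pM2l // ler_pM // lerDl.
lra.
Qed.

(** * Rotations *)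

Lemma subr_ACA (M : zmodType) (a b c d e f : M) :
  (a + b) - (c + d) - (e + f) = (a - c - e) + (b - d - f).
Proof. by rewrite !opprD (addrACA a b) (addrACA (a - c)). Qed.

(** Linear identities between operators are tested in the real inner product, where [ring] decides
    them. *)
Ltac bop_lin := apply: bopP => ?; rewrite !bopE; apply: rdot_inj => ?;
  rewrite !(rdotDl, rdotNl, rdotZl, rdot0l); ring.

(** * Estimates for sine, cosine and their Taylor polynomials *)

Section TrigonometricEstimates.
Variable R : realType.
Implicit Types x y t r e : R.

Lemma sin_lipschitz x y : `|sin x - sin y| <= `|x - y|.
Proof.
wlog xy : x y / y < x.
  move=> h; have [xy|yx|->] := ltgtP y x; first exact: h.
    by rewrite distrC (distrC x) h.
  by rewrite subrr normr0.
have [|c _ ->] := @MVT R sin cos y x xy.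
  by apply: continuous_subspaceT; exact: continuous_sin.
by rewrite normrM ler_piMl // cos_max.
Qed.

Lemma cos_lipschitz x y : `|cos x - cos y| <= `|x - y|.
Proof.
have -> : x - y = (x + pi / 2) - (y + pi / 2) by ring.
by rewrite -!sinDpihalf sin_lipschitz.
Qed.

Lemma cos_sub1_le x : `|cos x - 1| <= x ^+ 2.
Proof.
have -> : cos x = 1 - 2 * sin (x / 2) ^+ 2.
  rewrite {1}[x](_ : _ = (x / 2) *+ 2); last by rewrite -mulr_natr divfK.
  by rewrite cos_mulr2n cos2sin2; ring.
rewrite addrAC subrr sub0r normrN normrM (ger0_norm (ler0n R 2)) normrX.
have := sin_lipschitz (x / 2) 0; rewrite sin0 !subr0 => h.
have : `|sin (x / 2)| ^+ 2 <= `|x / 2| ^+ 2 by rewrite ler_pXn2r ?nnegrE.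
rewrite !real_normK ?num_real // => {}h.
have := sqr_ge0 x; rewrite expr_div_n in h; lra.
Qed.

(** Order two instead of the sharp three is enough for first-order expansions with a quadratic
    remainder. *)
Lemma sin_subx_le x : `|sin x - x| <= x ^+ 2.
Proof.
wlog x0 : x / 0 < x.
  move=> h; have [x0|x0|<-] := ltgtP 0 x; first exact: h.
    by have := h (- x); rewrite oppr_gt0 sinN sqrrN -opprD normrN; apply.
  by rewrite sin0 subrr normr0 expr0n.
pose f z : R := sin z - z.
have [|c] := @MVT R f (fun z => cos z - 1) 0 x x0.
  apply: continuous_subspaceT => z; apply: cvgB; first exact: continuous_sin.
  exact: cvg_id.
rewrite in_itv /= /f sin0 !subr0 => /andP[c0 cx] ->.
rewrite normrM (gtr0_norm x0) expr2 ler_wpM2r ?(ltW x0) //=.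
have := cos_lipschitz c 0; rewrite cos0 subr0 (gtr0_norm c0) => /le_trans; apply.
exact: ltW.
Qed.

Lemma cos_taylor x y : `|cos (x + y) - cos x + y * sin x| <= 2 * y ^+ 2.
Proof.
rewrite cosD.
have -> : cos x * cos y - sin x * sin y - cos x + y * sin x =
  cos x * (cos y - 1) - sin x * (sin y - y) by ring.
rewrite (le_trans (ler_normB _ _)) // !normrM.
have -> : 2 * y ^+ 2 = y ^+ 2 + y ^+ 2 by ring.
rewrite lerD // -[leRHS]mul1r ler_pM // ?cos_max ?sin_max //.
  exact: cos_sub1_le.
exact: sin_subx_le.
Qed.

Lemma sin_taylor x y : `|sin (x + y) - sin x - y * cos x| <= 2 * y ^+ 2.
Proof.
rewrite sinD.
have -> : sin x * cos y + cos x * sin y - sin x - y * cos x =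
  sin x * (cos y - 1) + cos x * (sin y - y) by ring.
rewrite (le_trans (ler_normD _ _)) // !normrM.
have -> : 2 * y ^+ 2 = y ^+ 2 + y ^+ 2 by ring.
rewrite lerD // -[leRHS]mul1r ler_pM // ?cos_max ?sin_max //.
  exact: cos_sub1_le.
exact: sin_subx_le.
Qed.

Lemma series_tail_le (u w : R ^nat) (l : R) n :
  (forall k, `|u k| <= w k) -> cvgn (series w) -> series u @ \oo --> l ->
  `|series u n - l| <= limn (series w) - series w n.
Proof.
move=> uw wc ul.
have w0 k : 0 <= w k by rewrite (le_trans _ (uw k)).
apply/ler_addgt0Pr => e e0.
have /cvgrPdist_le/(_ e e0)[N _ hN] := ul.
pose m := maxn n N.
have -> : series u n - l = - (l - series u m) - (series u m - series u n) by ring.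
rewrite (le_trans (ler_normB _ _)) // addrC normrN lerD //; last first.
  by apply: hN; rewrite /= leq_maxr.
apply: (@le_trans _ _ (series w m - series w n)).
  rewrite !sub_series_geq ?leq_maxl // (le_trans (ler_norm_sum _ _ _)) //.
  by apply: ler_sum => k _; exact: uw.
rewrite lerD2r; apply: nondecreasing_cvgn_le => //.
by apply/nondecreasing_seqP => k; rewrite seriesEnat /= big_nat_recr //= lerDl.
Qed.

Definition cos_poly t n : {poly R} := \sum_(k < n) cos_coeff t k *: 'X^k.
Definition sin_poly t n : {poly R} := \sum_(k < n) sin_coeff t k *: 'X^k.

Lemma horner_cos_poly t n x : (cos_poly t n).[x] = series (cos_coeff (t * x)) n.
Proof.
rewrite horner_sum seriesEord; apply: eq_bigr => k _.
by rewrite hornerZ hornerXn /cos_coeff /= exprMn; ring.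
Qed.

Lemma horner_sin_poly t n x : (sin_poly t n).[x] = series (sin_coeff (t * x)) n.
Proof.
rewrite horner_sum seriesEord; apply: eq_bigr => k _.
by rewrite hornerZ hornerXn /sin_coeff /= exprMn; ring.
Qed.

(** The exponential series at [|t| r] dominates both series for all [|x| <= r], so its tail bounds
    both errors uniformly. *)
Lemma trig_poly_approx t r e : 0 < e -> exists N, forall n, (N <= n)%N ->
  forall x, `|x| <= r -> `|(cos_poly t n).[x] - cos (t * x)| <= e /\
                         `|(sin_poly t n).[x] - sin (t * x)| <= e.
Proof.
move=> e0; pose w := exp_coeff (`|t| * r).
have wc : cvgn (series w) by exact: is_cvg_series_exp_coeff.
have /cvgrPdist_le/(_ e e0)[N _ hN] := wc.
exists N => n Nn x xr.
have wn : limn (series w) - series w n <= e.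
  by rewrite (le_trans (ler_norm _)) // hN.
have tw k : `|t * x| ^+ k / k`!%:R <= w k.
  rewrite /w /exp_coeff /= ler_wpM2r ?invr_ge0 // lerXn2r ?nnegrE //.
    by rewrite mulr_ge0 // (le_trans _ xr).
  by rewrite normrM ler_wpM2l.
(* The Boolean stands for the parity factor in the coefficients of sine and cosine. *)
have uw (b : bool) (m k : nat) :
    `|b%:R * (-1) ^+ m * (t * x) ^+ k / k`!%:R| <= w k.
  move: (t * x) (tw k) => y twk; rewrite (le_trans _ twk) //.
  rewrite !normrM normfV !normr_nat !normrX normrN1 expr1n mulr1.
  by rewrite ler_wpM2r ?invr_ge0 //; case: b; rewrite ?mul1r ?mul0r ?exprn_ge0.
split; rewrite (le_trans _ wn) //.
  rewrite horner_cos_poly; apply: series_tail_le => //.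
    by move=> k; exact: uw.
  by rewrite unlock; exact: is_cvg_series_cos_coeff.
rewrite horner_sin_poly; apply: series_tail_le => //.
  by move=> k; exact: uw.
by rewrite unlock; exact: is_cvg_series_sin_coeff.
Qed.

End TrigonometricEstimates.

Section Calculus.
Variables (R : realType) (V : hilbertType R).

(* The choice goes through an opaque lemma, as unification would otherwise
   unfold the operators that it compares. *)
Lemma fcal_subproof a b S f : exists F : bop V,
  a < b -> between a b S -> {within `[a, b], continuous f} -> isfc a b S f F.
Proof.
have [[F fF]|noF] := pselect (exists F, isfc a b S f F); first by exists F.
by exists 0 => ab abS fc; case: noF; exact: isfc_ex.
Qed.

Definition fcal a b S f : bop V := proj1_sig (cid (fcal_subproof a b S f)).

Lemma fcalP a b S f : a < b -> between a b S -> {within `[a, b], continuous f} ->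
  isfc a b S f (fcal a b S f).
Proof. by rewrite /fcal; case: cid. Qed.

Lemma isfcM_comm a b (S : bop V) f g F G : a < b -> between a b S ->
  isfc a b S f F -> isfc a b S g G -> F * G = G * F.
Proof.
move=> ab abS fF gG; apply: (isfc_uniq ab abS (isfcM fF gG) (isfcM gG fF)).
by move=> t _; rewrite mulrC.
Qed.

End Calculus.

Section Rotation.
Variables (R : realType) (V : hilbertType R) (J X : bop V).
Hypothesis JXP :
  [/\ J * J = 1, selfadjoint J, selfadjoint X & J * X = - (X * J)].

Let JJ : J * J = 1. Proof. by case: JXP. Qed.
Let Js : selfadjoint J. Proof. by case: JXP. Qed.
Let Xs : selfadjoint X. Proof. by case: JXP. Qed.
Let JX : J * X = - (X * J). Proof. by case: JXP. Qed.

(** Adding 1 keeps the interval [[-r, r]] nondegenerate when [X = 0]. *)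
Let r : R := opnorm X + 1.

Let r0 : 0 < r. Proof. by rewrite ltr_wpDl // opnorm_ge0. Qed.

Let rr : - r < r. Proof. by rewrite gtrN. Qed.

Let rX : between (- r) r X.
Proof. by apply: opnorm_between => //; rewrite lerDl. Qed.

Let rNX : between (- r) r (- X).
Proof. by have := betweenN rX; rewrite opprK. Qed.

Definition cosb t : bop V := fcal (- r) r X (fun x => cos (t * x)).
Definition sinb t : bop V := fcal (- r) r X (fun x => sin (t * x)).
(** By [bexp_rotb] this is the exponential of [t X J]; for a tangent [X] the product [X J] is the
    commutator in the definition of geodesics. *)
Definition rotb t : bop V := cosb t + sinb t * J.

Let cos_cont t : {within `[- r, r], continuous (fun x => cos (t * x))}.
Proof.
apply: continuous_subspaceT => x.
apply: continuous_comp; last exact: continuous_cos.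
by apply: cvgM; [exact: cvg_cst|exact: cvg_id].
Qed.

Let sin_cont t : {within `[- r, r], continuous (fun x => sin (t * x))}.
Proof.
apply: continuous_subspaceT => x.
apply: continuous_comp; last exact: continuous_sin.
by apply: cvgM; [exact: cvg_cst|exact: cvg_id].
Qed.

Lemma cosbP t : isfc (- r) r X (fun x => cos (t * x)) (cosb t).
Proof. exact: fcalP. Qed.

Lemma sinbP t : isfc (- r) r X (fun x => sin (t * x)) (sinb t).
Proof. exact: fcalP. Qed.

Let uniq f g F G := @isfc_uniq R V (- r) r X rr rX f g F G.

Lemma cosb_selfadjoint t : selfadjoint (cosb t).
Proof. exact: isfc_selfadjoint (cosbP t). Qed.

Lemma sinb_selfadjoint t : selfadjoint (sinb t).
Proof. exact: isfc_selfadjoint (sinbP t). Qed.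

Lemma cosbD s t : cosb (s + t) = cosb s * cosb t - sinb s * sinb t.
Proof.
apply: uniq (cosbP _) (isfcB (isfcM (cosbP s) (cosbP t)) (isfcM (sinbP s) (sinbP t))) _.
by move=> x _; rewrite mulrDl cosD.
Qed.

Lemma sinbD s t : sinb (s + t) = sinb s * cosb t + cosb s * sinb t.
Proof.
apply: uniq (sinbP _) (isfcD (isfcM (sinbP s) (cosbP t)) (isfcM (cosbP s) (sinbP t))) _.
by move=> x _; rewrite mulrDl sinD.
Qed.

Lemma cosbN t : cosb (- t) = cosb t.
Proof. by apply: uniq (cosbP _) (cosbP _) _ => x _; rewrite mulNr cosN. Qed.

Lemma sinbN t : sinb (- t) = - sinb t.
Proof.
have := isfcZ (-1) (sinbP t); rewrite rmorphN1 scaleN1r => h.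
by apply: uniq (sinbP _) h _ => x _; rewrite mulNr sinN mulN1r.
Qed.

Lemma cosb0 : cosb 0 = 1.
Proof.
rewrite -[1]scale1r; apply: uniq (cosbP _) (isfc_cst _ _ _ 1) _ => x _.
by rewrite mul0r cos0.
Qed.

Lemma sinb0 : sinb 0 = 0.
Proof.
rewrite -(scale0r (1 : bop V)); apply: uniq (sinbP _) (isfc_cst _ _ _ 0) _ => x _.
by rewrite mul0r sin0.
Qed.

Let intertwine_J f F G : {within `[- r, r], continuous f} ->
  isfc (- r) r X f F -> isfc (- r) r (- X) f G -> J * F = G * J.
Proof.
move=> fc fF fG; apply: bopP => x.
apply: (@isfc_intertwine R V V J (opnorm J) (- r) r X F (- X) G f) => //.
  by move=> y; exact: rnorm_bop_le.
by move=> y; exact: (congr1 (fun A : bop V => A y) JX).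
Qed.

Lemma cosbJ t : J * cosb t = cosb t * J.
Proof.
apply: (intertwine_J (@cos_cont t) (cosbP t)).
have := isfcN (cosbP t); rewrite opprK => h.
by apply: isfc_ext h _ => x _; rewrite mulrN cosN.
Qed.

Lemma sinbJ t : J * sinb t = - (sinb t * J).
Proof.
rewrite -mulNr; apply: (intertwine_J (@sin_cont t) (sinbP t)).
have := isfcN (isfcZ (-1) (sinbP t)); rewrite opprK rmorphN1 scaleN1r => h.
by apply: isfc_ext h _ => x _; rewrite mulrN sinN mulN1r opprK.
Qed.

Lemma rotbD s t : rotb (s + t) = rotb s * rotb t.
Proof.
rewrite /rotb cosbD sinbD [RHS]mulrDl !mulrDr.
have -> : sinb s * J * cosb t = sinb s * cosb t * J by rewrite -!mulrA cosbJ.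
have -> : sinb s * J * (sinb t * J) = - (sinb s * sinb t).
  by rewrite -mulrA [J * _]mulrA sinbJ mulNr -mulrA JJ mulr1 mulrN.
by rewrite !mulrA mulrDl -!addrA; congr (_ + _); rewrite addrCA [RHS]addrC -addrA.
Qed.

Lemma rotb0 : rotb 0 = 1.
Proof. by rewrite /rotb cosb0 sinb0 mul0r addr0. Qed.

Lemma rotbNK t : rotb t * rotb (- t) = 1.
Proof. by rewrite -rotbD subrr rotb0. Qed.

Lemma rotbKN t : rotb (- t) * rotb t = 1.
Proof. by rewrite -rotbD addNr rotb0. Qed.

Lemma rotb_adjoint t : is_adjoint (rotb t) (rotb (- t)).
Proof.
rewrite {2}/rotb cosbN sinbN mulNr -sinbJ.
apply: is_adjointD; first exact: cosb_selfadjoint.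
by apply: is_adjointM => //; exact: sinb_selfadjoint.
Qed.

Lemma rnorm_rotb t x : rnorm (rotb t x) = rnorm x.
Proof.
apply/eqP; rewrite -(@eqrXn2 _ 2) ?rnorm_ge0 // -!rdotxx.
have /is_adjointP -> := rotb_adjoint t.
by rewrite -mulbE rotbKN.
Qed.

Lemma opnorm_rotb t : opnorm (rotb t) <= 1.
Proof. by apply: opnorm_ler => // x; rewrite rnorm_rotb mul1r. Qed.

Lemma rotbJ t : J * rotb (- t) = rotb t * J.
Proof.
rewrite /rotb cosbN sinbN mulrDr mulrDl cosbJ mulNr mulrN mulrA sinbJ mulNr opprK.
by [].
Qed.

Lemma opnorm_involution : opnorm J <= 1.
Proof.
apply: opnorm_ler => // x; rewrite mul1r.
rewrite -(@ler_pXn2r _ 2) ?nnegrE ?rnorm_ge0 // -!rdotxx.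
by have /selfadjointP -> := Js; rewrite -mulbE JJ.
Qed.

Let J_opnorm : opnorm J <= 1. Proof. exact: opnorm_involution. Qed.

Lemma rotb_lipschitz s t : opnorm (rotb s - rotb t) <= 2 * r * `|s - t|.
Proof.
have h (f : R -> R) F G :
    (forall x y, `|f x - f y| <= `|x - y|) ->
    isfc (- r) r X (fun x => f (s * x)) F -> isfc (- r) r X (fun x => f (t * x)) G ->
    opnorm (F - G) <= r * `|s - t|.
  move=> fl fF fG; apply: (isfc_dist_le rr rX fF fG).
    by rewrite mulr_ge0 // ltW.
  move=> x xr; rewrite (le_trans (fl _ _)) // -mulrBl normrM mulrC.
  by rewrite ler_wpM2r // ler_norml.
have -> : rotb s - rotb t = (cosb s - cosb t) + (sinb s - sinb t) * J.
  by rewrite /rotb opprD addrACA mulrBl.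
have -> : 2 * r * `|s - t| = r * `|s - t| + r * `|s - t| by ring.
rewrite (le_trans (opnormD _ _)) // lerD //.
  exact: (h cos _ _ (@cos_lipschitz R) (cosbP s) (cosbP t)).
rewrite (le_trans (opnormM _ _)) // -[leRHS]mulr1 ler_pM ?opnorm_ge0 //.
exact: (h sin _ _ (@sin_lipschitz R) (sinbP s) (sinbP t)).
Qed.

Lemma rotb_taylor t h :
  opnorm (rotb (t + h) - rotb t - h%:C *: (X * J * rotb t)) <= 4 * r ^+ 2 * h ^+ 2.
Proof.
have est (f f' : R -> R) F G D :
    (forall x y, `|f (x + y) - f x - y * f' x| <= 2 * y ^+ 2) ->
    isfc (- r) r X (fun x => f ((t + h) * x)) F ->
    isfc (- r) r X (fun x => f (t * x)) G ->
    isfc (- r) r X (fun x => f' (t * x)) D ->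
    opnorm (F - G - h%:C *: (X * D)) <= 2 * r ^+ 2 * h ^+ 2.
  move=> fl fF fG fD; apply: (isfc_dist_le rr rX (isfcB fF fG)
    (isfcZ h (isfcM (isfc_id _ _ _) fD))).
    by rewrite mulr_ge0 ?sqr_ge0 // mulr_ge0 ?sqr_ge0.
  move=> x xr; rewrite mulrDl mulrA (le_trans (fl _ _)) // exprMn.
  rewrite -mulrA ler_pM2l // mulrC ler_wpM2r ?sqr_ge0 //.
  rewrite -[leLHS]real_normK ?num_real // ler_pXn2r ?nnegrE ?(ltW r0) //.
  by rewrite ler_norml.
(* Passing [J] through [sinb] and [cosb] identifies [X J rotb t] with the termwise derivative of
   [rotb]. *)
have -> : X * J * rotb t = - (X * sinb t) + X * cosb t * J.
  rewrite /rotb mulrDr addrC; congr (_ + _); last by rewrite -!mulrA cosbJ.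
  by rewrite -!mulrA [J * _]mulrA sinbJ mulNr -mulrA JJ mulr1 mulrN.
have -> : rotb (t + h) - rotb t - h%:C *: (- (X * sinb t) + X * cosb t * J) =
   (cosb (t + h) - cosb t - h%:C *: (X * - sinb t)) +
   (sinb (t + h) - sinb t - h%:C *: (X * cosb t)) * J.
  by rewrite /rotb scalerDr subr_ACA !mulrBl -scalebAl mulrN.
have -> : 4 * r ^+ 2 * h ^+ 2 = 2 * r ^+ 2 * h ^+ 2 + 2 * r ^+ 2 * h ^+ 2 by ring.
rewrite (le_trans (opnormD _ _)) // lerD //.
  apply: (est cos (fun x => - sin x) _ _ _ _ (cosbP _) (cosbP _)).
    by move=> x y; rewrite mulrN opprK cos_taylor.
  have := isfcZ (-1) (sinbP t); rewrite rmorphN1 scaleN1r => k.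
  by apply: isfc_ext k _ => x _; rewrite mulN1r.
rewrite (le_trans (opnormM _ _)) // -[leRHS]mulr1 ler_pM ?opnorm_ge0 //.
exact: (est sin cos _ _ _ (@sin_taylor R) (sinbP _) (sinbP _) (cosbP _)).
Qed.

Lemma bexp_rotb t : bexp (t%:C *: (X * J)) = rotb t.
Proof.
pose u n : bop V := (n`!%:R)^-1 *: (t%:C *: (X * J)) ^+ n.
(* From [(X J) ^+ 2 = - X ^+ 2], powers alternate between a power of [X] and a power of [X] times
   [J], with the signs of the cosine and sine series. At [n = 0] the default value of [n.-1] is
   harmless, its parity factor being 0. *)
have powE n : (X * J) ^+ n =
    ((~~ odd n)%:R * (-1) ^+ n./2)%:C *: X ^+ n +
    ((odd n)%:R * (-1) ^+ n.-1./2)%:C *: (X ^+ n * J).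
  elim: n => [|n IH].
    by rewrite !expr0 /= !mul1r mul0r scale0r addr0 scale1r.
  rewrite exprSr IH mulrDl -!scalebAl.
  have -> : X ^+ n * (X * J) = X ^+ n.+1 * J by rewrite mulrA -exprSr.
  have -> : X ^+ n * J * (X * J) = - X ^+ n.+1.
    by rewrite -mulrA [J * _]mulrA JX mulNr -mulrA JJ mulr1 mulrN -exprSr.
  rewrite addrC scalerN -scaleNr -rmorphN /= negbK; congr (_%:C *: _ + _).
  case: n {IH} => [|n] /=; first by rewrite !mul0r oppr0.
  by rewrite exprS mulN1r mulrN.
have uE n : u n = bop_poly (cos_coeff t n *: 'X^n) X + bop_poly (sin_coeff t n *: 'X^n) X * J.
  have scX (A : bop V) : (t%:C *: A) ^+ n = (t ^+ n)%:C *: A ^+ n.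
    elim: n => [|n IH]; first by rewrite !expr0 scale1r.
    by rewrite !exprS IH -scalebAl -scalebAr scalerA rmorphM.
  rewrite /u scX powE !bop_polyZ !bop_polyXn bop_polyX.
  rewrite -scalebAl !scalerDr !scalerA.
  have <- : ((n`!%:R : R)^-1)%:C = (n`!%:R)^-1 by rewrite fmorphV rmorph_nat.
  by rewrite -!rmorphM /=; congr (_%:C *: _ + _%:C *: _);
     rewrite /cos_coeff /sin_coeff /= -?exprnP; ring.
have sE n : series u n = bop_poly (cos_poly t n) X + bop_poly (sin_poly t n) X * J.
  have sumE (F : nat -> {poly R}) :
      bop_poly (\sum_(k < n) F k) X = \sum_(k < n) bop_poly (F k) X.
    by apply: (big_morph (fun p => bop_poly p X)) => [p q|]; rewrite ?bop_polyD ?bop_poly0.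
  rewrite seriesEord /= /cos_poly /sin_poly (sumE (fun k => cos_coeff t k *: 'X^k)).
  rewrite (sumE (fun k => sin_coeff t k *: 'X^k)) mulr_suml -big_split /=.
  by apply: eq_bigr => k _; exact: uE.
apply: (@cvg_lim _ (@norm_hausdorff _ (bop V))); apply/cvg_opnormP => e e0.
have e20 : 0 < e / 2 by rewrite divr_gt0.
have [N hN] := trig_poly_approx t r e20.
exists N => // n /= Nn; rewrite -/u sE opnormB /rotb opprD addrACA -mulrBl.
rewrite [e]splitr (le_trans (opnormD _ _)) // lerD //.
  apply: (isfc_dist_le rr rX (isfc_poly _ _ _ _) (cosbP t) (ltW e20)) => x xr.
  by have [] := hN n Nn x; rewrite ?ler_norml.
rewrite (le_trans (opnormM _ _)) // -[leRHS]mulr1 ler_pM ?opnorm_ge0 //.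
apply: (isfc_dist_le rr rX (isfc_poly _ _ _ _) (sinbP t) (ltW e20)) => x xr.
by have [] := hN n Nn x; rewrite ?ler_norml.
Qed.

End Rotation.

(** * Geodesics *)

Section Geodesics.
Variables (R : realType) (V : hilbertType R) (P X : bop V).
Hypotheses (PP : is_projection P) (PX : tangent P X).

Definition reflection : bop V := P + P - 1.
Local Notation J := reflection.

Lemma reflection_sqr : J * J = 1.
Proof.
have [PPP _] := PP.
rewrite /reflection mulrBr mulr1 !mulrDr !mulrBl !mulrDl PPP mul1r; bop_lin.
Qed.

Lemma reflection_selfadjoint : selfadjoint J.
Proof.
have [_ Ps] := PP; apply: is_adjointB; last exact: is_adjoint1.
exact: is_adjointD.
Qed.

Lemma reflectionX : J * X = - (X * J).
Proof.
have [_ XP] := PX; have {}XP : X * P = X - P * X by rewrite -{2}XP addrK.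
rewrite /reflection mulrBl mulrBr !mulrDl !mulrDr mul1r mulr1 XP; bop_lin.
Qed.

Lemma tangent_commutator : X * P - P * X = X * J.
Proof.
have [_ XP] := PX; have {}XP : X * P = X - P * X by rewrite -{2}XP addrK.
rewrite /reflection mulrBr mulrDr mulr1 XP; bop_lin.
Qed.

Local Notation rotb := (rotb J X).
(** The angle doubles because [J * rotb (- t) = rotb t * J]: conjugating [J] by [rotb t] gives
    [rotb (t + t) * J]. *)
Definition geod (t : R) : bop V := (2^-1)%:C *: (1 + rotb (t + t) * J).
(** Differentiating [geod] gives [X J rotb (t + t) J], and conjugation by [J] inverts the rotation.
    In this form the speed is visibly [opnorm X]. *)
Definition geod_velocity (t : R) : bop V := X * rotb (- (t + t)).

Let JJ := reflection_sqr.
Let Js := reflection_selfadjoint.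
Let Xs : selfadjoint X := PX.1.
Let JX := reflectionX.
Let JXP := And4 JJ Js Xs JX.

Lemma projection_reflection : P = (2^-1)%:C *: (1 + J).
Proof.
rewrite /reflection addrC subrK -[P in RHS]scale1r -scalerDl scalerA.
by rewrite -(rmorph1 (real_complex R)) -rmorphD -rmorphM /= mulVf ?scale1r.
Qed.

Lemma geod_rot t : rotb t * P * rotb (- t) = geod t.
Proof.
rewrite projection_reflection -scalebAr -scalebAl (mulrDr (rotb t) 1) (mulrDl (rotb t * 1)) mulr1.
rewrite (rotbNK JXP) -mulrA (rotbJ JXP) mulrA -(rotbD JXP).
by [].
Qed.

Lemma geod_bexp t : let Y := t%:C *: (X * P - P * X) in
  bexp Y * P * bexp (- Y) = geod t.
Proof.
rewrite /= tangent_commutator -scaleNr -rmorphN /= !(bexp_rotb JXP).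
exact: geod_rot.
Qed.

Lemma geod_projection t : is_projection (geod t).
Proof.
have [PPP Ps] := PP; rewrite -geod_rot; split.
  rewrite -!mulrA [rotb (- t) * _]mulrA (rotbKN JXP) mul1r.
  by rewrite [P * (P * _)]mulrA PPP.
have rt := rotb_adjoint JXP t.
rewrite /selfadjoint -{2}mulrA; apply: is_adjointM; last exact: is_adjoint_sym.
by apply: is_adjointM.
Qed.

Let r : R := opnorm X + 1.
Let r0 : 0 < r. Proof. by rewrite ltr_wpDl // opnorm_ge0. Qed.

Lemma geod_taylor t h :
  opnorm (geod (t + h) - geod t - h%:C *: geod_velocity t) <= 8 * r ^+ 2 * h ^+ 2.
Proof.
have -> : geod (t + h) - geod t - h%:C *: geod_velocity t =
   (2^-1)%:C *: ((rotb ((t + t) + (h + h)) - rotb (t + t) -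
                 (h + h)%:C *: (X * J * rotb (t + t))) * J).
  have E : X * J * rotb (t + t) * J = geod_velocity t.
    have := rotbJ JXP (- (t + t)); rewrite opprK => e.
    by rewrite -(mulrA X) e -!mulrA JJ mulr1.
  rewrite !(mulrBl J) -scalebAl E /geod.
  have -> : t + h + (t + h) = t + t + (h + h) by ring.
  move: (rotb _) (rotb (t + t)) (geod_velocity t) => A B C.
  apply: bopP => x; rewrite !bopE; apply: rdot_inj => y.
  by rewrite !(rdotDl, rdotNl, rdotZl); field.
rewrite opnormZ ger0_norm ?invr_ge0 //.
have h1 := rotb_taylor JXP (t + t) (h + h); have h2 := opnorm_involution JXP.
apply: (@le_trans _ _ (2^-1 * (4 * r ^+ 2 * (h + h) ^+ 2))).
  rewrite ler_pM2l ?invr_gt0 // (le_trans (opnormM _ _)) // -[leRHS]mulr1.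
  by apply: ler_pM; rewrite ?opnorm_ge0.
by rewrite le_eqVlt; apply/orP; left; apply/eqP; field.
Qed.

Lemma geod_velocity_opnorm t : opnorm (geod_velocity t) = opnorm X.
Proof.
have le1 s : opnorm (rotb s) <= 1 := opnorm_rotb JXP s.
apply/eqP; rewrite eq_le; apply/andP; split.
  by rewrite (le_trans (opnormM _ _)) // ler_piMr ?opnorm_ge0.
have -> : X = geod_velocity t * rotb (t + t).
  by rewrite /geod_velocity -mulrA (rotbKN JXP) mulr1.
by rewrite (le_trans (opnormM _ _)) // ler_piMr ?opnorm_ge0.
Qed.

Lemma geod_lipschitz s t : opnorm (geod s - geod t) <= 2 * r * `|s - t|.
Proof.
have -> : geod s - geod t = (2^-1)%:C *: ((rotb (s + s) - rotb (t + t)) * J).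
  by rewrite /geod -scalerBr opprD addrACA subrr add0r mulrBl.
rewrite opnormZ ger0_norm ?invr_ge0 // mulrC ler_pdivrMr //.
have -> : 2 * r * `|s - t| * 2 = 2 * r * `|s + s - (t + t)| * 1.
  have -> : s + s - (t + t) = 2 * (s - t) by ring.
  by rewrite normrM (ger0_norm (ler0n R 2)); ring.
rewrite (le_trans (opnormM _ _)) // ler_pM ?opnorm_ge0 //.
  exact: (rotb_lipschitz JXP).
exact: (opnorm_involution JXP).
Qed.

Lemma geod_velocity_lipschitz s t :
  opnorm (geod_velocity s - geod_velocity t) <= 4 * r ^+ 2 * `|s - t|.
Proof.
rewrite /geod_velocity -mulrBr (le_trans (opnormM _ _)) //.
have -> : 4 * r ^+ 2 * `|s - t| = r * (2 * r * `|- (s + s) - - (t + t)|).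
  have -> : - (s + s) - - (t + t) = - 2 * (s - t) by ring.
  by rewrite normrM normrN (ger0_norm (ler0n R 2)); ring.
rewrite ler_pM ?opnorm_ge0 //; first by rewrite lerDl.
exact: (rotb_lipschitz JXP).
Qed.

End Geodesics.

(** * Difference quotients, and geodesics as curves *)

Section QuotientFilter.
Variables (R : realType) (V : hilbertType R).

(** Small positive steps are admissible for [t <= 1 / 2], small negative ones otherwise; properness
    makes one-sided velocities unique. *)
Lemma quotient_domain_proper (t : R) : t \in `[0, 1] ->
  ProperFilter (within [set h | t + h \in `[0, 1]] (0^' : set_system R)).
Proof.
rewrite in_itv /= => /andP[t0 t1]; apply: Build_ProperFilter_ex => A.
rewrite /within /= => /nbhs_ballP[d /= d0 hd].
pose e := Num.min (d / 2) (1 / 2).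
have e0 : 0 < e by rewrite lt_min !divr_gt0.
have ed : e < d by rewrite gt_min ltr_pdivrMr // ltr_pMr // ltr1n.
have e1 : e <= 1 / 2 by rewrite ge_min lexx orbT.
have [th|th] := leP t (1 / 2).
  exists e; apply: hd => /=; rewrite ?gt_eqF //.
    by rewrite /ball /= sub0r normrN gtr0_norm.
  by rewrite in_itv /=; apply/andP; split; lra.
exists (- e); apply: hd => /=; rewrite ?oppr_eq0 ?gt_eqF //.
  by rewrite /ball /= sub0r opprK gtr0_norm.
by rewrite in_itv /=; apply/andP; split; lra.
Qed.

Lemma velocity_eq (c : R -> bop V) t (l : bop V) : t \in `[0, 1] ->
  quotients c t --> l -> velocity c t = l.
Proof.
move=> t01 cl; have FF := quotient_domain_proper t01.
rewrite /velocity; apply: cvg_lim => //; exact: norm_hausdorff.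
Qed.

Lemma quotients_taylor (c : R -> bop V) t (l : bop V) (K : R) : t \in `[0, 1] ->
  (forall h, t + h \in `[0, 1] -> opnorm (c (t + h) - c t - h%:C *: l) <= K * h ^+ 2) ->
  quotients c t --> l.
Proof.
move=> t01 ch; have FF := quotient_domain_proper t01.
apply/cvg_opnormP => e e0; rewrite near_withinE.
have K0 : 0 < `|K| + 1 by rewrite ltr_wpDl.
apply/nbhs_ballP; exists (e / (`|K| + 1)) => /=; first by rewrite divr_gt0.
move=> h; rewrite /ball /= sub0r normrN => hd h0 th.
have hp : 0 < `|h| by rewrite normr_gt0.
rewrite opnormB.
have -> : (h^-1)%:C *: (c (t + h) - c t) - l = (h^-1)%:C *: (c (t + h) - c t - h%:C *: l).
  by rewrite [RHS]scalerBr scalerA -rmorphM /= mulVf // scale1r.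
rewrite opnormZ normfV mulrC ler_pdivrMr // (le_trans (ch _ th)) //.
rewrite -[h ^+ 2]real_normK ?num_real // expr2 mulrA ler_pM2r //.
rewrite (@le_trans _ _ ((`|K| + 1) * `|h|)) //.
  by rewrite ler_pM2r // (le_trans (ler_norm K)) // lerDl.
by rewrite mulrC -ler_pdivlMr // ltW.
Qed.

End QuotientFilter.

Section GeodesicCurves.
Variables (R : realType) (V : hilbertType R) (P X : bop V) (g : R -> bop V).
Hypotheses (PP : is_projection P) (PX : tangent P X).
Hypothesis gE : {in `[0, 1], forall t : R, g t = geod P X t}.

Lemma geodesic_quotients t : t \in `[0, 1] -> quotients g t --> geod_velocity P X t.
Proof.
move=> t01; apply: (@quotients_taylor _ _ _ _ _ (8 * (opnorm X + 1) ^+ 2)) => // h th.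
by rewrite !gE //; exact: geod_taylor.
Qed.

Lemma geodesic_velocity t : t \in `[0, 1] -> velocity g t = geod_velocity P X t.
Proof. by move=> t01; apply: velocity_eq => //; exact: geodesic_quotients. Qed.

Lemma geodesic_length : curve_length g = (opnorm X)%:E.
Proof.
rewrite /curve_length.
under eq_integral => t.
  rewrite inE /= => t01; rewrite geodesic_velocity // geod_velocity_opnorm //.
  over.
by rewrite integral_cst //= lebesgue_measure_itv /= lte01 oppr0 adde0 mule1.
Qed.

Lemma lipschitz_continuous (c : R -> bop V) (K : R) :
  (forall s t, opnorm (c s - c t) <= K * `|s - t|) -> continuous c.
Proof.
move=> cK t; apply/cvg_opnormP => e e0.
have K0 : 0 < `|K| + 1 by rewrite ltr_wpDl.
apply/nbhs_ballP; exists (e / (`|K| + 1)) => /=; first by rewrite divr_gt0.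
move=> s; rewrite /ball /= => ts.
rewrite (le_trans (cK _ _)) // (@le_trans _ _ ((`|K| + 1) * `|t - s|)) //.
  by rewrite ler_wpM2r // (le_trans (ler_norm K)) // lerDl.
by rewrite mulrC -ler_pdivlMr // ltW.
Qed.

Lemma geodesic_is_curve : is_curve g.
Proof.
split.
- by move=> t t01; rewrite gE //; exact: geod_projection.
- apply: (@subspace_eq_continuous _ _ _ (geod P X)).
    by move=> t; rewrite inE => t01; exact/esym/gE.
  apply: continuous_subspaceT; apply: lipschitz_continuous => s t.
  exact: geod_lipschitz.
exists [::] => t t01 _; have t01' := subset_itv_oo_cc t01.
split; first by apply/cvg_ex; exists (geod_velocity P X t); exact: geodesic_quotients.
have vc : {for t, continuous (geod_velocity P X)}.
  by apply: lipschitz_continuous => s u; exact: geod_velocity_lipschitz.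
rewrite /prop_for /continuous_at geodesic_velocity //.
apply: cvg_trans vc; apply: near_eq_cvg; near=> s.
rewrite geodesic_velocity //; apply: subset_itv_oo_cc.
near: s; exact: near_in_itvoo.
Unshelve. all: by end_near. Qed.

End GeodesicCurves.

(** * The angle swept by a curve of projections *)

Lemma cos_mono (R : realType) : {in `[0, pi] &, {mono @cos R : x z /~ x <= z}}.
Proof.
have pi0 : 0 <= pi :> R := pi_ge0 R.
apply: segment_continuous_inj_ge; first by rewrite cospi cos0; lra.
  exact/continuous_subspaceT/continuous_cos.
exact: cos_inj.
Qed.

Section RealAnalysis.
Variable R : realType.
Notation mu := (@lebesgue_measure R).

(** Obtained from monotonicity, as [acos] inverts the decreasing bijection [cos] on [[0, pi]]; this
    includes the endpoints, where it has no derivative. *)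
Lemma acos_continuous : {within `[-1, 1], continuous (@acos R)}.
Proof.
have pi0 : 0 <= pi :> R := pi_ge0 R.
have cc : {within `[0, pi], continuous (@cos R)}.
  exact/continuous_subspaceT/continuous_cos.
have mono := segment_can_ge pi0 cc (@cosK R).
rewrite cospi cos0 in mono.
apply: segment_dec_surj_continuous => //.
rewrite acos1 acosN1 => y /= yp; exists (cos y); last exact: cosK.
by rewrite /= in_itv /= cos_geN1 cos_le1.
Qed.

(** Induction on the exceptional points: the interval is cut at each one that it contains, and the
    mean value theorem applies once none is left. *)
Lemma finite_exception_le (a b : R) (f df : R -> R) (s : seq R) : a <= b ->
  {within `[a, b], continuous f} ->
  {in `]a, b[, forall t, t \notin s -> is_derive t 1 f (df t) /\ df t <= 0} ->
  f b <= f a.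
Proof.
elim: s a b => [|x s IH] a b ab fc fd.
  move: ab; rewrite le_eqVlt => /predU1P[->//|ab].
  have [t tab|c cab fE] := @MVT R f df a b ab _ fc.
    by have [] := fd t tab isT.
  have [_ dfc] := fd c cab isT.
  by rewrite -subr_le0 fE mulr_le0_ge0 // subr_ge0 ltW.
have [xab|xab] := boolP (x \in `]a, b[); last first.
  apply: IH => // t tab ts; apply: fd => //; rewrite inE negb_or ts andbT.
  by apply: contra xab => /eqP <-.
have [ax xb] : a <= x /\ x <= b by move: xab; rewrite in_itv /= => /andP[/ltW ? /ltW].
apply: (@le_trans _ _ (f x)).
  apply: IH => //.
    by apply: continuous_subspaceW fc; apply: subset_itvr; rewrite bnd_simp.
  move=> t /[!in_itv]/= /andP[xt tb] ts; apply: fd.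
    by rewrite in_itv /= tb andbT (le_lt_trans ax).
  by rewrite inE negb_or ts andbT gt_eqF.
apply: IH => //.
  by apply: continuous_subspaceW fc; apply: subset_itvl; rewrite bnd_simp.
move=> t /[!in_itv]/= /andP[xt tb] ts; apply: fd.
  by rewrite in_itv /= xt (lt_le_trans tb).
by rewrite inE negb_or ts andbT lt_eqF.
Qed.

(** The interval is the union of an open set on which [w] is continuous and a finite set, all of
    whose subsets are measurable. *)
Lemma finite_exception_measurable (w : R -> R) (s : seq R) :
  {in `]0, 1[, forall t, t \notin s -> {for t, continuous w}} ->
  measurable_fun (`[0, 1]%classic : set R) w.
Proof.
move=> wc; pose D := `]0, 1[%classic `&` ~` [set` s].
pose E := `[0, 1]%classic `&` [set` [:: 0, 1 & s]].
have oD : open D.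
  apply: openI; first exact: interval_open.
  have [h _] := @accessible_finite_set_closed R.
  apply: closed_openC; apply: h; last exact: finite_seq.
  by apply: hausdorff_accessible; exact: Rhausdorff.
have cE (A : set R) : A `<=` E -> measurable A.
  move=> AE; apply: countable_measurable; first by move=> t; exact: measurable_set1.
  apply: finite_set_countable; apply: sub_finite_set AE _.
  by apply: finite_setIr; exact: finite_seq.
have -> : `[0, 1]%classic = D `|` E.
  apply/seteqP; split=> t.
    move=> t01; have [ts|ts] := boolP (t \in [:: 0, 1 & s]); first by right.
    left; move: ts t01; rewrite !inE !negb_or /= => /and3P[t0 t1 ts].
    rewrite !in_itv /= => /andP[h0 h1]; split; last exact/negP.
    by rewrite /= in_itv /= !lt_def t0 h0 eq_sym t1 h1.
  by case=> [[/subset_itv_oo_cc]|[]].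
apply/measurable_funU; [exact: open_measurable|exact: cE|split].
  apply: open_continuous_measurable_fun => // t; rewrite inE => -[t01 /negP ts].
  exact: wc.
by move=> mE Y mY; apply: cE; exact: subIsetl.
Qed.

End RealAnalysis.

(** * Velocities of curves of projections *)

Section CurveVelocity.
Variables (R : realType) (V : hilbertType R).
Implicit Types (A B D : bop V) (x y : V).

Variable c : R -> bop V.
Hypothesis cP : {in `[0, 1], forall t, is_projection (c t)}.

Let quotient t h : bop V := (h^-1)%:C *: (c (t + h) - c t).

Lemma quotients_small t D (d : R) : t \in `[0, 1] -> 0 < d -> quotients c t --> D ->
  exists h, [/\ h != 0, `|h| <= d, t + h \in `[0, 1] & opnorm (D - quotient t h) <= d].
Proof.
move=> t01 d0 cD; have FF := quotient_domain_proper t01.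
have near1 : \forall h \near within [set h | t + h \in `[0, 1]] (0^' : set_system R),
    opnorm (D - quotient t h) <= d.
  by move/cvg_opnormP: cD; apply.
have near2 : \forall h \near within [set h | t + h \in `[0, 1]] (0^' : set_system R),
    [/\ h != 0, `|h| <= d & t + h \in `[0, 1]].
  rewrite near_withinE; apply/nbhs_ballP; exists d => //= h.
  by rewrite /ball /= sub0r normrN => /ltW.
have [h [h1 [h2 h3 h4]]] := filter_ex (filterI near1 near2).
by exists h.
Qed.

Lemma velocity_selfadjoint t D : t \in `[0, 1] -> quotients c t --> D -> selfadjoint D.
Proof.
move=> t01 cD; apply: selfadjoint_closed => e e0.
have [h [_ _ th hD]] := quotients_small t01 e0 cD.
exists (quotient t h); last by rewrite opnormB.
by apply: is_adjointZ; apply: is_adjointB; [case: (cP th)|case: (cP t01)].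
Qed.

(** Idempotency gives an exact Leibniz rule [q = q c(t + h) + c(t) q] for the difference quotient
    [q]; replacing [c(t + h)] by [c(t)] costs at most [|h| |q|^2]. *)
Lemma velocity_tangent t D : t \in `[0, 1] -> quotients c t --> D ->
  D = D * c t + c t * D.
Proof.
move=> t01 cD; apply: bop_eq_small => e e0.
have [ctP _] := cP t01.
pose K := 1 + 2 * opnorm (c t) + (opnorm D + 1) ^+ 2.
have K0 : 0 < K.
  by have := opnorm_ge0 (c t); have := sqr_ge0 (opnorm D + 1); rewrite /K; lra.
pose d := Num.min 1 (e / K).
have d0 : 0 < d by rewrite lt_min ltr01 divr_gt0.
have d1 : d <= 1 by rewrite ge_min lexx.
have dK : d * K <= e by rewrite -ler_pdivlMr // ge_min lexx orbT.
have [h [h0 hd th hD]] := quotients_small t01 d0 cD.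
have [chP _] := cP th.
set q := quotient t h in hD.
have hq : c (t + h) - c t = h%:C *: q.
  by rewrite /q /quotient scalerA -rmorphM /= mulfV // scale1r.
have qE : q = q * c (t + h) + c t * q.
  rewrite /q /quotient -scalebAl -scalebAr -scalerDr mulrBl mulrBr chP ctP.
  by rewrite addrA subrK.
clearbody q.
have -> : D - (D * c t + c t * D) =
    (D - q) - (D - q) * c t - c t * (D - q) + q * (c (t + h) - c t).
  rewrite {1}qE !mulrBl !mulrBr; move: (q * c (t + h)) => u; bop_lin.
have q1 : opnorm q <= opnorm D + 1.
  rewrite -[q](subrKC D) (le_trans (opnormD _ _)) // lerD2l opnormB.
  exact: le_trans d1.
apply: le_trans dK.
have -> : d * K = d + d * opnorm (c t) + d * opnorm (c t) + d * (opnorm D + 1) ^+ 2.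
  by rewrite /K; ring.
have n1 : opnorm ((D - q) * c t) <= d * opnorm (c t).
  by rewrite (le_trans (opnormM _ _)) // ler_wpM2r ?opnorm_ge0.
have n2 : opnorm (c t * (D - q)) <= d * opnorm (c t).
  by rewrite (le_trans (opnormM _ _)) // mulrC ler_wpM2r ?opnorm_ge0.
have n3 : opnorm (q * (c (t + h) - c t)) <= d * (opnorm D + 1) ^+ 2.
  rewrite hq (le_trans (opnormM _ _)) // opnormZ [leLHS]mulrCA expr2.
  by rewrite ler_pM ?mulr_ge0 ?opnorm_ge0 // ler_pM ?opnorm_ge0.
have := opnormD ((D - q) - (D - q) * c t - c t * (D - q)) (q * (c (t + h) - c t)).
have := opnormD ((D - q) - (D - q) * c t) (- (c t * (D - q))).
have := opnormD (D - q) (- ((D - q) * c t)).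
rewrite !opnormN; lra.
Qed.

(* D is off-diagonal with respect to the splitting defined by c t. *)
Lemma velocity_rdot_le t D x : t \in `[0, 1] -> quotients c t --> D ->
  `|rdot (D x) x| <= 2 * (opnorm D * (rnorm (c t x) * rnorm (x - c t x))).
Proof.
move=> t01 cD; have /selfadjointP Ds := velocity_selfadjoint t01 cD.
have DE := velocity_tangent t01 cD; have [ctP /selfadjointP cts] := cP t01.
have cDc : c t * D * c t = 0.
  have := congr1 (fun B => c t * B) DE; rewrite mulrDr !mulrA ctP => /eqP.
  by rewrite -subr_eq subrr eq_sym => /eqP.
have E y : D y = D (c t y) + c t (D y) by rewrite {1}DE !bopE.
have cDcx : c t (D (c t x)) = 0 by have := congr1 (fun B : bop V => B x) cDc.
have -> : rdot (D x) x = 2 * rdot (D (c t x)) (x - c t x).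
  rewrite rdotBr -(cts (D (c t x)) x) cDcx rdot0l subr0.
  by rewrite {1}E rdotDl (cts (D x)) Ds rdotC; ring.
rewrite normrM (ger0_norm (ler0n R 2)) ler_pM2l // (le_trans (normr_rdot_le _ _)) //.
by rewrite mulrA ler_wpM2r ?rnorm_ge0 // rnorm_bop_le.
Qed.

Lemma rdot_derive t D x : t \in `]0, 1[ -> quotients c t --> D ->
  is_derive t 1 (fun s => rdot (c s x) x) (rdot (D x) x).
Proof.
move=> t01 cD.
have cvgq : h^-1 *: (((fun s => rdot (c s x) x) \o shift t) (h *: 1) - rdot (c t x) x)
    @[h --> 0^'] --> rdot (D x) x.
  apply/cvgrPdist_le => e e0.
  have K0 : 0 < rnorm x ^+ 2 + 1 by rewrite ltr_wpDl // sqr_ge0.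
  have : \forall h \near within [set h | t + h \in `[0, 1]] (0^' : set_system R),
      opnorm (D - quotient t h) <= e / (rnorm x ^+ 2 + 1).
    by move/cvg_opnormP: cD; apply; rewrite divr_gt0.
  rewrite near_withinE => near1.
  have near2 : \forall h \near (0^' : set_system R), t + h \in `[0, 1].
    apply: cvg_within.
    move: t01; rewrite in_itv /= => /andP[t0 t1].
    apply/nbhs_ballP; exists (Num.min t (1 - t)) => /=.
      by rewrite lt_min t0 subr_gt0.
    move=> h; rewrite /ball /= sub0r normrN lt_min => /andP[ht h1].
    move: ht h1; rewrite !ltr_norml in_itv /= => /andP[? ?] /andP[? ?].
    by apply/andP; split; lra.
  near=> h.
  have th : t + h \in `[0, 1] by near: h.
  have hq : opnorm (D - quotient t h) <= e / (rnorm x ^+ 2 + 1).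
    by move: th; near: h.
  rewrite /= [h *: 1]mulr1 [h + t]addrC.
  have -> : rdot (D x) x - h^-1 *: (rdot (c (t + h) x) x - rdot (c t x) x) =
      rdot ((D - quotient t h) x) x.
    by rewrite /quotient !bopE rdotBl rdotZl rdotBl.
  rewrite (le_trans (normr_rdot_le _ _)) //.
  apply: (@le_trans _ _ (e / (rnorm x ^+ 2 + 1) * rnorm x ^+ 2)).
    rewrite expr2 mulrA ler_wpM2r ?rnorm_ge0 //.
    by rewrite (le_trans (rnorm_bop_le _ _)) // ler_wpM2r ?rnorm_ge0.
  by rewrite mulrAC ler_pdivrMr // ler_pM2l // lerDl.
split; first by apply/cvg_ex; exists (rdot (D x) x).
by apply: cvg_lim => //; exact: Rhausdorff.
Unshelve. all: by end_near. Qed.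

End CurveVelocity.

Section LengthBound.
Variables (R : realType) (V : hilbertType R) (c : R -> bop V).
Hypothesis cc : is_curve c.
Notation mu := (@lebesgue_measure R).

Let w t : R := opnorm (velocity c t).
Let u (x : V) t : R := 2 * rdot (c t x) x - 1.

Let cP : {in `[0, 1], forall t, is_projection (c t)}. Proof. by case: cc. Qed.

(** With [p = |c x|^2] and [q = |x - c x|^2], one has [p + q = 1] and [1 - (2 p - 1)^2 = 4 p q]. The
    product on the right is the one in [velocity_rdot_le], which turns that bound into one on the
    derivative of [acos u]. *)
Let u_bound x t : t \in `[0, 1] -> rnorm x = 1 ->
  1 - u x t ^+ 2 = (2 * (rnorm (c t x) * rnorm (x - c t x))) ^+ 2.
Proof.
move=> t01 x1; have [PP /selfadjointP Ps] := cP t01.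
have fE : rnorm (c t x) ^+ 2 = rdot (c t x) x.
  by rewrite -rdotxx -Ps -mulbE PP.
have gE : rnorm (x - c t x) ^+ 2 = 1 - rdot (c t x) x.
  rewrite -rdotxx rdotBl !rdotBr (rdotC x (c t x)) !rdotxx x1 fE; ring.
by rewrite !exprMn fE gE /u; ring.
Qed.

Let u_norm x t : t \in `[0, 1] -> rnorm x = 1 -> -1 <= u x t <= 1.
Proof.
move=> t01 x1; rewrite -ler_norml -(@ler_pXn2r _ 2) ?nnegrE // real_normK ?num_real //.
by rewrite expr1n -subr_ge0 u_bound // sqr_ge0.
Qed.

Let speed_exceptions : exists s : seq R, {in `]0, 1[, forall t, t \notin s ->
  quotients c t --> velocity c t /\ {for t, continuous w}}.
Proof.
have [_ _ [s hs]] := cc; exists s => t t01 ts; have [cq cv] := hs t t01 ts.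
split=> //; apply/cvgrPdist_le => e e0.
move/cvg_opnormP: cv => /(_ e e0); apply: filterS => r.
rewrite /w => h; rewrite ler_norml.
have h1 := opnormD (velocity c t - velocity c r) (velocity c r).
have h2 := opnormD (velocity c r - velocity c t) (velocity c t).
rewrite !subrK in h1 h2; rewrite (opnormB (velocity c r)) in h2.
by apply/andP; split; lra.
Qed.

Lemma speed_measurable : measurable_fun (`[0, 1]%classic : set R) w.
Proof.
have [s hs] := speed_exceptions.
by apply: (@finite_exception_measurable _ _ s) => t t01 ts; case: (hs t t01 ts).
Qed.

Let ucont x : {within `[0, 1], continuous (u x)}.
Proof.
have [_ /subspace_continuousP ccont _] := cc.
apply/subspace_continuousP => t t01.
apply: cvgB; last exact: cvg_cst.
apply: cvgM; first exact: cvg_cst.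
apply: (@cvg_rdot _ _ _ _ _ (fun s => c s x)).
apply/cvg_rnormP => e e0.
have K0 : 0 < rnorm x + 1 by rewrite ltr_wpDl // rnorm_ge0.
have /cvg_opnormP/(_ _ (divr_gt0 e0 K0)) := ccont t t01.
apply: filterS => r h; rewrite -oppbE -addbE (le_trans (rnorm_bop_le _ _)) //.
apply: (@le_trans _ _ (e / (rnorm x + 1) * rnorm x)).
  by rewrite ler_wpM2r ?rnorm_ge0.
by rewrite mulrAC ler_pdivrMr // ler_pM2l // lerDl.
Qed.

(* Differentiating acos u directly would fail where |u| = 1; scaling u by r < 1
   avoids this without affecting the bound on the derivative. *)
Let acos_scaled_le x (L r : R) (b : R) : rnorm x = 1 -> curve_length c = L%:E ->
  0 < r < 1 -> b ^+ 2 = 1 ->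
  b * acos (r * u x 1) - b * acos (r * u x 0) <= 2 * L.
Proof.
move=> x1 cL /andP[r0 r1] b1.
have [s hs] := speed_exceptions.
have winf : mu.-integrable `[0, 1] (EFin \o w).
  apply/integrableP; split.
    apply/measurable_EFinP; exact: speed_measurable.
  under eq_integral => t _ do rewrite /= ger0_norm ?opnorm_ge0 //.
  by rewrite -/(curve_length c) cL ltry.
pose F t : R := parameterized_integral mu 0 t w.
have F1 : F 1 = L.
  by rewrite /F /parameterized_integral /Rintegral -/(curve_length c) cL.
have F0 : F 0 = 0.
  by rewrite /F /parameterized_integral set_itv1 Rintegral_set1.
have Fcont : {within `[0, 1], continuous F}.
  exact: parameterized_integral_continuous.
have rub t : t \in `[0, 1] -> -1 < r * u x t < 1.
  move=> t01; have /andP[h1 h2] := u_norm t01 x1; apply/andP; split; nra.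
(* The claim is that [f] decreases. The sign [b] covers both uses: 1 for vectors in the range of
   [c 0], where the angle starts at 0, and -1 for its kernel, where it starts at [pi]. *)
pose f t := b * acos (r * u x t) - 2 * F t.
suff : f 1 <= f 0 by rewrite /f F1 F0; lra.
pose du t := 2 * rdot (velocity c t x) x.
pose df t := b * (- (Num.sqrt (1 - (r * u x t) ^+ 2))^-1 * (r * du t)) - 2 * w t.
apply: (@finite_exception_le R 0 1 f df s) => //.
  apply/subspace_continuousP => t t01.
  have /subspace_continuousP/(_ t t01) uc := @ucont x.
  have /subspace_continuousP/(_ t t01) Fc := Fcont.
  apply: cvgB; last by apply: cvgM => //; exact: cvg_cst.
  apply: cvgM; first exact: cvg_cst.
  apply: (@cvg_comp _ _ _ (fun s => r * u x s) (@acos R) _ (nbhs (r * u x t))).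
    by apply: cvgM => //; exact: cvg_cst.
  by apply: continuous_acos; apply: rub.
move=> t t01 ts; have t01' := subset_itv_oo_cc t01.
have [cq wc] := hs t t01 ts.
have du_t := rdot_derive x t01 cq.
have [dF FE] : derivable F t 1 /\ derive1 F t = w t.
  apply: (@continuous_FTC1_closed R w 0 t 1) => //.
    by move: t01; rewrite in_itv /= => /andP[].
  by move: t01; rewrite in_itv /= => /andP[].
have isF : is_derive t 1 F (w t).
  by rewrite derive1E in FE; exact: (@DeriveDef _ _ _ _ _ _ _ dF FE).
have isu : is_derive t 1 (fun s => r * u x s) (r * du t).
  have h1 : is_derive t 1 (fun s => 2 * rdot (c s x) x - 1) (2 * rdot (velocity c t x) x - 0).
    by apply: is_deriveB; exact: is_deriveZ.
  by rewrite subr0 in h1; exact: is_deriveZ.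
have isa := @is_derive1_comp R acos (fun s => r * u x s) t _ _
  (is_derive1_acos (rub t t01')) isu.
split.
  by apply: is_deriveB; exact: is_deriveZ.
rewrite /df subr_le0 (le_trans (ler_norm _)) //.
have ru2 : 0 < 1 - (r * u x t) ^+ 2.
  by have /andP[h1 h2] := rub t t01'; nra.
have bn : `|b| = 1.
  by apply/eqP; rewrite -(@eqrXn2 _ 2) // real_normK ?num_real // expr1n b1.
rewrite !normrM normrN normfV bn mul1r (gtr0_norm r0).
rewrite (ger0_norm (sqrtr_ge0 _)) mulrC ler_pdivrMr ?sqrtr_gt0 //.
have := velocity_rdot_le cP x t01' cq.
have ub := u_bound t01' x1.
set m := rnorm _ * rnorm _ in ub * => vb.
have m0 : 0 <= m by rewrite mulr_ge0 ?rnorm_ge0.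
clearbody m.
(* Since [(2 m)^2 = 1 - u^2] and [r <= 1], one has [r^2 (1 - u^2) <= 1 - r^2 u^2]. *)
have rm : r * (2 * m) <= Num.sqrt (1 - (r * u x t) ^+ 2).
  have rm0 : 0 <= r * (2 * m) by rewrite !mulr_ge0 // ltW.
  rewrite -(ger0_norm rm0) -sqrtr_sqr.
  rewrite ler_wsqrtr // exprMn -ub exprMn mulrBr mulr1 lerB //.
  by rewrite expr_le1 // ltW.
have w0 : 0 <= w t by rewrite opnorm_ge0.
rewrite (ger0_norm (ler0n R 2)).
apply: (@le_trans _ _ (r * (2 * (2 * (w t * m))))).
  by rewrite ler_pM2l // ler_pM2l.
have -> : r * (2 * (2 * (w t * m))) = 2 * w t * (r * (2 * m)) by ring.
by rewrite ler_wpM2l // mulr_ge0.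
Qed.

(** The scaling factor tends to 1, by uniform continuity of [acos] on the closed interval. *)
Let acos_le x (L b : R) : rnorm x = 1 -> curve_length c = L%:E -> b ^+ 2 = 1 ->
  b * acos (u x 1) - b * acos (u x 0) <= 2 * L.
Proof.
move=> x1 cL b1; apply/ler_addgt0Pr => e e0.
have e20 : 0 < e / 2 by rewrite divr_gt0.
have [d d0 hd] := heine_cantor (@acos_continuous R) e20.
(* The second term keeps [(1 - r) u] within [d]; the first keeps [r] positive. *)
pose r := Num.max (1 / 2) (1 - d).
have r0 : 0 < r by rewrite lt_max divr_gt0.
have r1 : r < 1 by rewrite gt_max ltr_pdivrMr // mul1r ltr1n gtrBl d0.
have rd : 1 - r <= d by rewrite lerBlDr -lerBlDl le_max lexx orbT.
have r01 : 0 < r < 1 by rewrite r0.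
have bn : `|b| = 1.
  by apply/eqP; rewrite -(@eqrXn2 _ 2) // real_normK ?num_real // expr1n b1.
have close t : t \in `[0, 1] -> `|b * acos (u x t) - b * acos (r * u x t)| <= e / 2.
  move=> t01; rewrite -mulrBr normrM bn mul1r; have h := u_norm t01 x1.
  have /andP[h1 h2] := h.
  apply: hd => //; first by apply/andP; split; nra.
  rewrite -{1}[u x t]mul1r -mulrBl normrM gtr0_norm ?subr_gt0 //.
  apply: le_trans rd; rewrite ler_piMr ?subr_ge0 ?(ltW r1) //.
  by rewrite ler_norml h.
have := acos_scaled_le x1 cL r01 b1.
have := close 0; rewrite bound_itvE ler01 => /(_ isT)/ler_normlP[]+ _.
have := close 1; rewrite bound_itvE ler01 => /(_ isT)/ler_normlP[] _.
lra.
Qed.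

Let cos_le (y L : R) : -1 <= y <= 1 -> acos y <= 2 * L -> 2 * L <= pi -> cos (2 * L) <= y.
Proof.
move=> y1 yL Lpi; rewrite -[leRHS]acosK; last by rewrite in_itv.
have y0 := acos_ge0 y1.
rewrite leNgt; apply/negP => h.
move: h; rewrite ltNge cos_mono ?yL // in_itv /=.
  by rewrite Lpi (le_trans y0).
by rewrite y0 (le_trans yL).
Qed.

Lemma curve_angle_range x (L : R) : rnorm x = 1 -> curve_length c = L%:E ->
  2 * L <= pi -> c 0 x = x -> cos (2 * L) <= u x 1.
Proof.
move=> x1 cL Lpi cx; have l01 : 1 \in `[0, 1 : R] by rewrite bound_itvE ler01.
have u0 : u x 0 = 1 by rewrite /u cx rdotxx x1; ring.
apply: cos_le => //; first exact: u_norm.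
have b1 : (1 : R) ^+ 2 = 1 by rewrite expr1n.
by have := acos_le x1 cL b1; rewrite u0 acos1 mulr0 subr0 mul1r.
Qed.

Lemma curve_angle_kernel x (L : R) : rnorm x = 1 -> curve_length c = L%:E ->
  2 * L <= pi -> c 0 x = 0 -> cos (2 * L) <= - u x 1.
Proof.
move=> x1 cL Lpi cx; have l01 : 1 \in `[0, 1 : R] by rewrite bound_itvE ler01.
have u0 : u x 0 = -1 by rewrite /u cx rdot0l mulr0 sub0r.
have ub := u_norm l01 x1.
have nub : -1 <= - u x 1 <= 1 by rewrite lerNl opprK lerNl andbC.
apply: cos_le => //; rewrite acosN //.
have b1 : (-1 : R) ^+ 2 = 1 by rewrite sqrrN expr1n.
by have := acos_le x1 cL b1; rewrite u0 acosN1 !mulN1r opprK addrC.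
Qed.

End LengthBound.

(** * The sign of a self-adjoint operator *)

Section SignOperator.
Variables (R : realType) (V : hilbertType R) (Z : bop V).
Hypothesis Z1 : between (-1) 1 Z.

Implicit Types x y : V.

Let ltN11 : -1 < 1 :> R. Proof. lra. Qed.

Let d n : R := n.+1%:R^-1.
Let d0 n : 0 < d n. Proof. by rewrite invr_gt0. Qed.
Let den (x : R) n : 0 < `|x| + d n. Proof. by rewrite ltr_wpDl. Qed.

(** Continuous odd approximations of sgn, whose absolute values increase with [n]. *)
Let f n (x : R) := x / (`|x| + d n).
Let g n (x : R) := (`|x| + d n)^-1.

Let g_cont n : continuous (g n).
Proof.
move=> x; apply: cvgV; first by rewrite gt_eqF.
by apply: cvgD; [exact: norm_continuous|exact: cvg_cst].
Qed.

Let f_cont n : continuous (f n).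
Proof. by move=> x; apply: cvgM; [exact: cvg_id|exact: g_cont]. Qed.

Let F n : bop V := fcal (-1) 1 Z (f n).

Let FP n : isfc (-1) 1 Z (f n) (F n).
Proof. by apply: fcalP => //; apply: continuous_subspaceT; exact: f_cont. Qed.

Let f_le1 n (x : R) : `|f n x| <= 1.
Proof.
rewrite /f normrM normfV (gtr0_norm (den x n)) ler_pdivrMr // mul1r lerDl.
exact: ltW.
Qed.

Let F_opnorm n : opnorm (F n) <= 1.
Proof. exact: (isfc_opnorm_le ltN11 Z1 (FP n)). Qed.

Let F_selfadjoint n : selfadjoint (F n).
Proof. exact: isfc_selfadjoint Z1.1 (FP n). Qed.

Let sqr_rdot (A : bop V) (x : V) : selfadjoint A -> rdot ((A * A) x) x = rnorm (A x) ^+ 2 :> R.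
Proof. by move=> /selfadjointP As; rewrite mulbE As rdotxx. Qed.

(** For [b = f n t] and [a = f m t] one has [b^2 <= a b], hence [(a - b)^2 <= a^2 - b^2]; the
    calculus transfers this to [F]. *)
Let F_increasing n m x : (n <= m)%N ->
  rnorm (F m x - F n x) ^+ 2 <= rnorm (F m x) ^+ 2 - rnorm (F n x) ^+ 2.
Proof.
move=> nm; have FmP := FP m; have FnP := FP n.
have FB := isfcB FmP FnP.
have := isfcB (isfcB (isfcM FmP FmP) (isfcM FnP FnP)) (isfcM FB FB).
(* The function at hand is [2 b (a - b)]: its nonnegativity is the claim, and 8 is a generous upper
   bound. *)
move=> /(isfc_between ltN11 Z1 (c := 0) (d := 8)) [].
  move=> t _; set a := f m t; set b := f n t.
  have := f_le1 m t; have := f_le1 n t; rewrite -/a -/b !ler_norml.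
  move=> /andP[b1 b2] /andP[a1 a2].
  have h : b * b <= a * b.
    rewrite /a /b /f !mulf_div -!expr2 ler_wpM2l ?sqr_ge0 //.
    rewrite lef_pV2 ?posrE ?exprn_gt0 ?mulr_gt0 // expr2 ler_pM2r // lerD2l.
    by rewrite /d lef_pV2 ?posrE // ler_nat.
  by apply/andP; split; nra.
move=> _ /(_ x); rewrite mul0r => /andP[+ _].
rewrite !addbE !oppbE !rdotDl !rdotNl !sqr_rdot //; last first.
  exact: (is_adjointB (F_selfadjoint m) (F_selfadjoint n)).
by rewrite addbE oppbE subr_ge0.
Qed.

(** The numbers [|F n x|^2] increase and are bounded, so [F_increasing] makes the vectors [F n x]
    Cauchy. Since sgn jumps at 0, the limit is taken strongly. *)
Let sign_ex : exists E : bop V, forall x, F n x @[n --> \oo] --> E x.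
Proof.
apply: (@strong_limit _ _ _ 1) => // x e e0.
pose a n := rnorm (F n x) ^+ 2.
have a_cvg : cvgn a.
  apply: nondecreasing_is_cvgn.
    move=> n m nm; rewrite -subr_ge0 (le_trans _ (F_increasing x nm)) //.
    exact: sqr_ge0.
  exists (rnorm x ^+ 2) => _ [n _ <-]; rewrite /a ler_pXn2r ?nnegrE ?rnorm_ge0 //.
  by rewrite (le_trans (rnorm_bop_le _ _)) // ler_piMl ?rnorm_ge0.
have a_le n : a n <= limn a.
  apply: nondecreasing_cvgn_le => // m k mk.
  by rewrite -subr_ge0 (le_trans _ (F_increasing x mk)) // sqr_ge0.
have e20 : 0 < e ^+ 2 by rewrite exprn_gt0.
have /cvgrPdist_le/(_ _ e20)[N _ hN] := a_cvg.
exists N => m n Nm mn; rewrite -rnormN opprB.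
rewrite -(@ler_pXn2r _ 2) ?nnegrE ?rnorm_ge0 ?(ltW e0) //.
rewrite (le_trans (F_increasing x mn)) //.
have := hN m Nm; have := a_le n => /= h1 /ler_normlP[_ h2].
by rewrite -/(a m) -/(a n); lra.
Qed.

(** This is sgn with value 0 at 0, hence a partial isometry with the kernel of [Z]. *)
Definition signb : bop V := sval (cid sign_ex).
Local Notation E := signb.

Let EP x : F n x @[n --> \oo] --> E x.
Proof. exact: (svalP (cid sign_ex)). Qed.

Let E_close x (e : R) : 0 < e -> exists N, forall n, (N <= n)%N -> rnorm (E x - F n x) <= e.
Proof. by move=> e0; have /cvg_rnormP/(_ e e0)[N _ hN] := @EP x; exists N. Qed.

Let E_uniq (A B : bop V) : (forall n, opnorm (F n * A - B) <= d n) -> E * A = B.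
Proof.
move=> FAB; apply: bopP => x; apply/eqP; rewrite -subr_eq0 -rnorm_eq0.
apply/eqP; apply: eq0_small; first exact: rnorm_ge0.
move=> e e0; have e20 : 0 < e / 2 by rewrite divr_gt0.
have K0 : 0 < rnorm x + 1 by rewrite ltr_wpDl // rnorm_ge0.
have [N1 h1] := E_close (A x) e20.
have [N2 h2] := natSinv_small (divr_gt0 e20 K0).
pose n := maxn N1 N2; have := h1 n (leq_maxl _ _); have := h2 n (leq_maxr _ _).
rewrite -/(d n) => dn hn.
have -> : (E * A) x - B x = (E (A x) - F n (A x)) + (F n * A - B) x.
  by rewrite !bopE subrKA.
rewrite (le_trans (rnormD _ _)) // [e]splitr lerD //.
rewrite (le_trans (rnorm_bop_le _ _)) //.
apply: (@le_trans _ _ (e / 2 / (rnorm x + 1) * rnorm x)).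
  by rewrite ler_wpM2r ?rnorm_ge0 // (le_trans (FAB n)).
by rewrite mulrAC ler_pdivrMr // ler_pM2l // lerDl.
Qed.

Let lim_uniq (u v : nat -> V) (a b : V) : (forall n, u n = v n) ->
  u @ \oo --> a -> v @ \oo --> b -> a = b.
Proof.
by move=> /funext <-; apply: cvg_unique; exact: norm_hausdorff.
Qed.

Let E_intertwine (B : bop V) (s : R) : (forall n, B * F n = s%:C *: (F n * B)) ->
  B * E = s%:C *: (E * B).
Proof.
move=> BF; apply: bopP => x.
apply: (@lim_uniq (fun n => B (F n x)) (fun n => s%:C *: F n (B x))).
- by move=> n; have := congr1 (fun A : bop V => A x) (BF n).
- by apply: (continuous_cvg _ _ (@EP x)); exact: bop_continuous.
- by apply: cvgZr; exact: EP.
Qed.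

Lemma signb_selfadjoint : selfadjoint E.
Proof.
apply/selfadjointP => x y.
have h1 : rdot (F n x) y @[n --> \oo] --> rdot (E x) y by apply: cvg_rdot; exact: EP.
have h2 : rdot (F n y) x @[n --> \oo] --> rdot (E y) x by apply: cvg_rdot; exact: EP.
have FF : (fun n => rdot (F n x) y) = (fun n => rdot (F n y) x).
  by apply/funext => n; have /selfadjointP -> := F_selfadjoint n; rewrite rdotC.
rewrite FF in h1; rewrite (rdotC x).
by rewrite -(cvg_lim (@Rhausdorff R) h1) -(cvg_lim (@Rhausdorff R) h2).
Qed.

Lemma signb_comm (B : bop V) : B * Z = Z * B -> B * E = E * B.
Proof.
move=> BZ; rewrite -[RHS]scale1r; apply: E_intertwine => n; rewrite scale1r.
apply: bopP => x.
apply: (@isfc_intertwine R V V B (opnorm B) (-1) 1 Z (F n) Z (F n) (f n)) => //.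
- by move=> y; exact: rnorm_bop_le.
- by move=> y; exact: (congr1 (fun A : bop V => A y) BZ).
- by apply: continuous_subspaceT; exact: f_cont.
Qed.

(** [B] intertwines [Z] with [- Z], and every [f n] is odd. *)
Lemma signb_anticomm (B : bop V) : B * Z = - (Z * B) -> B * E = - (E * B).
Proof.
move=> BZ; rewrite -scaleN1r -(rmorphN1 (real_complex R)).
apply: E_intertwine => n; rewrite rmorphN1 scaleN1r -mulNr.
apply: bopP => x.
apply: (@isfc_intertwine R V V B (opnorm B) (-1) 1 Z (F n) (- Z) (- F n) (f n)) => //.
- by have := betweenN Z1; rewrite opprK.
- by move=> y; exact: rnorm_bop_le.
- by move=> y; exact: (congr1 (fun A : bop V => A y) BZ).
- by apply: continuous_subspaceT; exact: f_cont.
have := isfcN (isfcZ (-1) (FP n)); rewrite opprK rmorphN1 scaleN1r => h.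
by apply: isfc_ext h _ => x' _; rewrite /f normrN; ring.
Qed.

(** Multiplication by [x] or [|x|] removes the jump at 0: after it the approximations of sgn are
    within [d n] of their limits uniformly, so norm estimates identify the products. *)
Lemma signb_mul_abs A : isfc (-1) 1 Z Num.norm A -> E * Z = A /\ E * A = Z.
Proof.
move=> ZA; have est n (x : R) : x * x / (`|x| + d n) - `|x| = - (`|x| * d n / (`|x| + d n)).
  have := den x n; rewrite -expr2 -[x ^+ 2]real_normK ?num_real // => h.
  by field; rewrite gt_eqF.
have est2 n (x : R) : `| `|x| * d n / (`|x| + d n)| <= d n.
  have dn := ltW (d0 n); rewrite ger0_norm; last first.
    by rewrite divr_ge0 ?mulr_ge0 // ltW.
  by rewrite ler_pdivrMr // mulrC ler_pM2l // lerDl.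
split; apply: E_uniq => n.
  apply: (isfc_dist_le ltN11 Z1 (isfcM (FP n) (isfc_id _ _ _)) ZA (ltW (d0 n))) => x _.
  by rewrite /f mulrAC est normrN.
apply: (isfc_dist_le ltN11 Z1 (isfcM (FP n) ZA) (isfc_id _ _ _) (ltW (d0 n))) => x _.
have -> : f n x * `|x| - x = - (x * (d n / (`|x| + d n))).
  by have := den x n => h; rewrite /f; field; rewrite gt_eqF.
by rewrite normrN normrM -{1}(normr_id x) -normrM mulrA.
Qed.

Let absZ : exists A, isfc (-1) 1 Z Num.norm A.
Proof.
apply: isfc_ex => //; apply: continuous_subspaceT => x.
exact: norm_continuous.
Qed.

Let EEZ : E * E * Z = Z.
Proof.
by have [A ZA] := absZ; have [EZ EA] := signb_mul_abs ZA; rewrite -mulrA EZ EA.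
Qed.

Let G n : bop V := fcal (-1) 1 Z (g n).

Let FE n : F n = Z * G n.
Proof.
have GP : isfc (-1) 1 Z (g n) (G n).
  by apply: fcalP => //; apply: continuous_subspaceT; exact: g_cont.
exact: (isfc_uniq ltN11 Z1 (FP n) (isfcM (isfc_id _ _ _) GP)).
Qed.

(** [E * E] is the identity on the range of [Z], and [F n = Z * G n] takes its values there. *)
Lemma signb_cube : E * E * E = E.
Proof.
apply: bopP => x.
apply: (@lim_uniq (fun n => (E * E) (F n x)) (F ^~ x)); last exact: EP.
  by move=> n; rewrite -mulbE FE mulrA EEZ.
by apply: (continuous_cvg _ _ (@EP x)); exact: bop_continuous.
Qed.

Lemma signb_eq0 x : E x = 0 <-> Z x = 0.
Proof.
have ZE : Z * E = E * Z by exact: signb_comm.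
split=> h.
  have -> : Z x = (E * E * Z) x by rewrite EEZ.
  by rewrite -mulrA -ZE mulrA -ZE mulbE h linear0.
apply: (@lim_uniq (F ^~ x) (fun=> 0)); [move=> n|exact: EP|exact: cvg_cst].
have GP : isfc (-1) 1 Z (g n) (G n).
  by apply: fcalP => //; apply: continuous_subspaceT; exact: g_cont.
rewrite FE (isfcM_comm ltN11 Z1 (isfc_id _ _ _) GP) mulbE h.
exact: linear0.
Qed.

End SignOperator.

(** * Two reflections *)

Section Sinc.
Variable R : realType.

Lemma sinc0 : sinc (0 : R) = 1.
Proof. by rewrite /sinc eqxx. Qed.

Lemma mulr_sinc (x : R) : x * sinc x = sin x.
Proof.
rewrite /sinc; case: eqVneq => [->|x0]; first by rewrite mul0r sin0.
by rewrite mulrC divfK.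
Qed.

Lemma sincN (x : R) : sinc (- x) = sinc x.
Proof. by rewrite /sinc oppr_eq0 sinN invrN mulrNN. Qed.

Lemma continuous_scaled (f : R -> R) (t : R) :
  continuous f -> continuous (fun x : R => f (t * x)).
Proof.
move=> fc x; apply: continuous_comp; last exact: fc.
by apply: cvgM; [exact: cvg_cst|exact: cvg_id].
Qed.

Lemma continuous_sinc : continuous (@sinc R).
Proof.
move=> x; have [->|x0] := eqVneq x 0.
  apply/cvgrPdist_le => e e0; rewrite sinc0.
  apply/nbhs_ballP; exists e => //= y; rewrite /ball /= sub0r normrN => ye.
  have [->|y0] := eqVneq y 0; first by rewrite sinc0 subrr normr0 ltW.
  have yp : 0 < `|y| by rewrite normr_gt0.
  apply: le_trans (ltW ye); rewrite -(ler_pM2r yp) -normrM mulrBl mul1r.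
  by rewrite mulrC mulr_sinc -expr2 distrC real_normK ?num_real // sin_subx_le.
rewrite /continuous_at; have -> : sinc x = sin x / x by rewrite /sinc (negbTE x0).
apply: (@cvg_trans _ ((fun y => sin y / y) @ x)); last first.
  apply: (@cvgM _ _ (nbhs x) _ (@sin R) (fun y => y^-1)); first exact: continuous_sin.
  by apply: cvgV => //; exact: cvg_id.
apply: near_eq_cvg; near=> y; rewrite /sinc ifF //; apply/negbTE.
near: y; apply/nbhs_ballP; exists `|x|; first by rewrite /= normr_gt0.
by move=> y; rewrite /ball /=; apply: contraTneq => ->; rewrite subr0 ltxx.
Unshelve. all: by end_near. Qed.

End Sinc.

(** Both operators are the function [C] of the common square. Even functions are thereby transferred
    between two square roots of the same operator. *)
Lemma isfc_sqr_eq (R : realType) (V : hilbertType R) (a b c d M : R) (X T F G : bop V)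
    (C f g : R -> R) : a < b -> c < d -> 0 < M ->
  between a b X -> between c d T -> X * X = T * T ->
  (forall x, a <= x <= b -> x * x <= M) -> (forall x, c <= x <= d -> x * x <= M) ->
  {within `[0, M], continuous C} ->
  (forall x, a <= x <= b -> C (x * x) = f x) ->
  (forall x, c <= x <= d -> C (x * x) = g x) ->
  isfc a b X f F -> isfc c d T g G -> F = G.
Proof.
move=> ab cd M0 abX cdT XT aM cM Cc Cf Cg fF gG.
have sq (z m : R) : z * z <= m -> 0 <= z * z <= m by rewrite -expr2 sqr_ge0.
have XX := isfcM (isfc_id a b X) (isfc_id a b X).
have TT := isfcM (isfc_id c d T) (isfc_id c d T); rewrite -XT in TT.
have bXX : between 0 M (X * X).
  by apply: (isfc_between ab abX XX) => x /aM/sq.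
have [K KP] := isfc_ex M0 bXX Cc.
have FK : F = K.
  apply: (isfc_uniq ab abX fF (isfc_comp XX _ KP)) => x xab; last by rewrite Cf.
  exact/sq/aM.
have GK : G = K.
  apply: (isfc_uniq cd cdT gG (isfc_comp TT _ KP)) => x xab; last by rewrite Cg.
  exact/sq/cM.
by rewrite FK.
Qed.

Section TwoReflections.
Variables (R : realType) (V : hilbertType R) (J K : bop V).
Hypotheses (JJ : J * J = 1) (KK : K * K = 1).
Hypotheses (Js : selfadjoint J) (Ks : selfadjoint K).
Hypothesis JK0 : forall x, J x + K x = 0 -> x = 0.

Let bop_app (A B : bop V) x : A = B -> A x = B x. Proof. by move=> ->. Qed.

Let JJx x : J (J x) = x. Proof. by rewrite -mulbE JJ. Qed.
Let KKx x : K (K x) = x. Proof. by rewrite -mulbE KK. Qed.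

(* The cosine and the sine of 2 X, where X is the initial velocity of the
   geodesic: K J = cos 2X + (sin 2X) J. *)
Definition cos2b : bop V := (2^-1)%:C *: (K * J + J * K).
Definition sin2b : bop V := (2^-1)%:C *: (K - J * K * J).
Local Notation W := cos2b.
Local Notation Z := sin2b.

Lemma cos2b_selfadjoint : selfadjoint W.
Proof.
apply: is_adjointZ; rewrite [X in is_adjoint _ X]addrC.
by apply: is_adjointD; apply: is_adjointM.
Qed.

Lemma sin2b_selfadjoint : selfadjoint Z.
Proof.
apply: is_adjointZ; apply: is_adjointB => //.
by rewrite /selfadjoint -{2}mulrA; do 2!apply: is_adjointM => //.
Qed.

Lemma reflection_cos2b : J * W = W * J.
Proof.
rewrite /cos2b -scalebAr -scalebAl; congr (_ *: _).
by rewrite mulrDr mulrDl addrC mulrA JJ mul1r -(mulrA K) JJ mulr1 mulrA.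
Qed.

Lemma reflection_sin2b : J * Z = - (Z * J).
Proof.
rewrite /sin2b -scalebAr -scalebAl -scalerN; congr (_ *: _).
by rewrite mulrBr mulrBl opprB -(mulrA (J * K)) JJ mulr1 !mulrA JJ mul1r.
Qed.

Lemma reflection_decomposition : K = W * J + Z.
Proof.
rewrite /cos2b /sin2b -scalebAl -scalerDr mulrDl -mulrA JJ mulr1 addrACA.
rewrite subrr addr0 -[in RHS](scale1r K) -scalerDl scalerA.
by rewrite -(rmorph1 (real_complex R)) -rmorphD -rmorphM /= mulVf ?scale1r.
Qed.

Let W2 : bop V := K * J + J * K.
Let Z2 : bop V := K - J * K * J.

Let W2Z2_sqr : W2 * W2 + Z2 * Z2 = (4 : R)%:C *: (1 : bop V).
Proof.
apply: bopP => x; rewrite /W2 /Z2 !bopE !(linearD, linearN) /= !(JJx, KKx).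
apply: rdot_inj => y; rewrite !(rdotDl, rdotNl, rdotZl); ring.
Qed.

Let W2Z2_comm : W2 * Z2 = Z2 * W2.
Proof.
apply: bopP => x; rewrite /W2 /Z2 !bopE !(linearD, linearN) /= !(JJx, KKx).
apply: rdot_inj => y; rewrite !(rdotDl, rdotNl, rdotZl); ring.
Qed.

Lemma cos2b_sin2b_sqr : W * W + Z * Z = 1.
Proof.
rewrite /cos2b /sin2b -!scalebAl -!scalebAr -!scalerDr W2Z2_sqr !scalerA.
by rewrite -!rmorphM /= -[RHS]scale1r; congr (_%:C *: _); field.
Qed.

Lemma cos2b_sin2bC : W * Z = Z * W.
Proof. by rewrite /cos2b /sin2b -!scalebAl -!scalebAr W2Z2_comm. Qed.

Lemma rdot_cos2b x : rdot (W x) x = rdot (J x) (K x).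
Proof.
have /selfadjointP k := Ks; have /selfadjointP j := Js.
by rewrite !bopE rdotZl rdotDl (k (J x)) (j (K x)) (rdotC (K x)); field.
Qed.

Let rnormJ x : rnorm (J x) = rnorm x.
Proof.
apply/eqP; rewrite -(@eqrXn2 _ 2) ?rnorm_ge0 // -!rdotxx.
by have /selfadjointP -> := Js; rewrite JJx.
Qed.

Let rnormK x : rnorm (K x) = rnorm x.
Proof.
apply/eqP; rewrite -(@eqrXn2 _ 2) ?rnorm_ge0 // -!rdotxx.
by have /selfadjointP -> := Ks; rewrite KKx.
Qed.

Lemma cos2b_between : between (-1) 1 W.
Proof.
split; first exact: cos2b_selfadjoint.
move=> x; rewrite rdot_cos2b mulN1r mul1r -ler_norml (le_trans (normr_rdot_le _ _)) //.
by rewrite rnormJ rnormK rdotxx expr2.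
Qed.

Lemma sin2b_between : between (-1) 1 Z.
Proof.
apply: opnorm_between; first exact: sin2b_selfadjoint.
apply: opnorm_ler => // x; rewrite mul1r.
rewrite -(@ler_pXn2r _ 2) ?nnegrE ?rnorm_ge0 // -!rdotxx.
have /selfadjointP -> := sin2b_selfadjoint.
have -> : rdot x x = rdot x ((W * W + Z * Z) x) by rewrite cos2b_sin2b_sqr.
rewrite addbE rdotDr !mulbE lerDr.
by have /selfadjointP <- := cos2b_selfadjoint; exact: rdotxx_ge0.
Qed.

(** [(J + K)^2 = 2 (W + 1)], and a self-adjoint operator has the same kernel as its square. *)
Lemma cos2b_add1_inj x : W x + x = 0 -> x = 0.
Proof.
move=> Wx; pose A := J + K.
have As : selfadjoint A by exact: is_adjointD.
have AA : A (A x) = 0.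
  have -> : A (A x) = 2%:C *: (W x + x).
    rewrite /A /cos2b !(bopE, linearD) /= !(JJx, KKx).
    by apply: rdot_inj => y; rewrite !(rdotDl, rdotZl); field.
  by rewrite Wx scaler0.
by apply: JK0; exact: selfadjoint_sqr_eq0 As AA.
Qed.

(** On the kernel of [Z] one has [W W x = x], so [W + 1] annihilates [W x - x]. *)
Lemma sin2b_eq0 x : Z x = 0 -> W x = x.
Proof.
move=> Zx; have WWx : W (W x) = x.
  have := bop_app x cos2b_sin2b_sqr.
  by rewrite addbE !mulbE Zx linear0 addr0.
apply/eqP; rewrite -subr_eq0; apply/eqP/cos2b_add1_inj.
have -> : W (W x - x) = W (W x) - W x by exact: linearB.
by rewrite WWx addrC subrKA subrr.
Qed.

Let ltN11 : -1 < 1 :> R. Proof. lra. Qed.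

Let acos2_cont : {within `[-1, 1], continuous (fun x : R => acos x / 2)}.
Proof.
have /subspace_continuousP h := @acos_continuous R.
by apply/subspace_continuousP => x x1; apply: cvgM; [exact: h|exact: cvg_cst].
Qed.

Definition angleb : bop V := fcal (-1) 1 W (fun x => acos x / 2).
Local Notation Th := angleb.

Lemma anglebP : isfc (-1) 1 W (fun x => acos x / 2) Th.
Proof. by apply: fcalP => //; exact: cos2b_between. Qed.

Let pi2 : 0 < pi / 2 :> R. Proof. by rewrite divr_gt0 // pi_gt0. Qed.

Let acos2_itv (x : R) : -1 <= x <= 1 -> 0 <= acos x / 2 <= pi / 2.
Proof.
by move=> x1; rewrite divr_ge0 ?acos_ge0 //= ler_pM2r ?invr_gt0 // acos_lepi.
Qed.

Lemma angleb_between : between 0 (pi / 2) Th.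
Proof. exact: (isfc_between ltN11 cos2b_between anglebP). Qed.

Let sinct_cont (t : R) : continuous (fun x => t * sinc (t * x)).
Proof.
move=> x; apply: cvgM; first exact: cvg_cst.
by apply: (@continuous_scaled R (@sinc R)); exact: continuous_sinc.
Qed.

Let cos2_cont := @continuous_scaled R cos 2 (@continuous_cos R).
Let sin2_cont := @continuous_scaled R sin 2 (@continuous_sin R).

Lemma cos_angleb : isfc 0 (pi / 2) Th (fun x => cos (2 * x)) W.
Proof.
have [F FP] := isfc_ex pi2 angleb_between
  (continuous_subspaceT cos2_cont).
have := isfc_comp anglebP acos2_itv FP => h.
have WF := isfc_uniq ltN11 cos2b_between (isfc_id _ _ _) h.
rewrite WF // => x x1.
by rewrite /= mulrC divfK // acosK // in_itv.
Qed.

Definition absZ : bop V := fcal (-1) 1 Z Num.norm.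

Lemma absZP : isfc (-1) 1 Z Num.norm absZ.
Proof.
apply: fcalP => //; first exact: sin2b_between.
by apply: continuous_subspaceT => x; exact: norm_continuous.
Qed.

(** [absZ] is a function of [Z], the sine a function of [W]; they meet in [S], the square root of
    [Z * Z = 1 - W * W]. *)
Lemma sin_angleb : isfc 0 (pi / 2) Th (fun x => sin (2 * x)) absZ.
Proof.
have [F FP] := isfc_ex pi2 angleb_between
  (continuous_subspaceT sin2_cont).
suff -> : absZ = F by [].
have FW := isfc_comp anglebP acos2_itv FP.
have sqc : {within `[0, 1], continuous (@Num.sqrt R)}.
  by apply: continuous_subspaceT; exact: sqrt_continuous.
have ZZ := isfcM (isfc_id (-1) 1 Z) (isfc_id (-1) 1 Z).
have sq1 (z : R) : -1 <= z <= 1 -> 0 <= z * z <= 1.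
  by move=> /andP[z1 z2]; apply/andP; split; nra.
have ZZ01 : between 0 1 (Z * Z).
  by apply: (isfc_between ltN11 sin2b_between ZZ).
have [S SP] := isfc_ex ltr01 ZZ01 sqc.
transitivity S.
  apply: (isfc_uniq ltN11 sin2b_between absZP (isfc_comp ZZ sq1 SP)) => x _.
  by rewrite -expr2 sqrtr_sqr.
have WW : isfc (-1) 1 W (fun x => 1 - x * x) (Z * Z).
  have -> : Z * Z = 1%:C *: (1 : bop V) - W * W.
    by rewrite scale1r -cos2b_sin2b_sqr addrC addKr.
  exact: (isfcB (isfc_cst _ _ _ 1) (isfcM (isfc_id _ _ _) (isfc_id _ _ _))).
apply: (isfc_uniq ltN11 cos2b_between (isfc_comp WW _ SP) FW) => x x1.
  by have /andP[h1 h2] := sq1 x x1; apply/andP; split; lra.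
by rewrite (mulrC 2) divfK // sin_acos // expr2.
Qed.

(** The kernel of [Z] belongs to the eigenvalue 1 of [W], not to -1, so the angle there is
    [acos 1 / 2 = 0]. *)
Lemma angleb_eq0 x : Z x = 0 -> Th x = 0.
Proof.
move=> /sin2b_eq0 Wx.
have h : W x = 1%:C *: x by rewrite scale1r.
rewrite (isfc_eigen anglebP _ h); last by apply/andP; split; lra.
by rewrite acos1 mul0r scale0r.
Qed.

Definition signZ : bop V := signb sin2b_between.
Local Notation E := signZ.
Definition velocityb : bop V := E * Th.
Local Notation X := velocityb.

Let commW_commTh (B : bop V) : B * W = W * B -> B * Th = Th * B.
Proof.
move=> BW; apply: bopP => x.
apply: (@isfc_intertwine R V V B (opnorm B) (-1) 1 W Th W Th _ ltN11) anglebP anglebP x => //.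
- exact: cos2b_between.
- exact: cos2b_between.
- by move=> y; exact: rnorm_bop_le.
- by move=> y; exact: (congr1 (fun A : bop V => A y) BW).
Qed.

Lemma signZ_angleb : E * Th = Th * E.
Proof.
apply: commW_commTh; apply/esym.
exact: (signb_comm sin2b_between cos2b_sin2bC).
Qed.

Lemma reflection_angleb : J * Th = Th * J.
Proof. by apply: commW_commTh; exact: reflection_cos2b. Qed.

Lemma reflection_signZ : J * E = - (E * J).
Proof. exact: (signb_anticomm sin2b_between reflection_sin2b). Qed.

Lemma signZ_cube : E * E * E = E. Proof. exact: signb_cube. Qed.

Lemma signZ_eq0 x : E x = 0 <-> Z x = 0. Proof. exact: signb_eq0. Qed.

(** [x - E (E x)] lies in the kernel of [E], which is that of [Z], and there [Th] vanishes. *)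
Lemma signZ_sqr_angleb : E * E * Th = Th.
Proof.
have comm : E * E * Th = Th * (E * E).
  by rewrite -mulrA signZ_angleb !mulrA signZ_angleb.
rewrite comm; apply: bopP => x; pose y := x - E (E x).
have Ey : E y = 0.
  have -> : E y = E x - (E * E * E) x by exact: linearB.
  by rewrite signZ_cube subrr.
have : Th y = 0 by apply: angleb_eq0; apply/signZ_eq0.
have -> : Th y = Th x - (Th * (E * E)) x by exact: linearB.
by move/eqP; rewrite subr_eq0 => /eqP.
Qed.

Lemma velocityb_selfadjoint : selfadjoint X.
Proof.
rewrite /selfadjoint /velocityb {2}signZ_angleb; apply: is_adjointM.
  exact: signb_selfadjoint.
by case: angleb_between.
Qed.

Lemma velocityb_sqr : X * X = Th * Th.
Proof.
by rewrite /velocityb -mulrA (mulrA Th) -signZ_angleb !mulrA signZ_sqr_angleb.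
Qed.

Lemma reflection_velocityb : J * X = - (X * J).
Proof.
by rewrite /velocityb mulrA reflection_signZ mulNr -!mulrA reflection_angleb.
Qed.

Lemma rnorm_velocityb x : rnorm (X x) = rnorm (Th x).
Proof.
apply/eqP; rewrite -(@eqrXn2 _ 2) ?rnorm_ge0 // -!rdotxx.
have /selfadjointP -> := velocityb_selfadjoint.
have /selfadjointP -> := angleb_between.1.
by rewrite -!mulbE velocityb_sqr.
Qed.

Lemma velocityb_opnorm_le (m : R) : 0 <= m ->
  (forall x, rnorm (Th x) <= m * rnorm x) -> opnorm X <= m.
Proof. by move=> m0 h; apply: opnorm_ler => // x; rewrite rnorm_velocityb. Qed.

Lemma opnorm_velocityb : opnorm X <= pi / 2.
Proof.
apply: velocityb_opnorm_le => [|x]; first exact: ltW.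
rewrite (le_trans (rnorm_bop_le _ _)) // ler_wpM2r ?rnorm_ge0 //.
apply: (isfc_opnorm_le pi2 angleb_between (isfc_id _ _ _)) => [|t]; first exact: ltW.
by move=> /andP[t0 t1]; rewrite ger0_norm.
Qed.

(** The even factor of the sine: by [sinb_of_square], the sine of [2 Y] is [Y * G] for each
    self-adjoint [Y] that anticommutes with [J] and has the square of [Th]. *)
Let G : bop V := fcal 0 (pi / 2) Th (fun x => 2 * sinc (2 * x)).

Let GP : isfc 0 (pi / 2) Th (fun x => 2 * sinc (2 * x)) G.
Proof.
apply: fcalP => //; first exact: angleb_between.
exact/continuous_subspaceT/sinct_cont.
Qed.

Let Th_G : Th * G = absZ.
Proof.
apply: (isfc_uniq pi2 angleb_between (isfcM (isfc_id _ _ _) GP) sin_angleb) => x _.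
by rewrite /= mulrCA mulrA mulr_sinc.
Qed.

(** [G x = 0] forces [absZ x = 0], hence [Th x = 0]; but there [G] acts as [2 sinc 0 = 2]. *)
Let G_inj x : G x = 0 -> x = 0.
Proof.
move=> Gx; have Ax : absZ x = 0 by rewrite -Th_G mulbE Gx; exact: linear0.
have Zx : Z x = 0.
  have [_ <-] := signb_mul_abs sin2b_between absZP; rewrite mulbE Ax.
  exact: linear0.
have Thx : Th x = 0%:C *: x by rewrite scale0r angleb_eq0.
have := isfc_eigen GP _ Thx; rewrite Gx mulr0 sinc0 mulr1 lexx ltW // => /(_ isT)/esym.
by move/eqP; rewrite scaler_eq0 (inj_eq (@complexI R) 2 0) pnatr_eq0 => /eqP.
Qed.

(** * Square roots of the squared angle that anticommute with the reflection *)

Section SquareRoot.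
Variable Y : bop V.
Hypotheses (Ys : selfadjoint Y) (JY : J * Y = - (Y * J)).

Let JYP := And4 JJ Js Ys JY.
Let r : R := opnorm Y + 1.
Let r0 : 0 < r. Proof. by rewrite ltr_wpDl // opnorm_ge0. Qed.
Let rr : - r < r. Proof. by rewrite gtrN. Qed.
Let rY : between (- r) r Y.
Proof. by apply: opnorm_between => //; rewrite lerDl. Qed.

(** A common bound for the squares of points of [[-r, r]] and of [[0, pi / 2]]. *)
Let M : R := r * r + pi / 2 * (pi / 2).
Let M0 : 0 < M. Proof. by rewrite addr_gt0 // mulr_gt0. Qed.
Let rM x : - r <= x <= r -> x * x <= M.
Proof.
move=> /andP[h1 h2]; rewrite /M (@le_trans _ _ (r * r)) //; first by nra.
by rewrite lerDl mulr_ge0 // ltW.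
Qed.
Let piM x : 0 <= x <= pi / 2 -> x * x <= M.
Proof.
move=> /andP[h1 h2]; rewrite /M (@le_trans _ _ (pi / 2 * (pi / 2))) //.
  by rewrite ler_pM.
by rewrite lerDr mulr_ge0 // ltW.
Qed.

Let sqrt_comp_cont (f : R -> R) : continuous f ->
  {within `[0, M], continuous (f \o @Num.sqrt R)}.
Proof.
move=> fc; apply: continuous_subspaceT => x.
by apply: continuous_comp; [exact: sqrt_continuous|exact: fc].
Qed.

Lemma cosb_of_square t T F : between 0 (pi / 2) T -> Y * Y = T * T ->
  isfc 0 (pi / 2) T (fun x => cos (t * x)) F -> cosb Y t = F.
Proof.
move=> bT YT FP.
refine (isfc_sqr_eq rr pi2 M0 rY bT YT rM piM
  (sqrt_comp_cont (@continuous_scaled R cos t (@continuous_cos R))) _ _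
  (cosbP JYP t) FP).
- move=> x _ /=; rewrite -expr2 sqrtr_sqr.
  by case: (ger0P x) => // _; rewrite mulrN cosN.
- by move=> x /andP[x0 _] /=; rewrite -expr2 sqrtr_sqr ger0_norm.
Qed.

(** [sin (t x)] is [x] times the even function [t sinc (t x)], so apart from the factor [Y] only the
    square of [Y] matters. *)
Lemma sinb_of_square t F : Y * Y = Th * Th ->
  isfc 0 (pi / 2) Th (fun x => t * sinc (t * x)) F -> sinb Y t = Y * F.
Proof.
move=> YT FP; have [F' F'P] := isfc_ex rr rY (continuous_subspaceT (@sinct_cont t)).
have <- : F' = F.
  refine (isfc_sqr_eq rr pi2 M0 rY angleb_between YT rM piM
    (sqrt_comp_cont (@sinct_cont t)) _ _ F'P FP).
  - move=> x _ /=; rewrite -expr2 sqrtr_sqr.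
    by case: (ger0P x) => // _; rewrite mulrN sincN.
  - by move=> x /andP[x0 _] /=; rewrite -expr2 sqrtr_sqr ger0_norm.
apply: (isfc_uniq rr rY (sinbP JYP _) (isfcM (isfc_id _ _ _) F'P)) => x _.
by rewrite /= mulrCA mulrA mulr_sinc.
Qed.

(** With [T = |Y|], evenness gives [W = cos 2T]. The bound [pi / 2] keeps [2 T] in the range where
    [acos] inverts [cos], so that [T = Th]. *)
Lemma square_of_cosb : opnorm Y <= pi / 2 -> cosb Y (1 + 1) = W -> Y * Y = Th * Th.
Proof.
move=> Ypi YW; have [T TP] : exists T, isfc (- r) r Y Num.norm T.
  by apply: isfc_ex => //; apply: continuous_subspaceT => x; exact: norm_continuous.
have YT : Y * Y = T * T.
  apply: (isfc_uniq rr rY (isfcM (isfc_id _ _ _) (isfc_id _ _ _)) (isfcM TP TP)) => x _.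
  by rewrite /= -normrM ger0_norm // -expr2 sqr_ge0.
have [Ts T0] : between 0 r T.
  by apply: (isfc_between rr rY TP) => x xr; rewrite normr_ge0 ler_norml.
have bT : between 0 (pi / 2) T.
  have Tpi : opnorm T <= pi / 2.
    apply: opnorm_ler => [|x]; first exact: ltW.
    have -> : rnorm (T x) = rnorm (Y x).
      apply/eqP; rewrite -(@eqrXn2 _ 2) ?rnorm_ge0 // -!rdotxx.
      move: (Ys) (Ts) => /selfadjointP -> /selfadjointP ->.
      by rewrite -!mulbE YT.
    by rewrite (le_trans (rnorm_bop_le _ _)) // ler_wpM2r ?rnorm_ge0.
  have [_ h] := opnorm_between Ts Tpi; split=> // x.
  by have /andP[-> _] := T0 x; have /andP[_ ->] := h x.
have [F FP] := isfc_ex pi2 bT (continuous_subspaceT cos2_cont).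
have WF : W = F by rewrite -YW; exact: cosb_of_square bT YT FP.
rewrite -WF in FP.
rewrite YT; suff -> : T = Th by [].
have c1 (x : R) : 0 <= x <= pi / 2 -> -1 <= cos (2 * x) <= 1.
  by rewrite cos_geN1 cos_le1.
apply: (isfc_uniq pi2 bT (isfc_id _ _ _) (isfc_comp FP c1 anglebP)) => x /andP[x0 xp].
rewrite cosK ?in_itv /=; first by rewrite mulrC mulKf.
by rewrite mulr_ge0 //= mulrC -ler_pdivlMr.
Qed.

End SquareRoot.

Lemma cosb_velocityb_angleb t F : isfc 0 (pi / 2) Th (fun x => cos (t * x)) F ->
  cosb X t = F.
Proof.
exact: (cosb_of_square velocityb_selfadjoint reflection_velocityb
  angleb_between velocityb_sqr).
Qed.

Lemma sinb_velocityb_angleb t F : isfc 0 (pi / 2) Th (fun x => sin (t * x)) F ->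
  sinb X t = E * F.
Proof.
move=> FP; have [K' K'P] := isfc_ex pi2 angleb_between
  (continuous_subspaceT (@sinct_cont t)).
rewrite (sinb_of_square velocityb_selfadjoint reflection_velocityb velocityb_sqr K'P).
rewrite /velocityb -mulrA; congr (_ * _).
apply: (isfc_uniq pi2 angleb_between (isfcM (isfc_id _ _ _) K'P) FP) => x _.
by rewrite /= mulrCA mulrA mulr_sinc.
Qed.

Lemma cosb_velocityb : cosb X (1 + 1) = W.
Proof. exact: cosb_velocityb_angleb cos_angleb. Qed.

Lemma sinb_velocityb : sinb X (1 + 1) = Z.
Proof.
rewrite (sinb_velocityb_angleb sin_angleb).
by case: (signb_mul_abs sin2b_between absZP).
Qed.

Lemma velocityb_eq0 x : X x = 0 -> E x = 0.
Proof.
move=> Xx; have Thx : Th x = 0%:C *: x.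
  by rewrite scale0r; apply/eqP; rewrite -rnorm_eq0 -rnorm_velocityb Xx rnorm0.
have Ax : absZ x = 0.
  rewrite (isfc_eigen sin_angleb _ Thx) ?lexx ?ltW //=.
  by rewrite mulr0 sin0 scale0r.
apply/signZ_eq0; have [_ <-] := signb_mul_abs sin2b_between absZP.
by rewrite mulbE Ax; exact: linear0.
Qed.

(** [Y * G] and [X * G] both equal [Z]. Taking adjoints puts [G] on the left, where its injectivity
    cancels it. *)
Lemma velocityb_uniq Y : selfadjoint Y -> J * Y = - (Y * J) -> opnorm Y <= pi / 2 ->
  cosb Y (1 + 1) = W -> sinb Y (1 + 1) = Z -> Y = X.
Proof.
move=> Ys JY Ypi YW YZ; have YT := square_of_cosb Ys JY Ypi YW.
have YG : (Y - X) * G = 0.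
  rewrite mulrBl -(sinb_of_square Ys JY YT GP) YZ.
  by rewrite -(sinb_of_square velocityb_selfadjoint reflection_velocityb velocityb_sqr GP)
    sinb_velocityb subrr.
have Ds := is_adjointB Ys velocityb_selfadjoint.
have Gs := isfc_selfadjoint angleb_between.1 GP.
have GD : G * (Y - X) = 0.
  apply: (is_adjoint_uniq (is_adjointM Ds Gs)); rewrite YG.
  by apply/is_adjointP => x y; rewrite !zerobE rdot0l rdot0r.
apply/eqP; rewrite -subr_eq0; apply/eqP; apply: bopP => x.
by apply: G_inj; rewrite -mulbE GD.
Qed.

(** Half of [acos] maps [[cos 2L, 1]] into [[0, L]]; [0 < L] keeps both intervals nondegenerate. *)
Lemma velocityb_le (L : R) : 0 < L -> 2 * L <= pi -> between (cos (2 * L)) 1 W ->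
  opnorm X <= L.
Proof.
move=> L0 Lpi bW; have c1 : cos (2 * L) < 1.
  rewrite lt_neqAle cos_le1 andbT; apply/eqP => h.
  have : 2 * L = 0.
    have := @cos_inj R (2 * L) 0; rewrite !in_itv /= lexx pi_ge0 Lpi andbT.
    by rewrite mulr_ge0 ?ltW // h cos0 => /(_ isT isT erefl).
  by apply/eqP; rewrite gt_eqF // mulr_gt0.
have bTh := isfc_between c1 bW (isfcW (cos_geN1 _) (lexx 1) anglebP) (c := 0) (d := L).
apply: velocityb_opnorm_le => [|x]; first exact: ltW.
have {}bTh : between 0 L Th.
  apply: bTh => t /andP[w1 w2].
  have w11 : -1 <= t <= 1 by rewrite w2 (le_trans (cos_geN1 _) w1).
  rewrite divr_ge0 ?acos_ge0 //= ler_pdivrMr // mulrC.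
  rewrite leNgt; apply/negP => h.
  have : t < cos (2 * L).
    rewrite -[t]acosK ?in_itv // ltNge cos_mono ?in_itv /= ?acos_ge0 ?acos_lepi //;
      last by rewrite Lpi mulr_ge0 ?(ltW L0).
    by rewrite -ltNge.
  by rewrite ltNge w1.
rewrite (le_trans (rnorm_bop_le _ _)) // ler_wpM2r ?rnorm_ge0 //.
apply: (isfc_opnorm_le L0 bTh (isfc_id _ _ _)) => [|t]; first exact: ltW.
by move=> /andP[t0 t1]; rewrite ger0_norm.
Qed.

End TwoReflections.

(** * Minimal geodesics *)

Section MinimalGeodesic.
Variables (R : realType) (V : hilbertType R) (P Q : bop V).
Hypotheses (PP : is_projection P) (QQ : is_projection Q).
Hypotheses (kerP_Q : forall x, P x = 0 -> Q x = x -> x = 0)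
           (P_kerQ : forall x, P x = x -> Q x = 0 -> x = 0).

Local Notation J := (reflection P).
Local Notation K := (reflection Q).

(** [J x + K x = 0] means [Q x = x - P x]. This vector lies in the range of [Q] and the kernel of
    [P], so it is 0, and [x] lies in the range of [P] and the kernel of [Q]. *)
Lemma reflections_injective x : J x + K x = 0 -> x = 0.
Proof.
have [PPP _] := PP; have [QQQ _] := QQ.
rewrite /reflection !bopE => h.
have Qx : Q x = x - P x.
  apply: rdot_inj => y; have := congr1 (fun z => rdot z y) h.
  by rewrite !(rdotDl, rdotNl) rdot0l => h'; lra.
have Qx0 : Q x = 0.
  apply: kerP_Q; last by rewrite -mulbE QQQ.
  rewrite Qx; have -> : P (x - P x) = P x - (P * P) x by exact: linearB.
  by rewrite PPP subrr.
by apply: P_kerQ => //; apply/esym/eqP; rewrite -subr_eq0 -Qx Qx0.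
Qed.

Definition direction : bop V :=
  velocityb (reflection_sqr PP) (reflection_sqr QQ)
    (reflection_selfadjoint PP) (reflection_selfadjoint QQ).
Local Notation X := direction.

Let JJ := reflection_sqr PP.
Let KK := reflection_sqr QQ.
Let Js := reflection_selfadjoint PP.
Let Ks := reflection_selfadjoint QQ.
Let JK0 := reflections_injective.

Lemma direction_reflection : J * X = - (X * J).
Proof. exact: (reflection_velocityb JJ KK Js Ks). Qed.

Lemma direction_selfadjoint : selfadjoint X.
Proof. exact: velocityb_selfadjoint. Qed.

Lemma direction_tangent : tangent P X.
Proof.
split; first exact: direction_selfadjoint.
have := direction_reflection; move: X => Y JY.
apply: bopP => x; apply: rdot_inj => y.
have := congr1 (fun A : bop V => rdot (A x) y) JY.
rewrite /reflection mulrBr mulrDr mulrBl mulrDl mulr1 mul1r.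
by rewrite !bopE !(rdotDl, rdotNl) => h; lra.
Qed.

Lemma opnorm_direction : opnorm X <= pi / 2.
Proof. exact: opnorm_velocityb. Qed.

Let JXP := And4 JJ Js direction_selfadjoint direction_reflection.

Lemma geod_start Y : tangent P Y -> geod P Y 0 = P.
Proof.
move=> PY; rewrite /geod addr0 (rotb0 (And4 JJ Js PY.1 (reflectionX PY))) mul1r.
by rewrite -projection_reflection.
Qed.

Lemma geod_direction_end : geod P X 1 = Q.
Proof.
have cX : cosb X (1 + 1) = cos2b J K := cosb_velocityb JJ KK Js Ks JK0.
have sX : sinb X (1 + 1) = sin2b J K := sinb_velocityb JJ KK Js Ks JK0.
rewrite /geod /rotb cX sX mulrDl -mulrA JJ mulr1.
rewrite -(@reflection_decomposition _ _ J K JJ).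
by rewrite -projection_reflection.
Qed.

(** The endpoint determines [K], whose parts commuting and anticommuting with [J] are [cosb * J] and
    [sinb]; these must agree with [W * J] and [Z]. *)
Lemma geod_end_direction Y : tangent P Y -> opnorm Y <= pi / 2 ->
  geod P Y 1 = Q -> Y = X.
Proof.
move=> PY Ypi YQ; have JY := reflectionX PY.
have JYP := And4 JJ Js PY.1 JY.
have KE : K = cosb Y (1 + 1) * J + sinb Y (1 + 1).
  rewrite -[sinb Y _]mulr1 -JJ mulrA -mulrDl -/(rotb J Y (1 + 1)).
  rewrite {1}/reflection -YQ /geod.
  move: (rotb _ _ _) => B; apply: bopP => x; rewrite !bopE; apply: rdot_inj => y.
  by rewrite !(rdotDl, rdotNl, rdotZl); field.
have cJ := cosbJ JYP (1 + 1); have sJ := sinbJ JYP (1 + 1).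
apply: (velocityb_uniq JJ KK Js Ks JK0 PY.1) => //.
  rewrite /cos2b KE mulrDl (mulrDr J) (mulrA J) cJ sJ -(mulrA _ J J) JJ mulr1.
  move: (cosb _ _) (_ * J) => A B; apply: bopP => x; rewrite !bopE.
  by apply: rdot_inj => y; rewrite !(rdotDl, rdotNl, rdotZl); field.
rewrite /sin2b KE (mulrDr J) mulrDl (mulrA J) cJ sJ mulNr -!(mulrA _ J J) JJ !mulr1.
move: (sinb _ _) (_ * J) => A B; apply: bopP => x; rewrite !bopE.
by apply: rdot_inj => y; rewrite !(rdotDl, rdotNl, rdotZl); field.
Qed.

Section Curve.
Variable c : R -> bop V.
Hypotheses (cc : is_curve c) (c0 : c 0 = P) (c1 : c 1 = Q).
Variable L : R.
Hypotheses (cL : curve_length c = L%:E) (Lpi : 2 * L <= pi).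

Let unit_vector (x : V) : x != 0 -> rnorm ((rnorm x)^-1%:C *: x) = 1.
Proof.
rewrite -rnorm_eq0 => x0.
by rewrite rnormZ ger0_norm ?invr_ge0 ?rnorm_ge0 // mulVf.
Qed.

Let rdot_K x : rdot x (K x) = 2 * rdot (Q x) x - rdot x x.
Proof. by rewrite rdotC /reflection !bopE rdotBl rdotDl; ring. Qed.

Let rdot_normalize (A : bop V) x : x != 0 ->
  rdot (A ((rnorm x)^-1%:C *: x)) ((rnorm x)^-1%:C *: x) * rdot x x = rdot (A x) x.
Proof.
rewrite -rnorm_eq0 => x0; rewrite linearZ /= rdotZl rdotZr rdotxx.
by field.
Qed.

Lemma curve_end_range x : P x = x -> cos (2 * L) * rdot x x <= rdot x (K x).
Proof.
move=> Px; have [->|x0] := eqVneq x 0; first by rewrite linear0 !rdot0r mulr0.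
pose y : V := (rnorm x)^-1%:C *: x.
have y1 : rnorm y = 1 := unit_vector x0.
have yy : c 0 y = y by rewrite c0 linearZ /= Px.
have := curve_angle_range cc y1 cL Lpi yy; rewrite c1 => h.
rewrite rdot_K -(rdot_normalize Q x0) -/y.
have := ler_wpM2r (rdotxx_ge0 x) h; lra.
Qed.

Lemma curve_end_kernel x : P x = 0 -> cos (2 * L) * rdot x x <= - rdot x (K x).
Proof.
move=> Px; have [->|x0] := eqVneq x 0; first by rewrite linear0 !rdot0r mulr0 oppr0.
pose y : V := (rnorm x)^-1%:C *: x.
have y1 : rnorm y = 1 := unit_vector x0.
have yy : c 0 y = 0 by rewrite c0 linearZ /= Px scaler0.
have := curve_angle_kernel cc y1 cL Lpi yy; rewrite c1 => h.
rewrite rdot_K -(rdot_normalize Q x0) -/y.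
have := ler_wpM2r (rdotxx_ge0 x) h; lra.
Qed.

(** The form of [W] at [x = p + q] is that of [J x = p - q] against [K x]. The cross terms cancel as
    [K] is self-adjoint, leaving one term on the range and one on the kernel of [P]. *)
Lemma curve_cos2b : between (cos (2 * L)) 1 (cos2b J K).
Proof.
have [PPP /selfadjointP Ps] := PP.
have [Ws hW] := cos2b_between JJ KK Js Ks.
split=> // x; have /andP[_ ->] := hW x; rewrite andbT.
set p := P x; set q := x - P x.
have Pp : P p = p by rewrite /p -mulbE PPP.
have Pq : P q = 0.
  have -> : P q = P x - (P * P) x by exact: linearB.
  by rewrite PPP subrr.
have xE : x = p + q by rewrite /q /p addrC subrK.
have pq : rdot p q = 0 by rewrite /p Ps Pq rdot0r.
have Jp : J p = p by rewrite /reflection !bopE Pp addrK.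
have Jq : J q = - q by rewrite /reflection !bopE Pq addr0 sub0r.
have JD a b : J (a + b) = J a + J b by exact: linearD.
have KD a b : K (a + b) = K a + K b by exact: linearD.
have Jx : J x = p - q by rewrite {1}xE JD Jp Jq.
have := curve_end_range Pp; have := curve_end_kernel Pq.
rewrite (rdot_cos2b Js Ks) Jx xE KD.
have kpq : rdot q (K p) = rdot p (K q).
  by have /selfadjointP ks := Ks; rewrite rdotC ks.
move: (K p) (K q) kpq => kp kq kpq; clearbody p q.
by rewrite rdotBl !rdotDl !rdotDr (rdotC q p) pq kpq mulrDr; lra.
Qed.

End Curve.

Lemma direction_length_min c : is_curve c -> c 0 = P -> c 1 = Q ->
  ((opnorm X)%:E <= curve_length c)%E.
Proof.
move=> cc c0 c1; have : (0 <= curve_length c)%E.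
  by apply: integral_ge0 => t _; rewrite lee_fin opnorm_ge0.
case cL : (curve_length c) => [L| |] //; last by move=> _; exact: leey.
rewrite !lee_fin => L0; rewrite leNgt; apply/negP => LX.
have Xpi := opnorm_direction.
(* [L] may be 0, while [velocityb_le] asks for a positive bound; the midpoint is positive and still
   below [opnorm X]. *)
pose L' := (L + opnorm X) / 2.
have LL' : L < L' by rewrite /L'; lra.
have L'X : L' < opnorm X by rewrite /L'; lra.
have L'pi : 2 * L' <= pi by lra.
have Lpi : 2 * L <= pi by lra.
have L'0 : 0 < L' := le_lt_trans L0 LL'.
have bL := curve_cos2b cc c0 c1 cL Lpi.
have bL' : between (cos (2 * L')) 1 (cos2b J K).
  apply: betweenW _ (lexx 1) bL.
  by rewrite cos_mono ?in_itv /= ?Lpi ?L'pi ?andbT; lra.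
by have := velocityb_le JJ KK Js Ks JK0 L'0 L'pi bL'; rewrite leNgt L'X.
Qed.

Let gE : {in `[0, 1], forall t : R, geod P X t = geod P X t}. Proof. by []. Qed.

Lemma direction_minimal : minimal_geodesic (geod P X).
Proof.
have PX := direction_tangent; split.
  by exists P, X; split=> // t _ /=; rewrite (geod_bexp PP PX).
apply/eqP; rewrite eq_le; apply/andP; split; last first.
  apply: ereal_inf_lbound; exists (geod P X) => //; split=> //.
  exact: (geodesic_is_curve PP PX gE).
apply: le_ereal_inf_tmp => _ [c [cc c0 c1] <-].
rewrite (geodesic_length PP PX gE); apply: direction_length_min => //.
  by rewrite c0 geod_start.
by rewrite c1 geod_direction_end.
Qed.

Lemma minimal_geodesic_uniq g : minimal_geodesic g -> g 0 = P -> g 1 = Q ->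
  {in `[0, 1], forall t, g t = geod P X t}.
Proof.
move=> [[P' [Y [PP' PY gP]]] gmin] g0 g1.
have {}gP : {in `[0, 1], forall t, g t = geod P' Y t}.
  by move=> t t01; rewrite gP //= (geod_bexp PP' PY).
have l0 : 0 \in `[0, 1 : R] by rewrite bound_itvE ler01.
have l1 : 1 \in `[0, 1 : R] by rewrite bound_itvE ler01.
have P'P : P' = P.
  rewrite -g0 gP // /geod addr0.
  have P'Y := And4 (reflection_sqr PP') (reflection_selfadjoint PP') PY.1 (reflectionX PY).
  by rewrite (rotb0 P'Y) mul1r -projection_reflection.
move: PP' PY gP; rewrite P'P => _ PY gP.
have gX : g 0 = geod P X 0 by rewrite g0 geod_start //; exact: direction_tangent.
have g1X : g 1 = geod P X 1 by rewrite g1 geod_direction_end.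
(* Constant speed makes the length of [g] equal to [opnorm Y]; minimality equates it with
   [opnorm X]. *)
have Ypi : opnorm Y <= pi / 2.
  have := geodesic_length PP PY gP; rewrite gmin gX g1X.
  have [_ <-] := direction_minimal.
  by rewrite (geodesic_length PP direction_tangent gE) => -[<-]; exact: opnorm_direction.
by rewrite -(geod_end_direction PY Ypi) // -gP.
Qed.

End MinimalGeodesic.

(** * Block operators *)

Section DirectSum.
Variables (R : realType) (H : hilbertType R).
Implicit Types (z w : hsum H) (x y : H).

Lemma rdot_hsum z w : rdot z w = rdot z.1 w.1 + rdot z.2 w.2.
Proof. by rewrite /rdot -raddfD. Qed.

Lemma hdot_hsum z w : hdot z w = hdot z.1 w.1 + hdot z.2 w.2.
Proof. by []. Qed.

Lemma rnorm_fst z : rnorm z.1 <= rnorm z.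
Proof.
rewrite -(@ler_pXn2r _ 2) ?nnegrE ?rnorm_ge0 // -!rdotxx (rdot_hsum z).
by rewrite lerDl rdotxx_ge0.
Qed.

Lemma rnorm_snd z : rnorm z.2 <= rnorm z.
Proof.
rewrite -(@ler_pXn2r _ 2) ?nnegrE ?rnorm_ge0 // -!rdotxx (rdot_hsum z).
by rewrite lerDr rdotxx_ge0.
Qed.

Definition hinl x : hsum H := (x, 0).
Definition hinr x : hsum H := (0, x).

Let hinl_linear : linear hinl.
Proof. by move=> a x y; congr (_, _); rewrite /= scaler0 addr0. Qed.
Let hinr_linear : linear hinr.
Proof. by move=> a x y; congr (_, _); rewrite /= scaler0 addr0. Qed.

HB.instance Definition _ := GRing.isLinear.Build R[i] H (hsum H) *:%R hinl hinl_linear.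
HB.instance Definition _ := GRing.isLinear.Build R[i] H (hsum H) *:%R hinr hinr_linear.

Lemma hsum_split z : z = hinl z.1 + hinr z.2.
Proof. by case: z => x y; congr (_, _); rewrite /= ?addr0 ?add0r. Qed.

Lemma rnorm_hinl x : rnorm (hinl x) = rnorm x.
Proof.
apply/eqP; rewrite -(@eqrXn2 _ 2) ?rnorm_ge0 // -!rdotxx rdot_hsum /=.
by rewrite rdot0l addr0.
Qed.

Lemma rnorm_hinr x : rnorm (hinr x) = rnorm x.
Proof.
apply/eqP; rewrite -(@eqrXn2 _ 2) ?rnorm_ge0 // -!rdotxx rdot_hsum /=.
by rewrite rdot0l add0r.
Qed.

Lemma block_ex (A : bop (hsum H)) (i : H -> hsum H) (p : hsum H -> H) :
  linear i -> (forall x, rnorm (i x) = rnorm x) ->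
  (forall (a : R[i]) z w, p (a *: z + w) = a *: p z + p w) ->
  (forall z, rnorm (p z) <= rnorm z) ->
  exists a : bop H, forall x, a x = p (A (i x)).
Proof.
move=> il ir pl pr; apply: (@bop_ex _ _ _ (opnorm A)) => [k x y|x].
  by rewrite il linearP pl.
by rewrite (le_trans (pr _)) // (le_trans (rnorm_bop_le _ _)) // ir.
Qed.

Lemma eq_opp_eq0 x : x = - x -> x = 0.
Proof.
move=> xN; apply: rdot_inj => y; have := congr1 (fun u => rdot u y) xN.
by rewrite rdotNl rdot0l => h; lra.
Qed.

Section Blocks.
Variable J : bop (hsum H).
Hypothesis JE : forall z, J z = (z.1, - z.2) :> hsum H.

(** Anticommutation with [J] makes each diagonal block its own opposite. *)
Lemma offdiag_ex A : J * A = - (A * J) -> exists a b, is_offdiag a b A.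
Proof.
move=> JA.
have [||||a aE] := @block_ex A hinr fst;
  [exact: linearP|exact: rnorm_hinr|by []|exact: rnorm_fst|].
have [||||b bE] := @block_ex A hinl snd;
  [exact: linearP|exact: rnorm_hinl|by []|exact: rnorm_snd|].
have JAz z : J (A z) = - A (J z) by exact: (congr1 (fun B : bop (hsum H) => B z) JA).
exists a, b => z; rewrite aE bE.
have l0 x : (A (hinl x)).1 = 0.
  have := JAz (hinl x); rewrite !JE /= oppr0 => /(congr1 fst) /=.
  exact: eq_opp_eq0.
have r0 x : (A (hinr x)).2 = 0.
  have := JAz (hinr x); rewrite !JE /=.
  have -> : ((0, - x) : hsum H) = - hinr x by congr (_, _); rewrite /= oppr0.
  have -> : A (- hinr x) = - A (hinr x) by exact: linearN.
  by rewrite opprK => /(congr1 snd) /= /esym; exact: eq_opp_eq0.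
have -> : A z = A (hinl z.1) + A (hinr z.2) by rewrite -linearD -hsum_split.
by case: (A _) (l0 z.1) (A _) (r0 z.2) => u1 u2 /= -> [u3 u4] /= ->;
  congr (_, _); rewrite /= ?addr0 ?add0r.
Qed.

Lemma diag_ex A : J * A = A * J ->
  exists S S' : bop H, forall z, A z = (S z.1, S' z.2) :> hsum H.
Proof.
move=> JA.
have [||||a aE] := @block_ex A hinl fst;
  [exact: linearP|exact: rnorm_hinl|by []|exact: rnorm_fst|].
have [||||b bE] := @block_ex A hinr snd;
  [exact: linearP|exact: rnorm_hinr|by []|exact: rnorm_snd|].
have JAz z : J (A z) = A (J z) by exact: (congr1 (fun B : bop (hsum H) => B z) JA).
exists a, b => z; rewrite aE bE.
have l0 x : (A (hinl x)).2 = 0.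
  have := JAz (hinl x); rewrite !JE /= oppr0 => /(congr1 snd) /= /esym.
  exact: eq_opp_eq0.
have r0 x : (A (hinr x)).1 = 0.
  have := JAz (hinr x); rewrite !JE /=.
  have -> : ((0, - x) : hsum H) = - hinr x by congr (_, _); rewrite /= oppr0.
  have -> : A (- hinr x) = - A (hinr x) by exact: linearN.
  by move=> /(congr1 fst) /=; exact: eq_opp_eq0.
have -> : A z = A (hinl z.1) + A (hinr z.2) by rewrite -linearD -hsum_split.
by case: (A _) (l0 z.1) (A _) (r0 z.2) => u1 u2 /= -> [u3 u4] /= ->;
  congr (_, _); rewrite /= ?addr0 ?add0r.
Qed.

End Blocks.

End DirectSum.

(** * Polar decomposition of the initial velocity and its blocks *)

Section PolarDirection.
Variables (R : realType) (V : hilbertType R) (P Q : bop V).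
Hypotheses (PP : is_projection P) (QQ : is_projection Q).
Hypotheses (kerP_Q : forall x, P x = 0 -> Q x = x -> x = 0)
           (P_kerQ : forall x, P x = x -> Q x = 0 -> x = 0).

(** The existential hides how [E] and [Th] are built; the block computations use only these
    relations. *)
Lemma direction_polar (J := reflection P) (X := direction PP QQ) :
  exists E Th : bop V,
  [/\ X = E * Th, E * Th = Th * E, E * E * E = E & X * X = Th * Th] /\
  [/\ selfadjoint E, between 0 (pi / 2) Th, J * E = - (E * J), J * Th = Th * J &
      [/\ forall x, X x = 0 -> E x = 0,
      forall t F, isfc 0 (pi / 2) Th (fun x => cos (t * x)) F -> cosb X t = F &
      forall t F, isfc 0 (pi / 2) Th (fun x => sin (t * x)) F -> sinb X t = E * F]].
Proof.
have JK0 := reflections_injective PP QQ kerP_Q P_kerQ.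
exists (signZ (reflection_sqr PP) (reflection_sqr QQ)
  (reflection_selfadjoint PP) (reflection_selfadjoint QQ)).
exists (angleb (reflection P) (reflection Q)).
have JJ := reflection_sqr PP; have KK := reflection_sqr QQ.
have Js := reflection_selfadjoint PP; have Ks := reflection_selfadjoint QQ.
split; split.
- by [].
- exact: signZ_angleb.
- exact: signZ_cube.
- exact: velocityb_sqr.
- exact: signb_selfadjoint.
- exact: angleb_between.
- exact: reflection_signZ.
- exact: reflection_angleb.
split.
- exact: velocityb_eq0.
- exact: cosb_velocityb_angleb.
- exact: sinb_velocityb_angleb.
Qed.

End PolarDirection.

Section DirectionBlocks.
Variables (R : realType) (H : hilbertType R).
(** Here [b] is the adjoint of [a], [w] that of [v], and [S] the absolute value of [b], because
    [S * S = a * b]. *)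
Variables (J X E Th : bop (hsum H)) (a b v w S S' : bop H).
Hypothesis XE : is_offdiag a b X.
Hypothesis EE : is_offdiag w v E.
Hypothesis ThE : forall z : hsum H, Th z = (S z.1, S' z.2) :> hsum H.
Hypotheses (Xs : selfadjoint X) (Es : selfadjoint E).
Hypothesis Th0 : between 0 (pi / 2) Th.
Hypotheses (XETh : X = E * Th) (EThC : E * Th = Th * E) (E3 : E * E * E = E)
  (XX : X * X = Th * Th) (X0 : forall z, X z = 0 -> E z = 0).

Let app (A B : bop (hsum H)) z : A = B -> A z = B z. Proof. by move=> ->. Qed.

Lemma offdiag_adjoint (c d : bop H) (A : bop (hsum H)) : selfadjoint A ->
  is_offdiag c d A -> is_adjoint c d.
Proof.
move=> As Acd x y; have := As (hinr x) (hinl y).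
by rewrite !Acd !hdot_hsum /= !linear0l !linear0r ?linear0 addr0 add0r.
Qed.

Let ba : is_adjoint b a.
Proof. exact/is_adjoint_sym/(offdiag_adjoint Xs XE). Qed.
Let vw : is_adjoint v w.
Proof. exact/is_adjoint_sym/(offdiag_adjoint Es EE). Qed.

Let bvS : b = v * S.
Proof.
apply: bopP => x; have := app (hinl x) XETh.
by rewrite XE !mulbE EE ThE /= => /(congr1 snd).
Qed.

Let vS : v * S = S' * v.
Proof.
apply: bopP => x; have := app (hinl x) EThC.
by rewrite !mulbE ThE EE EE ThE /= => /(congr1 snd).
Qed.

Let SS : S * S = a * b.
Proof.
apply: bopP => x; have := app (hinl x) XX.
by rewrite !mulbE !ThE !XE /= => /(congr1 fst).
Qed.

Let vwv x : v (w (v x)) = v x.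
Proof.
have := app (hinl x) E3.
by rewrite !mulbE !EE /= => /(congr1 snd).
Qed.

Lemma offdiag_opnorm : opnorm a <= opnorm X.
Proof.
apply: opnorm_ler; first exact: opnorm_ge0.
move=> x; rewrite -(rnorm_hinr x) (le_trans _ (rnorm_bop_le _ _)) //.
by rewrite XE /=; exact: (rnorm_fst ((a x, _) : hsum H)).
Qed.

Lemma block_between : between 0 (pi / 2) S.
Proof.
have [/selfadjointP Ths h] := Th0; split.
  apply/selfadjointP => x y; have := Ths (hinl x) (hinl y).
  by rewrite !ThE !rdot_hsum /= rdot0l !rdot0r !addr0.
by move=> x; have := h (hinl x); rewrite ThE !rdot_hsum /= !rdot0r !addr0.
Qed.

Let S0 := block_between.

Lemma block_abs (t : R) : 0 <= t -> is_abs (t%:C *: b) (t%:C *: S).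
Proof.
move=> t0; have [Ss h] := S0; split.
  apply: selfadjoint_positive; first exact: is_adjointZ.
  move=> x; rewrite scalebE rdotZl mulr_ge0 //.
  by have /andP[] := h x; rewrite mul0r.
exists (t%:C *: a); first exact: is_adjointZ.
by rewrite -!scalebAl -!scalebAr SS.
Qed.

Lemma block_polar : is_polar b v S.
Proof.
split=> //.
- by have := block_abs ler01; rewrite !scale1r.
(* [v w v = v] puts [x - w (v x)] in the kernel of [v], to which [x] is orthogonal; this says
   [|x|^2 = |v x|^2]. *)
- move=> x xv; have : hdot x (x - w (v x)) = 0.
    apply: xv; have -> : v (x - w (v x)) = v x - v (w (v x)) by exact: linearB.
    by rewrite vwv subrr.
  rewrite linearBr /= -vw => /eqP; rewrite subr_eq0 !hdotxx => /eqP h.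
  by apply/eqP; rewrite -(@eqrXn2 _ 2) // h.
(* One inclusion of kernels comes from [b = S' * v]. Conversely [b x = 0] puts [hinl x] in the
   kernel of [X], hence of [E]. *)
- move=> x; split=> [vx|bx]; first by rewrite bvS vS mulbE vx linear0.
  have Xx : X (hinl x) = 0 by rewrite XE /= bx linear0.
  by have := X0 Xx; rewrite EE /= => /(congr1 snd).
Qed.

Section Time.
Variable t : R.
Hypothesis t01 : 0 <= t < 1.

Hypothesis cosX : forall F,
  isfc 0 (pi / 2) Th (fun x => cos (t * x)) F -> cosb X t = F.
Hypothesis sinX : forall F,
  isfc 0 (pi / 2) Th (fun x => sin (t * x)) F -> sinb X t = E * F.

Let pi2 : 0 < pi / 2 :> R. Proof. by rewrite divr_gt0 // pi_gt0. Qed.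
(** Strictly between [t pi / 2] and [pi / 2]: cos has no zero on [[0, m]], and [m] is positive even
    at [t = 0]. *)
Let m : R := (1 + t) / 2 * (pi / 2).
Let m0 : 0 < m.
Proof. by case/andP: t01 => t0 t1; rewrite mulr_gt0 // divr_gt0 // ltr_pwDl. Qed.
Let mpi : m < pi / 2.
Proof. by case/andP: t01 => t0 t1; rewrite /m gtr_pMl // ltr_pdivrMr //; lra. Qed.
Let tm x : 0 <= x <= pi / 2 -> 0 <= t * x <= m.
Proof.
case/andP: t01 => t0 t1 /andP[x0 xp]; rewrite mulr_ge0 //= /m.
by rewrite ler_pM // ler_pdivlMr //; lra.
Qed.

Let M : bop H := t%:C *: S.
Let tSM : isfc 0 (pi / 2) S (fun x => t * x) M.
Proof. exact: isfcZ (isfc_id _ _ _). Qed.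
Let bM : between 0 m M.
Proof. exact: (isfc_between pi2 S0 tSM). Qed.

Let cos_gt0 x : 0 <= x <= m -> 0 < cos x.
Proof.
move=> /andP[x0 xm]; apply: cos_gt0_pihalf; rewrite (lt_le_trans _ x0) ?oppr_lt0 //=.
exact: le_lt_trans xm mpi.
Qed.

Let cosV_cont : {within `[0, m], continuous (fun x : R => (cos x)^-1)}.
Proof.
apply/subspace_continuousP => x; rewrite /= in_itv /= => xm.
apply: cvg_within_filter; apply: cvgV; last exact: continuous_cos.
by rewrite gt_eqF // cos_gt0.
Qed.

Let intertwine (f : R -> R) F G : continuous f ->
  isfc 0 m M f F -> isfc 0 (pi / 2) Th (fun x => f (t * x)) G ->
  forall x, G (hinl x) = hinl (F x).
Proof.
move=> fc fF fG x; apply/esym.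
apply: (@isfc_intertwine R H (hsum H) (@hinl R H) 1 _ _ S F Th G _ pi2 S0 Th0 _ _ _
  (isfc_comp tSM tm fF) fG) => [y|y|].
- by rewrite rnorm_hinl mul1r.
- by rewrite ThE /hinl /= linear0.
- exact/continuous_subspaceT/continuous_scaled.
Qed.

Lemma rotation_block cosM sinM : isfc 0 m M cos cosM -> isfc 0 m M sin sinM ->
  (forall x, cosb X t (hinl x) = hinl (cosM x)) /\
  (forall x, sinb X t (hinl x) = hinr (v (sinM x))).
Proof.
move=> cM sM; have fex (f : R -> R) : continuous f ->
    exists F, isfc 0 (pi / 2) Th (fun x => f (t * x)) F.
  by move=> fc; apply: isfc_ex => //; exact/continuous_subspaceT/continuous_scaled.
have [C CP] := fex _ (@continuous_cos R); have [D DP] := fex _ (@continuous_sin R).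
split=> x; first by rewrite (cosX CP) (intertwine (@continuous_cos R) cM CP).
rewrite (sinX DP) mulbE (intertwine (@continuous_sin R) sM DP) EE /hinl /=.
by rewrite linear0.
Qed.

Lemma rotated_graph (P : bop (hsum H)) :
  (forall z, P z = hinl z.1) -> (forall z, J z = (z.1, - z.2) :> hsum H) ->
  (forall s, rotb J X (- s) * rotb J X s = 1) ->
  exists sincM cosM cosMV tanM A : bop H,
    [/\ [/\ is_funcalc (@sinc R) M sincM,
            is_funcalc cos M cosM & is_funcalc tan M tanM],
        cosM * cosMV = 1 /\ cosMV * cosM = 1,
        A = t%:C *: b * sincM * cosMV /\ A = v * tanM &
        range (rotb J X t * P * rotb J X (- t)) = graph setT A].
Proof.
move=> PE JE rotK.
have [cosM cP] := isfc_ex m0 bM (continuous_subspaceT (@continuous_cos R)).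
have [sinM sP] := isfc_ex m0 bM (continuous_subspaceT (@continuous_sin R)).
have [sincM scP] := isfc_ex m0 bM (continuous_subspaceT (@continuous_sinc R)).
have [cosMV cvP] := isfc_ex m0 bM cosV_cont.
(* [tan] unfolds to sine times the inverse of cosine, so this is its calculus on [[0, m]]. *)
have tP := isfcM sP cvP.
have cK : cosM * cosMV = 1.
  rewrite -[1]scale1r -(rmorph1 (real_complex R)).
  apply: (isfc_uniq m0 bM (isfcM cP cvP) (isfc_cst _ _ _ _)) => x /cos_gt0 c0.
  by rewrite mulfV // gt_eqF.
have cC : cosM * cosMV = cosMV * cosM := isfcM_comm m0 bM cP cvP.
exists sincM, cosM, cosMV, (sinM * cosMV), (v * (sinM * cosMV)).
split.
- split; [exact: isfc_funcalc scP|exact: isfc_funcalc cP|].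
  exact: isfc_funcalc tP.
- by split=> //; rewrite -cC.
- split=> //; rewrite bvS.
  have -> : t%:C *: (v * S) = v * M by rewrite scalebAr.
  rewrite -!mulrA; congr (_ * _); rewrite mulrA; congr (_ * _).
  apply: (isfc_uniq m0 bM sP (isfcM (isfc_id _ _ _) scP)) => x _.
  by rewrite /= mulr_sinc.
have [cx sx] := rotation_block cP sP.
have rx x : rotb J X t (hinl x) = (cosM x, v (sinM x)) :> hsum H.
  have Jx : J (hinl x) = hinl x by rewrite JE /hinl /= oppr0.
  rewrite /rotb addbE mulbE Jx cx sx.
  by congr (_, _); rewrite /= ?addr0 ?add0r.
have sC : sinM * cosMV = cosMV * sinM := isfcM_comm m0 bM sP cvP.
move: (rotb J X t) (rotb J X (- t)) rx (rotK t) => U U' rx rK.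
apply/seteqP; split=> [_ [z _ <-]|z [_ zA]].
  rewrite !mulbE PE rx /graph /=; split=> //.
  by rewrite -[cosMV _]/((cosMV * cosM) _) -cC cK.
(* The preimage of [z] is [z] itself in rotated form: [U' * U = 1] makes the rotated projection fix
   it. *)
exists (U (hinl (cosMV z.1))) => //.
have -> : (U * P * U') (U (hinl (cosMV z.1))) =
  U (P ((U' * U) (hinl (cosMV z.1)))) by [].
rewrite rK PE rx.
rewrite -[cosM _]/((cosM * cosMV) _) cK.
by case: z zA => z1 z2 /= ->.
Qed.

End Time.

End DirectionBlocks.

(** * Graphs *)

Section GraphProjections.
Variables (R : realType) (H : hilbertType R) (D : set H) (T : H -> H).
Hypotheses (denseD : dense D) (closedT : closed_operator D T).

(** For [x] nonzero, a point [y] of [D] closer to [x] than [|x|] would give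
    [|x|^2 = <x, x - y> < |x|^2]. *)
Lemma dense_orthogonal (x : H) : (forall y, D y -> rdot x y = 0) -> x = 0.
Proof.
move=> xD; apply/eqP/negPn/negP; rewrite -rnorm_eq0 => x0.
have xp : 0 < rnorm x by rewrite lt_neqAle eq_sym x0 rnorm_ge0.
have e0 : (0 : R[i]) < (rnorm x)%:C by rewrite ltcR.
have [|y [xy /xD Dy]] := denseD _ (ball_open x (rnorm x)%:C).
  by exists x; exact: ballxx.
move: xy; rewrite -ball_normE /= rnormE ltcR => xy.
have := rdot_le x (x - y); rewrite rdotBr Dy subr0 rdotxx expr2.
by rewrite leNgt ltr_pM2l // xy.
Qed.

Lemma linear_on0 : T 0 = 0.
Proof.
have [[D0 lin] _] := closedT; have [_] := lin 1 0 0 D0 D0.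
by rewrite !scale1r addr0 => /esym/eqP; rewrite addrC -subr_eq0 addrK => /eqP.
Qed.

Lemma graph_projection_ex : exists Q, is_projection_onto (graph D T) Q.
Proof.
have [[D0 lin] Gc] := closedT; apply: projection_ex => //.
  by split=> //=; rewrite linear_on0.
move=> c x y [Dx xT] [Dy yT]; have [Dc Tc] := lin c _ _ Dx Dy.
by split; rewrite /= ?xT ?yT ?Tc.
Qed.

Lemma horizontal_projection_ex : exists P : bop (hsum H),
  (forall z, P z = hinl z.1) /\ is_projection_onto (graph setT (0 : bop H)) P.
Proof.
have [||P PE] := @bop_ex R (hsum H) (fun z => hinl z.1) 1.
- by move=> c z w; rewrite -linearP.
- by move=> z; rewrite rnorm_hinl mul1r rnorm_fst.
exists P; split=> //; split; first split.
- by apply: bopP => z; rewrite mulbE !PE.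
- apply/selfadjointP => z w; rewrite !PE !rdot_hsum /=.
  by rewrite rdot0l rdot0r.
apply/seteqP; split=> [_ [z _ <-]|[x y] [_ /= ->]]; first by rewrite PE.
by exists (hinl x) => //; rewrite PE.
Qed.

End GraphProjections.

Theorem theorem5p10 (R : realType) (H : hilbertType R)
    (D : set H) (T : H -> H) (denseD : dense D) (closedT : closed_operator D T) :
  exists g : R -> bop (hsum H),
    [/\ minimal_geodesic g,
        is_projection_onto (graph setT (0 : bop H)) (g 0),
        is_projection_onto (graph D T) (g 1),
        (forall g' : R -> bop (hsum H),
           minimal_geodesic g' ->
           is_projection_onto (graph setT (0 : bop H)) (g' 0) ->
           is_projection_onto (graph D T) (g' 1) ->
           forall t : R, t \in `[0, 1] -> g' t = g t) &
        exists (X : bop (hsum H)) (a b v S : bop H),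
          [/\ quotients g 0 --> X,
              is_adjoint a b /\ is_offdiag a b X,
              opnorm a <= pi / 2,
              is_polar b v S &
              forall t : R, t \in `[0, 1[ ->
                exists M sincM cosM cosMV tanM A : bop H,
                  [/\ is_abs (t%:C *: b) M,
                      [/\ is_funcalc (@sinc R) M sincM,
                          is_funcalc cos M cosM & is_funcalc tan M tanM],
                      cosM * cosMV = 1 /\ cosMV * cosM = 1,
                      A = t%:C *: b * sincM * cosMV /\ A = v * tanM &
                      is_projection_onto (graph setT A) (g t)]]].
Proof.
have [P [PE PG]] := horizontal_projection_ex H.
have [Q QG] := graph_projection_ex closedT.
have PP := PG.1; have QQ := QG.1.
(* A vector [(0, y)] of the graph has [y = T 0 = 0]. *)
have kerP_Q x : P x = 0 -> Q x = x -> x = 0.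
  rewrite PE => /(congr1 fst) /= x1 /(projection_fix x QG)[_].
  by case: x x1 => x1 x2 /= -> ->; rewrite (linear_on0 closedT).
(* A horizontal vector orthogonal to the graph has its first component orthogonal to the dense
   domain. *)
have P_kerQ x : P x = x -> Q x = 0 -> x = 0.
  rewrite PE => xE Qx; rewrite -xE; suff -> : x.1 = 0 by exact: linear0.
  apply: (dense_orthogonal denseD) => y Dy.
  have [_ /selfadjointP Qs] := QQ.
  have Gy : graph D T (y, T y) by split.
  have := Qs x (y, T y); rewrite Qx rdot0l ((projection_fix _ QG).1 Gy).
  by rewrite -xE rdot_hsum /= rdot0l addr0.
pose X := direction PP QQ.
have PX : tangent P X := direction_tangent PP QQ.
have g0 := geod_start PP PX.
have g1 := geod_direction_end PP QQ kerP_Q P_kerQ.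
exists (geod P X); split.
- exact: direction_minimal.
- by rewrite g0.
- by rewrite g1.
- move=> g' g'min g'0 g'1; apply: (minimal_geodesic_uniq PP QQ kerP_Q P_kerQ) => //.
    exact: projection_uniq g'0 PG.
  exact: projection_uniq g'1 QG.
have JX := reflectionX PX.
have JXP := And4 (reflection_sqr PP) (reflection_selfadjoint PP) PX.1 JX.
have JE z : reflection P z = (z.1, - z.2) :> hsum H.
  rewrite /reflection !bopE PE; case: z => x y.
  by congr (_, _); rewrite /= ?addr0 ?sub0r // addrK.
have [E [Th [[XETh EThC E3 XX] [Es Th0 JEE JTh [X0 cX sX]]]]] :=
  direction_polar PP QQ kerP_Q P_kerQ.
have [a [b XE]] := offdiag_ex JE JX.
have [w [v EE]] := offdiag_ex JE JEE.
have [S [S' ThE]] := diag_ex JE JTh.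
have Xpi := opnorm_direction PP QQ kerP_Q P_kerQ.
exists X, a, b, v, S; split.
- have gE : {in `[0, 1], forall t : R, geod P X t = geod P X t} by [].
  have l0 : 0 \in `[0, 1 : R] by rewrite bound_itvE ler01.
  have := geodesic_quotients PP PX gE l0.
  by rewrite /geod_velocity addr0 oppr0 (rotb0 JXP) mulr1.
- by split=> //; exact: offdiag_adjoint PX.1 XE.
- exact: le_trans (offdiag_opnorm XE) Xpi.
- exact: (block_polar XE EE ThE PX.1 Es Th0 XETh EThC E3 XX X0).
move=> t; rewrite in_itv /= => t01.
have rotK s := rotbKN JXP s.
have [sincM [cosM [cosMV [tanM [A [fcs cK AE rA]]]]]] :=
  rotated_graph XE EE ThE Th0 XETh t01 (cX t) (sX t) PE JE rotK.
exists (t%:C *: S), sincM, cosM, cosMV, tanM, A; split=> //.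
  by apply: (block_abs XE ThE PX.1 Th0 XX); case/andP: t01.
split; first exact: (geod_projection PP PX).
by rewrite -rA (geod_rot PP PX).
Qed.
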